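(* Let $n\ge 2$, let $B_1\subset\mathbb{R}^n$ be the open unit ball, let $f\colon[0,+\infty)\to[0,\infty)$ be a $C^2$ function with $f'>0$ in $(0,+\infty)$, let $\lambda\ge 0$, and let $(\alpha_\lambda,\psi_\lambda)$ be a solution of the constrained problem on $\Omega=B_1$ described in the context, with associated weight $V_\lambda=f'(\alpha_\lambda+\lambda\psi_\lambda)$. Then, for every integer $k\ge1$, any $k$-th radial eigenfunction of $L_\lambda$ has at most $2k$ generalized nodal domains.
   Context: Constrained problem. A solution is a pair $(\alpha_\lambda,\psi_\lambda)$ with $\alpha_\lambda\in\mathbb{R}$, $\alpha_\lambda>0$, and $\psi_\lambda\in C^2(\overline{B_1})$ such that $-\Delta\psi_\lambda=f(\alpha_\lambda+\lambda\psi_\lambda)$ in $B_1$, $\int_{B_1}f(\alpha_\lambda+\lambda\psi_\lambda)\,dx=1$, $\psi_\lambda>0$ in $B_1$, and $\psi_\lambda=0$ on $\partial B_1$. On the ball, $\psi_\lambda$ is radial by the theorem of Gidas–Ni–Nirenberg, so $V_\lambda:=f'(\alpha_\lambda+\lambda\psi_\lambda)$ is a radial function, and $V_\lambda>0$ on $\overline{B_1}$. Notation. $\langle\phi\rangle_\lambda:=\frac{\int_{B_1}V_\lambda\phi\,dx}{\int_{B_1}V_\lambda\,dx}$ and $[\phi]_\lambda:=\phi-\langle\phi\rangle_\lambda$. Eigenvalues. The linearized operator is $L_\lambda(\phi)=-\Delta\phi-\lambda V_\lambda[\phi]_\lambda$. A number $\sigma\in\mathbb{R}$ is an eigenvalue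 with eigenfunction $\phi\in H^1_0(B_1)\setminus\{0\}$ if $\phi$ is a weak solution of $-\Delta\phi-\lambda V_\lambda[\phi]_\lambda=\sigma V_\lambda[\phi]_\lambda$ in $B_1$. Enumeration of radial eigenfunctions. Only radial eigenfunctions are enumerated (non-radial ones are not counted). Let $H$ be the space of radial functions in $H^1_0(B_1)$. The radial eigenvalues $\sigma_1\le\sigma_2\le\cdots$ (counted with multiplicity) are defined inductively by $$\sigma_k=\min\left\{\frac{\int_{B_1}|\nabla\phi|^2-\lambda\int_{B_1}V_\lambda[\phi]_\lambda^2}{\int_{B_1}V_\lambda[\phi]_\lambda^2}\ :\ \phi\in H\setminus\{0\},\ \big\langle[\phi]_\lambda[\phi_j]_\lambda\big\rangle_\lambda=0\ \text{for all }1\le j\le k-1\right\},$$ where $\phi_j$ is an eigenfunction realizing the minimum $\sigma_j$. A $k$-th radial eigenfunction is a radial eigenfunction of $\sigma_k$. A radial eigenfunction is written $\phi=\phi(r)$, $r=|x|\in[0,1]$. Singular points. Let $\phi$ be a radial eigenfunction with $\langle\phi\rangle_\lambda>0$. A singular point of $\phi$ is a point $r_0\in[0,1]$ with $\phi(r_0)=0$, $\phi'(r_0)=0$, $\phi''(r_0)>0$. Generalized nodal domains. Let $\phi$ be a radial eigenfunction with $\langle\phi\rangle_\lambda>0$. A generalized nodal domain of $\phi$ is a radial domain $\Omega_0\subseteq B_1$ (a ball centered at the origin or an open spherical shell centered at the origin) such that: (i) $\phi\equiv0$ on $\partial\Omega_0$, and $\partial_r\phi\ne0$ on each boundary sphere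 of $\Omega_0$ of radius $r\in[0,1)$; (ii) in $\Omega_0$ either $\phi\ge0$ or $\phi\le0$; (iii) if $\phi\le0$ in $\Omega_0$, then $\phi<0$ in $\Omega_0$; (iv) if $\phi\ge0$ in $\Omega_0$, then $\phi>0$ in $\Omega_0$ possibly with the exception of finitely many spheres $\{|x|=r_i\}$ such that each $r_i$ is a singular point of $\phi$. If $\Omega_0$ is a ball $B_r(0)$, the boundary condition is just $\phi(r)=0$. Convention: if $\langle\phi\rangle_\lambda<0$, the generalized nodal domains of $\phi$ are those of $-\phi$. (A radial eigenfunction on $B_1$ always has $\langle\phi\rangle_\lambda\ne0$.) *)

(* Defs.v *)
From HB Require Import structures.
From mathcomp Require Import all_boot all_order all_algebra.
From mathcomp Require Import all_classical all_reals all_analysis.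

Set Implicit Arguments.
Unset Strict Implicit.
Unset Printing Implicit Defensive.

Import Order.TTheory GRing.Theory Num.Theory.
Import numFieldNormedType.Exports.

Local Open Scope classical_set_scope.
Local Open Scope ring_scope.

Section measurable_row.
Context d (T : sigmaRingType d) (n : nat).

Let coors : 'I_n -> 'rV[T]_n -> T := fun i x => x ord0 i.

HB.instance Definition _ := @isMeasurable.Build (measure_tuple_display d)
  'rV[T]_n (g_sigma_preimage coors) (@sigma_algebra0 _ _ _)
  (@sigma_algebraC _ _) (@sigma_algebra_bigcup _ _ _).

End measurable_row.

Section row_measurability.
Context d (T : measurableType d).

Lemma measurable_row_coord n (i : 'I_n) :
  measurable_fun [set: 'rV[T]_n] (fun x : 'rV[T]_n => x ord0 i).
Proof.
move=> _ Y mY; rewrite setTI; apply: sub_sigma_algebra => /=.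
rewrite -bigcup_seq/=; exists i => /=; first by rewrite mem_index_enum.
by exists Y => //; rewrite setTI.
Qed.

Lemma measurable_fun_rowP d1 (T1 : measurableType d1) n (g : T1 -> 'rV[T]_n) :
  (forall i, measurable_fun [set: T1] (fun x => g x ord0 i)) ->
  measurable_fun [set: T1] g.
Proof.
move=> mg _ Y mY; rewrite setTI.
pose G := [set A : set 'rV[T]_n | measurable (g @^-1` A)].
suff : measurable `<=` G by apply.
apply: smallest_sub => /=.
  split.
  - by rewrite /G /= preimage_set0.
  - by move=> A; rewrite /G /= setTD preimage_setC; exact: measurableC.
  - move=> F mF; rewrite /G /= preimage_bigcup.
    by apply: bigcupT_measurable => i; exact: mF.
rewrite -bigcup_seq => A [i _ [B mB <-]]; rewrite /G /= setTI.
by have := mg i measurableT _ mB; rewrite setTI.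
Qed.

End row_measurability.

Section volume.
Context (R : realType).
Local Open Scope ereal_scope.

Definition row_cons n (p : measurableTypeR R * 'rV[R]_n) : 'rV[R]_n.+1 :=
  row_mx (p.1)%:M p.2 : 'rV[R]_(1 + n).

Lemma measurable_row_cons n : measurable_fun [set: measurableTypeR R * 'rV[R]_n] (@row_cons n).
Proof.
apply: measurable_fun_rowP => i.
rewrite (_ : (fun x => _) = fun x : measurableTypeR R * 'rV[R]_n =>
  match fintype.split (i : 'I_(1 + n)) with inl _ => x.1 | inr j => x.2 ord0 j end).
  case: (fintype.split _) => j; first exact: measurable_fst.
  apply: (@measurableT_comp _ _ _ _ _ _ (fun x : 'rV[R]_n => x ord0 j)) => //.
  exact: measurable_row_coord.
apply/funext => x; rewrite /row_cons mxE; case: (fintype.split _) => // j.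
by rewrite mxE !ord1.
Qed.

Definition row_uncons n (x : 'rV[R]_n.+1) : measurableTypeR R * 'rV[R]_n :=
  (x ord0 ord0, rsubmx (x : 'rV[R]_(1 + n))).

Lemma row_cons0 n t (y : 'rV[R]_n) : row_cons (t, y) ord0 ord0 = t.
Proof.
by rewrite mxE; case: fintype.splitP => // j _; rewrite mxE !ord1 eqxx.
Qed.

Lemma row_consS n t (y : 'rV[R]_n) i :
  row_cons (t, y) ord0 (lift ord0 i) = y ord0 i.
Proof.
rewrite mxE; case: fintype.splitP => [j|j [ij]]; first by rewrite ord1.
by congr (y _ _); exact/val_inj.
Qed.

Lemma row_consK n : cancel (@row_cons n) (@row_uncons n).
Proof.
move=> [t y]; rewrite /row_cons /row_uncons /=; congr pair.
  exact: row_cons0.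
by rewrite row_mxKr.
Qed.

Lemma row_unconsK n : cancel (@row_uncons n) (@row_cons n).
Proof.
move=> x; apply/rowP => i; rewrite /row_uncons.
case: (unliftP ord0 i) => [j ->|->]; last by rewrite row_cons0.
by rewrite row_consS mxE; congr (x _ _); exact/val_inj.
Qed.

Lemma measurable_row_uncons n :
  measurable_fun [set: 'rV[R]_n.+1] (@row_uncons n).
Proof.
apply/measurable_fun_pair; first exact: measurable_row_coord.
apply: measurable_fun_rowP => i.
rewrite (_ : (fun x => _) = fun x : 'rV[R]_n.+1 =>
  x ord0 (rshift 1 i : 'I_(1 + n))); first exact: measurable_row_coord.
by apply/funext => x; rewrite mxE.
Qed.

(* n-dimensional Lebesgue measure on the Borel sets *)
Fixpoint volume (n : nat) : set 'rV[R]_n -> \bar R :=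
  match n with
  | 0 => dirac (0%R : 'rV[R]_0)
  | m.+1 => pushforward
      (@product_measure1 _ _ (measurableTypeR R) 'rV[R]_m R
        lebesgue_measure (@volume m))
      (@row_cons m)
  end.

Section volume_step.
Variables (n : nat) (m : {sigma_finite_measure set 'rV[R]_n -> \bar R}).

Let p := pushforward (lebesgue_measure \x m) (@row_cons n).

Let p0 : p set0 = 0.
Proof. by rewrite /p /pushforward preimage_set0 measure0. Qed.

Let p_ge0 A : 0 <= p A.
Proof. exact: (measure_ge0 (lebesgue_measure \x m)). Qed.

Let p_sigma_additive : semi_sigma_additive p.
Proof.
have mf := @measurable_row_cons n.
move=> F mF tF mUF; rewrite /p /pushforward preimage_bigcup.
apply: (measure_semi_sigma_additive (s := lebesgue_measure \x m)).
- by move=> i; rewrite -[X in measurable X]setTI; exact: mf.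
- apply/trivIsetP => /= i j _ _ ij; rewrite -preimage_setI.
  by move/trivIsetP : tF => /(_ _ _ _ _ ij) ->//; rewrite preimage_set0.
- by rewrite -preimage_bigcup -[X in measurable X]setTI; exact: mf.
Qed.

HB.instance Definition _ := isMeasure.Build _ _ _ p p0 p_ge0 p_sigma_additive.

Let p_sigma_finite : sigma_finite setT p.
Proof.
have [F [FT mF]] : exists F : (set (measurableTypeR R * 'rV[R]_n))^nat,
    setT = \bigcup_i F i /\
    forall i, measurable (F i) /\ (lebesgue_measure \x m) (F i) < +oo.
  have /sigma_finiteP[F [TF ndF Foo]] := sigma_finiteT (@lebesgue_measure R).
  have /sigma_finiteP[G [TG ndG Goo]] := sigma_finiteT m.
  exists (fun i => F i `*` G i); split.
    rewrite -setXTT TF TG predeqE => -[x y]; split.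
      move=> [/= [i _ Fix] [k _ Gky]]; exists (maxn i k) => //; split.
        by move: x Fix; exact/subsetPset/ndF/leq_maxl.
      by move: y Gky; exact/subsetPset/ndG/leq_maxr.
    by move=> [i _ []/= ? ?]; split; exists i.
  move=> k; have [? ?] := Foo k; have [? ?] := Goo k.
  split; first exact: measurableX.
  by rewrite product_measure1E// lte_mul_pinfty// ge0_fin_numE.
exists (fun i => @row_uncons n @^-1` F i).
  by rewrite -preimage_bigcup -FT preimage_setT.
move=> i; split.
  by rewrite -[X in measurable X]setTI; apply: measurable_row_uncons => //;
    exact: (mF i).1.
rewrite /p /pushforward -comp_preimage (_ : _ \o _ = id) ?preimage_id.
  exact: (mF i).2.
by apply/funext => x /=; rewrite row_consK.
Qed.

HB.instance Definition _ := Measure_isSigmaFinite.Build _ _ _ p p_sigma_finite.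

Definition volume_step : {sigma_finite_measure set 'rV[R]_n.+1 -> \bar R} := p.

End volume_step.

Section volume_measure.
Variable n : nat.

Let volumeP : exists m : {sigma_finite_measure set 'rV[R]_n -> \bar R},
  @volume n = m.
Proof.
elim: n => [|k [m mE]]; first by exists (dirac (0%R : 'rV[R]_0)).
by exists (volume_step m); rewrite /= mE.
Qed.

Let volume0 : @volume n set0 = 0.
Proof. by have [m ->] := volumeP; rewrite measure0. Qed.

Let volume_ge0 A : 0 <= @volume n A.
Proof. by have [m ->] := volumeP; exact: measure_ge0. Qed.

Let volume_sigma_additive : semi_sigma_additive (@volume n).
Proof. by have [m ->] := volumeP; exact: measure_semi_sigma_additive. Qed.

HB.instance Definition _ := isMeasure.Build _ _ _
  (@volume n) volume0 volume_ge0 volume_sigma_additive.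

Let volume_sigma_finite : sigma_finite setT (@volume n).
Proof. by have [m ->] := volumeP; exact: sigma_finiteT. Qed.

HB.instance Definition _ :=
  Measure_isSigmaFinite.Build _ _ _ (@volume n) volume_sigma_finite.

End volume_measure.

Lemma volume_box n (a b : 'rV[R]_n) : (forall i, a ord0 i <= b ord0 i)%R ->
  volume [set x : 'rV[R]_n | forall i, (a ord0 i <= x ord0 i <= b ord0 i)%R] =
  (\prod_(i < n) (b ord0 i - a ord0 i))%:E.
Proof.
elim: n a b => [|n IHn] a b ab.
  by rewrite big_ord0 /= diracE mem_set// => -[].
pose a' := (row_uncons a).2; pose b' := (row_uncons b).2.
have a'E i : a' ord0 i = a ord0 (lift ord0 i).
  by rewrite /a' mxE; congr (a _ _); exact/val_inj.
have b'E i : b' ord0 i = b ord0 (lift ord0 i).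
  by rewrite /b' mxE; congr (b _ _); exact/val_inj.
have mbox : measurable [set y : 'rV[R]_n |
    forall i, (a' ord0 i <= y ord0 i <= b' ord0 i)%R].
  rewrite (_ : [set _ | _] = \bigcap_(i in [set: 'I_n])
    (setT `&` (fun y : 'rV[R]_n => y ord0 i) @^-1` `[a' ord0 i, b' ord0 i])).
    apply: fin_bigcap_measurable => // i _.
    by apply: measurable_row_coord.
  apply/seteqP; split=> y /= h i; first by move=> _; rewrite /= in_itv /= h.
  by have [_ /=] := h i I; rewrite in_itv.
rewrite /= /pushforward (_ : _ @^-1` _ = `[a ord0 ord0, b ord0 ord0] `*`
  [set y : 'rV[R]_n | forall i, (a' ord0 i <= y ord0 i <= b' ord0 i)%R]).
  rewrite product_measure1E//= IHn; last by move=> i; rewrite a'E b'E.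
  rewrite lebesgue_measure_itv /= lte_fin big_ord_recl; case: ltP => [_|ba].
    by rewrite EFinM; congr (_ * _%:E); apply: eq_bigr => i _; rewrite a'E b'E.
  have -> : a ord0 ord0 = b ord0 ord0 by apply/eqP; rewrite eq_le ab ba.
  by rewrite subrr mul0r mul0e.
apply/seteqP; split=> [[t y] /= h|[t y] /= [ht hy] i].
  split; first by have := h ord0; rewrite row_cons0 in_itv.
  by move=> i; have := h (lift ord0 i); rewrite row_consS a'E b'E.
case: (unliftP ord0 i) => [j ->|->]; last by rewrite row_cons0; rewrite in_itv in ht.
by rewrite row_consS -a'E -b'E.
Qed.

End volume.

Section relative_derivative.
Context (R : realType).
Implicit Types (D : set R) (f : R -> R) (x : R).

(* difference quotients restricted to D, hence one-sided at an endpoint of an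
   interval D *)
Definition quotient_in D f x : set_system R :=
  (f t - f x) / (t - x) @[t --> within D x^'].

Definition derivable_in D f x := cvg (quotient_in D f x).

Definition deriv_in D f x : R := lim (quotient_in D f x).

Definition C2_in D f :=
  [/\ forall x, D x -> derivable_in D f x,
      forall x, D x -> derivable_in D (deriv_in D f) x &
      {within D, continuous (deriv_in D (deriv_in D f))}].

End relative_derivative.

Section unit_ball.
Context (R : realType) (n : nat).
Implicit Types (u v : 'rV[R]_n -> R) (V : 'rV[R]_n -> R).

(* the library norm `|x| on 'rV_n is the sup norm *)
Definition enorm (x : 'rV[R]_n) : R := Num.sqrt (\sum_i x ord0 i ^+ 2).

Definition B1 : set 'rV[R]_n := [set x | enorm x < 1].

Definition cB1 : set 'rV[R]_n := [set x | enorm x <= 1].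

Definition pderiv (i : 'I_n) u : 'rV[R]_n -> R := 'D_(delta_mx ord0 i) u.

Definition pderivs (s : seq 'I_n) u : 'rV[R]_n -> R := foldr pderiv u s.

Definition laplacian u (x : 'rV[R]_n) : R := \sum_i pderiv i (pderiv i u) x.

(* C^2 on the closed ball: the partial derivatives of order at most 2 exist in
   the open ball and extend continuously to the closed ball *)
Definition C2_closed_ball u :=
  [/\ {within cB1, continuous u},
      forall (s : seq 'I_n) i x, (size s < 2)%N -> B1 x ->
        derivable (pderivs s u) x (delta_mx ord0 i) &
      forall s : seq 'I_n, (size s <= 2)%N ->
        exists g : 'rV[R]_n -> R, {within cB1, continuous g} /\
          forall x, B1 x -> g x = pderivs s u x].

Definition test_function u :=
  [/\ forall s : seq 'I_n, continuous (pderivs s u),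
      forall (s : seq 'I_n) i x,
        derivable (pderivs s u) x (delta_mx ord0 i),
      compact (closure [set x | u x != 0]) &
      closure [set x | u x != 0] `<=` B1].

Definition intB u : R := \int[@volume R n]_(x in B1) u x.

Definition ae_B1 (P : 'rV[R]_n -> Prop) :=
  {ae @volume R n, forall x, B1 x -> P x}.

Definition L2 u := measurable_fun B1 u /\
  (@volume R n).-integrable B1 (fun x => (u x ^+ 2)%:E).

Definition weak_gradient u (G : 'I_n -> 'rV[R]_n -> R) :=
  forall i, L2 (G i) /\
    forall th, test_function th ->
      intB (fun x => u x * pderiv i th x) = - intB (fun x => G i x * th x).

(* weak_gradient determines G up to null sets *)
Definition wgrad u : 'I_n -> 'rV[R]_n -> R :=
  xget (fun _ _ => 0) [set G | weak_gradient u G].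

Definition sobolevH1 u := L2 u /\ exists G, weak_gradient u G.

(* closure of the test functions for the H^1 norm *)
Definition sobolevH10 u := sobolevH1 u /\
  exists th : nat -> 'rV[R]_n -> R,
    [/\ forall m, test_function (th m),
        intB (fun x => (th m x - u x) ^+ 2) @[m --> \oo] --> 0 &
        forall i, intB (fun x => (pderiv i (th m) x - wgrad u i x) ^+ 2)
                    @[m --> \oo] --> 0].

Definition grad_dot u v (x : 'rV[R]_n) : R := \sum_i wgrad u i x * wgrad v i x.

Definition radial u := exists p : R -> R, ae_B1 (fun x => u x = p (enorm x)).

Definition nonzero u := ~ ae_B1 (fun x => u x = 0).

Definition constrained_solution (f : R -> R) (lam alpha : R) psi :=
  [/\ 0 < alpha /\ C2_closed_ball psi,
      forall x, B1 x -> - laplacian psi x = f (alpha + lam * psi x),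
      intB (fun x => f (alpha + lam * psi x)) = 1,
      forall x, B1 x -> 0 < psi x &
      forall x, enorm x = 1 -> psi x = 0].

Definition avg V u : R := intB (fun x => V x * u x) / intB V.

Definition centred V u : 'rV[R]_n -> R := fun x => u x - avg V u.

Definition eigenfunction (lam : R) V (sigma : R) u :=
  [/\ sobolevH10 u, nonzero u &
      forall v, sobolevH10 v ->
        intB (grad_dot u v) - lam * intB (fun x => V x * centred V u x * v x) =
        sigma * intB (fun x => V x * centred V u x * v x)].

Definition rayleigh (lam : R) V u : R :=
  (intB (grad_dot u u) - lam * intB (fun x => V x * centred V u x ^+ 2)) /
  intB (fun x => V x * centred V u x ^+ 2).

Definition admissible V (phi : nat -> 'rV[R]_n -> R) (k : nat) u :=
  [/\ sobolevH10 u, radial u, nonzero u &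
      forall j, (1 <= j < k)%N ->
        avg V (fun x => centred V u x * centred V (phi j) x) = 0].

(* sigma j, phi j, for 1 <= j <= k, are produced by the inductive min-max
   scheme *)
Definition radial_enumeration (lam : R) V (k : nat)
    (sigma : nat -> R) (phi : nat -> 'rV[R]_n -> R) :=
  forall j, (1 <= j <= k)%N ->
    [/\ admissible V phi j (phi j),
        eigenfunction lam V (sigma j) (phi j),
        sigma j = rayleigh lam V (phi j) &
        forall u, admissible V phi j u -> sigma j <= rayleigh lam V u].

Definition kth_radial_eigenfunction (lam : R) V (k : nat) u :=
  exists sigma phi, [/\ radial_enumeration lam V k sigma phi,
    radial u & eigenfunction lam V (sigma k) u].

(* continuous representative of a radial eigenfunction, as a function of the
   radius *)
Definition radial_profile u (p : R -> R) :=
  {within `[0, 1], continuous p} /\ ae_B1 (fun x => u x = p (enorm x)).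

Definition singular_point (p : R -> R) (r : R) :=
  [/\ 0 <= r <= 1, p r = 0, deriv_in `[0, 1] p r = 0 &
      0 < deriv_in `[0, 1] (deriv_in `[0, 1] p) r].

(* rad is the set of radii of the boundary spheres of Om *)
Definition radial_domain (Om : set 'rV[R]_n) (rad : set R) :=
  (exists b, [/\ 0 < b <= 1, Om = [set x | enorm x < b] & rad = [set b]]) \/
  (exists a b, [/\ 0 <= a < b, b <= 1, Om = [set x | a < enorm x < b] &
     rad = [set a; b]]).

Definition nodal_domain_of_profile (p : R -> R) (Om : set 'rV[R]_n) :=
  exists rad, radial_domain Om rad /\
  [/\ forall r, rad r -> p r = 0 /\ (r < 1 -> deriv_in `[0, 1] p r != 0),
      (forall x, Om x -> 0 <= p (enorm x)) \/
        (forall x, Om x -> p (enorm x) <= 0),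
      (forall x, Om x -> p (enorm x) <= 0) ->
        forall x, Om x -> p (enorm x) < 0 &
      (forall x, Om x -> 0 <= p (enorm x)) ->
        exists s : seq R, (forall r, r \in s -> singular_point p r) /\
          forall x, Om x -> enorm x \notin s -> 0 < p (enorm x)].

Definition generalized_nodal_domain V u (Om : set 'rV[R]_n) :=
  exists p, radial_profile u p /\
    ((0 < avg V u /\ nodal_domain_of_profile p Om) \/
     (avg V u < 0 /\ nodal_domain_of_profile (fun r => - p r) Om)).

End unit_ball.

(* Main.v *)
Require Import Defs.
From mathcomp Require Import all_boot all_order all_algebra.
From mathcomp Require Import all_classical all_reals all_analysis.
From mathcomp Require Import measurable_realfun ring lra.

Set Implicit Arguments.
Unset Strict Implicit.
Unset Printing Implicit Defensive.

Import Order.TTheory GRing.Theory Num.Theory.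
Import numFieldNormedType.Exports.

Local Open Scope classical_set_scope.
Local Open Scope ring_scope.

(* Let [phi] have positive average [c], let [lam + sigma] be its (positive)
   spectral parameter, and let [G] be a smooth function vanishing on [t <= e] and
   within [2 * e < c] of the identity on [t >= 0], with [0 <= G' <= 1].  If [phi] is
   positive somewhere on each of m disjoint radial intervals at whose ends it is
   nonpositive, the functions [G(phi) chi_i], with [chi_i] a radial cutoff of the
   i-th interval, span a space of dimension m on which the equation of [phi],
   tested against [G(phi) X^2], makes
   [int |grad u|^2 - (lam + sigma) * int V u^2] negative.  If m > k, this space meets
   the k conditions of zero mean and orthogonality to the first k-1
   eigenfunctions, contradicting the minimality of [sigma]; hence m <= k.
   This bounds the positive domains at once, since they are disjoint: a zero
   inside one of them is singular, whereas the derivative does not vanish on the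
   bounding spheres.  For the negative domains, a barrier argument shows that
   [phi] is not negative near the unit sphere, so that each of them is followed by
   a zone where [phi] is positive, and these zones lie in disjoint intervals whose
   ends are radii of domains, or 1. *)

(** * Smooth functions *)

(** The constant [c] gives the two signs of [phi] different roles. The energy bound compares
    [G(phi)^2] with [(phi - c) G(phi)], and their difference [G(phi) (G(phi) - phi + c)] is positive
    wherever [phi > e], because [G(t) >= t - 2 * e] and [2 * e < c]. For [- phi] the constant enters
    with the opposite sign and the comparison fails; so a negative domain yields no test function of
    its own and has to be charged to a positive zone next to it. The truncation at level [e] removes
    every question about the ends of the intervals. A radial profile is only known to be continuous,
    but near an end where it is nonpositive it stays below [e]; there [G(phi)] vanishes and [chi_i]
    is free to pass from 0 to 1. Hence the gradient of [chi_i] never meets [G(phi)]. Taking [G]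
    smooth with Lipschitz derivative, instead of the positive part, keeps the chain rule in [H^1_0]
    within reach of approximation by test functions. *)

Section flat.
Context {R : realType}.
Implicit Types (P : {poly R}) (t y : R).

(* The class of functions [P(1/t) exp(-1/t)] on the positive half-line is stable
   under differentiation, so all its members are smooth on the whole line. *)
Definition flat P t : R := if 0 < t then P.[t^-1] * expR (- t^-1) else 0.

(** With [y = 1/t] one has [dy/dt = - y^2], so the derivative of [P(y) exp(-y)] is
    [y^2 (P(y) - P'(y)) exp(-y)]. *)
Definition dflat P : {poly R} := 'X^2 * (P - P^`()).

(** For [y > 1] one power is given away, [y ^+ n <= y ^+ n.+1], and the term of degree [n.+1] of the
    exponential series bounds the latter. *)
Lemma exprn_expRN_le n y : 0 <= y -> `|y ^+ n * expR (- y)| <= n.+1`!%:R + 1.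
Proof.
move=> y0; rewrite ger0_norm ?mulr_ge0 ?exprn_ge0 ?expR_ge0// expRN.
rewrite ler_pdivrMr ?expR_gt0//.
have e1 := expR_ge1Dx y; have e0 := expR_gt0 y.
have f0 : 0 <= n.+1`!%:R :> R by [].
have [y1|y1] := leP y 1.
  have : y ^+ n <= 1 by rewrite exprn_ile1.
  nra.
have := expR_ge1Dxn n y0.
rewrite -lerBrDl ler_pdivrMr ?ltr0n ?fact_gt0// => h.
have yn : y ^+ n <= y ^+ n.+1 by rewrite exprS ler_peMl ?exprn_ge0// ltW.
nra.
Qed.

Lemma flat_bounded P : exists2 C : R, 0 <= C & forall t, `|flat P t| <= C.
Proof.
exists (\sum_(i < size P) `|P`_i| * (i.+1`!%:R + 1)).
  by apply: sumr_ge0 => i _; rewrite mulr_ge0// addr_ge0.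
move=> t; rewrite /flat; case: ifPn => t0; last first.
  by rewrite normr0 sumr_ge0// => i _; rewrite mulr_ge0// addr_ge0.
rewrite horner_coef mulr_suml (le_trans (ler_norm_sum _ _ _))//.
apply: ler_sum => i _; rewrite -mulrA normrM ler_wpM2l//.
by apply: exprn_expRN_le; rewrite invr_ge0 ltW.
Qed.

Lemma flat_npos P t : t <= 0 -> flat P t = 0.
Proof. by rewrite /flat ltNge => ->. Qed.

Lemma flatX P t : flat P t = t * flat ('X * P) t.
Proof.
rewrite /flat; case: ifPn => t0; last by rewrite mulr0.
by rewrite hornerM hornerX !mulrA divff ?mul1r ?gt_eqF.
Qed.

Lemma is_derive_flat P t : is_derive t 1 (flat P) (flat (dflat P) t).
Proof.
have [t0|t0|t0] := ltgtP t 0.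
- rewrite flat_npos ?(ltW t0)//.
  apply: (@near_eq_is_derive _ _ _ (cst 0)).
  have : \forall z \near t, z < 0 by apply: lt_nbhsl.
  by apply: filterS => z /ltW/flat_npos ->.
- pose g := fun z => P.[z^-1] * expR (- z^-1).
  have tn0 : t != 0 by rewrite gt_eqF.
  apply: (@near_eq_is_derive _ _ _ g).
    have : \forall z \near t, 0 < z by exact: lt_nbhsr.
    by apply: filterS => z z0; rewrite /g /flat z0.
  have di : is_derive t (1:R) (fun z : R => z^-1) (- t ^- 2).
    apply: DeriveDef; first by apply: derivableV; rewrite ?gt_eqF.
    by rewrite deriveV// derive_id scaler1.
  have dP : is_derive t (1:R) (fun z : R => P.[z^-1]) (P^`().[t^-1] * (- t ^- 2)).
    exact: (@is_derive1_comp _ (horner P) (fun z => z^-1) _ _ _ (is_derive_poly P _) di).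
  have dN : is_derive t (1:R) (fun z : R => - z^-1) (t ^- 2).
    by have := is_deriveN di; rewrite opprK.
  have dE : is_derive t (1:R) (fun z : R => expR (- z^-1)) (expR (- t^-1) * t ^- 2).
    exact: (@is_derive1_comp _ expR (fun z => - z^-1) _ _ _ (is_derive_expR _) dN).
  have := is_deriveM dP dE; rewrite /g => h; apply: is_derive_eq h _.
  rewrite /flat t0 /dflat hornerM hornerXn hornerD hornerN exprVn.
  by rewrite /GRing.scale/=; ring.
- rewrite t0 flat_npos//.
  have lim0 : (fun h : R => h^-1 *: (flat P (h *: 1 + 0) - flat P 0)) @ 0^' --> 0.
    (* Two factors [h] are extracted from [flat P h]: one cancels the denominator of the difference
       quotient, the other makes it tend to 0. *)
    have [C C0 hC] := flat_bounded ('X * ('X * P)).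
    apply/cvgr0Pnorm_le => e e0; near=> h.
    have hn0 : h != 0 by near: h; exact: nbhs_dnbhs_neq.
    rewrite (flat_npos _ (lexx 0)) subr0 addr0 [h *: _]mulr1 flatX.
    rewrite /GRing.scale/= mulrA mulVf// mul1r flatX normrM.
    rewrite (@le_trans _ _ (`|h| * (C + 1)))//.
      by rewrite ler_wpM2l// (le_trans (hC _))// lerDl.
    rewrite -ler_pdivlMr ?ltr_wpDl//; near: h.
    apply: dnbhs0_le; rewrite divr_gt0// ltr_wpDl//.
  apply: DeriveDef; first by apply/cvg_ex; exists 0.
  exact: cvg_lim lim0.
Unshelve. all: by end_near.
Qed.

Definition smooth1 (g : R -> R) := forall k t, derivable (derive1n k g) t 1.

Lemma smooth1_derive1 g : smooth1 g -> smooth1 (derive1 g).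
Proof. by move=> sg k t; rewrite -derive1Sn; exact: sg. Qed.

Lemma smooth1S g : (forall t, derivable g t 1) -> smooth1 (derive1 g) -> smooth1 g.
Proof. by move=> dg sg [|k] t; [exact: dg|rewrite derive1Sn; exact: sg]. Qed.

Lemma smooth1_derivable g t : smooth1 g -> derivable g t 1.
Proof. by move=> /(_ 0%N t). Qed.

Lemma derivable1_continuous (g : R -> R) : (forall t, derivable g t 1) -> continuous g.
Proof.
by move=> dg t; apply/differentiable_continuous/derivable1_diffP; exact: dg.
Qed.

Lemma smooth1_continuous g : smooth1 g -> continuous g.
Proof. by move=> sg; apply: derivable1_continuous => t; exact: smooth1_derivable. Qed.

Lemma derive1_flat P : derive1 (flat P) = flat (dflat P).
Proof.
by apply/funext => t; rewrite derive1E; case: (is_derive_flat P t) => _ ->.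
Qed.

Lemma derivable_flat P t : derivable (flat P) t 1.
Proof. by case: (is_derive_flat P t). Qed.

Lemma smooth1_flat P : smooth1 (flat P).
Proof.
move=> k; elim: k P => [|k IH] P t; first exact: derivable_flat.
by rewrite derive1Sn derive1_flat; exact: IH.
Qed.

Lemma is_derive_affine (g : R -> R) a b c t (dg : R) :
  is_derive (b * t + c) 1 g dg ->
  is_derive t 1 (fun t => a * g (b * t + c)) (a * b * dg).
Proof.
move=> hg; have hA : is_derive t (1:R) (fun t => b * t + c) b.
  have h1 := is_deriveZ b (is_derive_id t (1 : R)).
  have := is_deriveD h1 (is_derive_cst c t 1).
  by rewrite addr0 [b *: _]mulr1.
have := is_deriveZ a (@is_derive1_comp _ g (fun t => b * t + c) _ _ _ hg hA).
by move=> h; apply: is_derive_eq h _; rewrite /GRing.scale/=; ring.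
Qed.

Lemma smooth1_affine g a b c : smooth1 g -> smooth1 (fun t => a * g (b * t + c)).
Proof.
move=> sg k; elim: k g a sg => [|k IH] g a sg t.
  have /derivableP/is_derive_affine h := sg 0%N (b * t + c).
  by case: (h a).
rewrite derive1Sn (_ : derive1 _ = fun t => a * b * derive1 g (b * t + c)).
  by apply: IH; exact: smooth1_derive1.
apply/funext => s; rewrite derive1E.
have /derivableP/is_derive_affine h := sg 0%N (b * s + c).
by case: (h a) => _ ->; rewrite derive1E.
Qed.

Definition expbump := flat 1.

Lemma expbumpE t : 0 < t -> expbump t = expR (- t^-1).
Proof. by move=> t0; rewrite /expbump /flat t0 hornerC mul1r. Qed.

Lemma expbump_ge0 t : 0 <= expbump t.
Proof.
have [t0|t0] := leP t 0; first by rewrite /expbump flat_npos.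
by rewrite expbumpE// expR_ge0.
Qed.

Lemma expbump_gt0 t : 0 < t -> 0 < expbump t.
Proof. by move=> t0; rewrite expbumpE// expR_gt0. Qed.

Lemma expbump_le1 t : expbump t <= 1.
Proof.
have [t0|t0] := leP t 0; first by rewrite /expbump flat_npos.
by rewrite expbumpE// expR_le1 oppr_le0 invr_ge0 ltW.
Qed.

Lemma expbump_le s t : s <= t -> expbump s <= expbump t.
Proof.
move=> st; have [s0|s0] := leP s 0; first by rewrite {1}/expbump flat_npos// expbump_ge0.
have t0 := lt_le_trans s0 st.
by rewrite !expbumpE// ler_expR lerN2 lef_pV2.
Qed.

Lemma smooth1_expbump : smooth1 expbump. Proof. exact: smooth1_flat. Qed.

(* A smooth convex substitute for the positive part. *)
Definition ramp t := t * expbump t.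

Lemma is_derive_ramp t : is_derive t 1 ramp (flat (1 + 'X) t).
Proof.
have := is_deriveM (is_derive_id t (1 : R)) (is_derive_flat 1 t).
move=> h; apply: is_derive_eq h _; rewrite /GRing.scale/= mulr1.
rewrite /dflat derivC subr0 mulr1 -/(expbump t) /expbump /flat; case: ifPn => t0.
  rewrite hornerD hornerC hornerX hornerXn exprVn.
  have : t != 0 by rewrite gt_eqF.
  by move=> ?; field.
by rewrite mulr0 addr0.
Qed.

Lemma derive1_ramp : derive1 ramp = flat (1 + 'X).
Proof.
by apply/funext => t; rewrite derive1E; case: (is_derive_ramp t) => _ ->.
Qed.

Lemma smooth1_ramp : smooth1 ramp.
Proof.
apply: smooth1S; last by rewrite derive1_ramp; exact: smooth1_flat.
by move=> t; case: (is_derive_ramp t).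
Qed.

Lemma derive1_ramp_ge0 t : 0 <= derive1 ramp t.
Proof.
rewrite derive1_ramp /flat; case: ifPn => // t0; rewrite mulr_ge0 ?expR_ge0//.
by rewrite hornerD hornerC hornerX addr_ge0// invr_ge0 ltW.
Qed.

(** The derivative is [(1 + y) exp(-y)] with [y = 1/t], and [1 + y <= exp(y)]. *)
Lemma derive1_ramp_le1 t : derive1 ramp t <= 1.
Proof.
rewrite derive1_ramp /flat; case: ifPn => // t0.
rewrite hornerD hornerC hornerX expRN ler_pdivrMr ?expR_gt0// mul1r.
exact: expR_ge1Dx.
Qed.

Lemma ramp_npos t : t <= 0 -> ramp t = 0.
Proof. by move=> t0; rewrite /ramp /expbump flat_npos// mulr0. Qed.

Lemma ramp_gt0 t : 0 < t -> 0 < ramp t.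
Proof. by move=> t0; rewrite mulr_gt0// expbump_gt0. Qed.

Lemma ramp_ge0 t : 0 <= ramp t.
Proof.
have [t0|t0] := leP t 0; first by rewrite ramp_npos.
by rewrite ltW// ramp_gt0.
Qed.

Lemma ramp_le t : 0 <= t -> ramp t <= t.
Proof. by move=> t0; rewrite ler_piMr// expbump_le1. Qed.

(** From [1 - y <= exp(-y)] with [y = 1/t]. This loss of 1, added to the shift by 1 in [threshold],
    is the origin of the [2 * e] in [threshold_ge]. *)
Lemma ramp_ge t : t - 1 <= ramp t.
Proof.
have [t0|t0] := leP t 0.
  by rewrite ramp_npos// subr_le0 (le_trans t0).
rewrite /ramp expbumpE//; have := expR_ge1Dx (- t^-1) => h.
have : t * (1 - t^-1) <= t * expR (- t^-1) by rewrite ler_wpM2l// ltW.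
by rewrite mulrBr divff ?gt_eqF// mulr1.
Qed.

Lemma derive1_ramp_lipschitz :
  exists2 C : R, 0 <= C & forall s t, `|derive1 ramp s - derive1 ramp t| <= C * `|s - t|.
Proof.
have [C C0 hC] := flat_bounded (dflat (1 + 'X)); exists C => // s t.
rewrite derive1_ramp.
wlog st : s t / s < t => [H|].
  have [|ts|->] := ltgtP s t; first exact: H.
    by rewrite distrC [`|s - t|]distrC; exact: H.
  by rewrite !subrr !normr0 mulr0.
have [] := @MVT _ (flat (1 + 'X)) (flat (dflat (1 + 'X))) _ _ st.
- by move=> x _; exact: is_derive_flat.
- apply: continuous_subspaceT; apply: smooth1_continuous; exact: smooth1_flat.
- move=> z _ h; rewrite distrC h normrM [`|s - t|]distrC.
  by rewrite ler_wpM2r.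
Qed.

End flat.

(** * Smooth functions of several variables *)

Section smooth.
Context {R : realType} {n : nat}.
Implicit Types (u v w : 'rV[R]_n -> R) (i j : 'I_n) (x : 'rV[R]_n).

Notation e_ i := (delta_mx ord0 i : 'rV[R]_n).

Lemma is_derive_line (V : normedModType R) (u : V -> R) (x v : V) du :
  is_derive x v u du <-> is_derive (0 : R) 1 (fun h : R => u (h *: v + x)) du.
Proof.
have E : 'D_v u x = 'D_1 (fun h : R => u (h *: v + x)) 0.
  rewrite /derive; set g1 := fun h => h^-1 *: _; set g2 := fun h => h^-1 *: _.
  suff -> : g1 = g2 by [].
  by apply/funext => h; rewrite /g1 /g2/= addr0 scale0r add0r [_%:A]mulr1.
split=> -[du1 du2].
  by apply: DeriveDef; [exact: (derivable1P u x v).1|rewrite -E].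
by apply: DeriveDef; [exact: (derivable1P u x v).2|rewrite E].
Qed.

Lemma is_derive_comp1 (V : normedModType R) (g : R -> R) (u : V -> R) (x v : V) dg du :
  is_derive (u x) 1 g dg -> is_derive x v u du ->
  is_derive x v (g \o u) (dg * du).
Proof.
move=> hg /is_derive_line hu; apply/is_derive_line.
apply: (@is_derive1_comp _ g (fun h : R => u (h *: v + x))) => //=.
by rewrite scale0r add0r.
Qed.

(** Finite orders make stability under products and compositions an induction: the product and chain
    rules at order [k.+1] call the statement at order [k], both for the derivatives and, through
    [CkS], for the functions themselves. *)
Fixpoint Ck (k : nat) u : Prop :=
  match k with
  | 0 => continuous u
  | k'.+1 => [/\ continuous u, forall i x, derivable u x (e_ i) &
                 forall i, Ck k' (pderiv i u)]
  end.

Definition smooth u := forall k, Ck k u.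

Lemma CkS k u : Ck k.+1 u -> Ck k u.
Proof.
elim: k u => [|k IH] u; first by case.
by move=> [cu du Du]; split=> // i; exact/IH/Du.
Qed.

Lemma smooth_continuous u : smooth u -> continuous u.
Proof. by move=> /(_ 0%N). Qed.

Lemma smooth_derivable u i x : smooth u -> derivable u x (e_ i).
Proof. by move=> /(_ 1%N) [_ + _]; exact. Qed.

Lemma smooth_pderiv u i : smooth u -> smooth (pderiv i u).
Proof. by move=> su k; have [_ _] := su k.+1; exact. Qed.

Lemma smooth_pderivs u s : smooth u -> smooth (pderivs s u).
Proof. by move=> su; elim: s => //= i s IH; exact: smooth_pderiv. Qed.

Lemma pderivsP u : (forall s, continuous (pderivs s u)) ->
  (forall s i x, derivable (pderivs s u) x (e_ i)) -> smooth u.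
Proof.
move=> cu du k; rewrite -[u]/(pderivs [::] u); elim: k [::] => [|k IH] s.
  exact: cu.
by split => // i; exact: (IH (i :: s)).
Qed.

Lemma test_functionP u : test_function u <->
  [/\ smooth u, compact (closure [set x | u x != 0]) &
      closure [set x | u x != 0] `<=` @B1 R n].
Proof.
split=> [[h1 h2 h3 h4]|[su h3 h4]]; first by split=> //; exact: pderivsP.
split=> // [s|s i x].
- exact/smooth_continuous/smooth_pderivs.
- exact/smooth_derivable/smooth_pderivs.
Qed.

Lemma pderiv_cst (c : R) i : pderiv i (cst c) = cst 0.
Proof. by apply/funext => x; exact: derive_cst. Qed.

Lemma pderivD u v i : smooth u -> smooth v ->
  pderiv i (fun x => u x + v x) = fun x => pderiv i u x + pderiv i v x.
Proof.
by move=> su sv; apply/funext => x; apply: deriveD; exact: smooth_derivable.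
Qed.

Lemma pderivM u v i : smooth u -> smooth v ->
  pderiv i (fun x => u x * v x) = fun x => pderiv i u x * v x + u x * pderiv i v x.
Proof.
move=> su sv; apply/funext => x.
rewrite /pderiv (@deriveM _ _ u v); [|exact: smooth_derivable|exact: smooth_derivable].
by rewrite /GRing.scale/= addrC mulrC.
Qed.

Lemma pderiv_comp (g : R -> R) u i : smooth1 g -> smooth u ->
  pderiv i (g \o u) = fun x => derive1 g (u x) * pderiv i u x.
Proof.
move=> sg su; apply/funext => x.
have /derivableP hg := sg 0%N (u x).
have /derivableP hu := @smooth_derivable u i x su.
by have [_] := is_derive_comp1 hg hu; rewrite derive1E.
Qed.

Lemma smooth_cst (c : R) : smooth (cst c).
Proof.
move=> k; elim: k c => [|k IH] c /=; first exact: cst_continuous.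
split=> [|i x|i]; first exact: cst_continuous.
- exact: derivable_cst.
- by rewrite pderiv_cst; exact: IH.
Qed.

Lemma Ck_add k u v : Ck k u -> Ck k v -> Ck k (fun x => u x + v x).
Proof.
elim: k u v => [|k IH] u v.
  by move=> cu cv x; exact: (cvgD (cu x) (cv x)).
move=> [cu du Du] [cv dv Dv]; split=> [x|i x|i].
- by exact: (cvgD (cu x) (cv x)).
- exact: derivableD.
- rewrite (_ : pderiv i _ = fun x => pderiv i u x + pderiv i v x).
    by apply: IH; [exact: Du|exact: Dv].
  by apply/funext => x; exact: deriveD.
Qed.

Lemma Ck_mul k u v : Ck k u -> Ck k v -> Ck k (fun x => u x * v x).
Proof.
elim: k u v => [|k IH] u v.
  by move=> cu cv x; exact: (cvgM (cu x) (cv x)).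
move=> hu hv; have [cu du Du] := hu; have [cv dv Dv] := hv.
split=> [x|i x|i].
- by exact: (cvgM (cu x) (cv x)).
- exact: derivableM.
- rewrite (_ : pderiv i _ = fun x => pderiv i u x * v x + u x * pderiv i v x).
    by apply: Ck_add; apply: IH; [exact: Du|exact: CkS hv|exact: CkS hu|exact: Dv].
  apply/funext => x; rewrite /pderiv (@deriveM _ _ u v); [|exact: du|exact: dv].
  by rewrite /GRing.scale/= addrC mulrC.
Qed.

Lemma Ck_comp k (g : R -> R) u : smooth1 g -> Ck k u -> Ck k (g \o u).
Proof.
elim: k g u => [|k IH] g u sg.
  by move=> cu x; apply: continuous_comp; [exact: cu|exact: smooth1_continuous].
move=> hu; have [cu du Du] := hu.
have h i x : is_derive x (e_ i) (g \o u) (derive1 g (u x) * pderiv i u x).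
  rewrite derive1E; apply: is_derive_comp1.
    by apply: derivableP; exact: sg 0%N _.
  exact/derivableP/du.
split=> [x|i x|i].
- by apply: continuous_comp; [exact: cu|exact: smooth1_continuous].
- by case: (h i x).
- rewrite (_ : pderiv i _ = fun x => (derive1 g \o u) x * pderiv i u x).
    by apply: Ck_mul; [apply: IH; [exact: smooth1_derive1|exact: CkS hu]|exact: Du].
  by apply/funext => x; case: (h i x).
Qed.

Lemma smoothD u v : smooth u -> smooth v -> smooth (fun x => u x + v x).
Proof. by move=> su sv k; exact: Ck_add. Qed.

Lemma smoothM u v : smooth u -> smooth v -> smooth (fun x => u x * v x).
Proof. by move=> su sv k; exact: Ck_mul. Qed.

Lemma smooth_comp (g : R -> R) u : smooth1 g -> smooth u -> smooth (g \o u).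
Proof. by move=> sg su k; exact: Ck_comp. Qed.

Lemma smooth_affine a b u : smooth u -> smooth (fun x => a * u x + b).
Proof.
by move=> su; apply: smoothD; [apply: smoothM => //|]; exact: smooth_cst.
Qed.

Lemma smooth_sum (I : Type) (r : seq I) (F : I -> 'rV[R]_n -> R) :
  (forall k, smooth (F k)) -> smooth (fun x => \sum_(i <- r) F i x).
Proof.
move=> sF; elim: r => [|a r IH].
  by under eq_fun do rewrite big_nil; exact: smooth_cst.
by under eq_fun do rewrite big_cons; exact: smoothD.
Qed.

Lemma smooth_prod (I : Type) (r : seq I) (F : I -> 'rV[R]_n -> R) :
  (forall k, smooth (F k)) -> smooth (fun x => \prod_(i <- r) F i x).
Proof.
move=> sF; elim: r => [|a r IH].
  by under eq_fun do rewrite big_nil; exact: smooth_cst.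
by under eq_fun do rewrite big_cons; exact: smoothM.
Qed.

Lemma is_derive_coord i j x :
  is_derive x (e_ i) (fun y => y ord0 j) (i == j)%:R.
Proof.
apply/is_derive_line.
rewrite (_ : (fun h : R => _) = fun h : R => (i == j)%:R * h + x ord0 j).
  have h := is_deriveZ (i == j)%:R (is_derive_id (0 : R) (1 : R)).
  have := is_deriveD h (is_derive_cst (x ord0 j) (0 : R) (1 : R)).
  by rewrite addr0 [_ *: 1]mulr1.
by apply/funext => h; rewrite !mxE/= eq_sym mulrC.
Qed.

Lemma pderiv_coord i j : pderiv i (fun y : 'rV[R]_n => y ord0 j) = cst (i == j)%:R.
Proof. by apply/funext => x; case: (is_derive_coord i j x). Qed.

Lemma smooth_coord j : smooth (fun y => y ord0 j).
Proof.
case=> [|k] /=; first exact: coord_continuous.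
split=> [|i x|i]; first exact: coord_continuous.
- by case: (is_derive_coord i j x).
- by rewrite pderiv_coord; exact: smooth_cst.
Qed.

(** Radial cutoffs and barriers are written as functions of the squared norm, which is smooth at the
    origin, unlike [enorm]. *)
Definition sqn x : R := \sum_i x ord0 i ^+ 2.

Lemma smooth_sqn : smooth sqn.
Proof.
by apply: smooth_sum => i; apply: smoothM; exact: smooth_coord.
Qed.

Lemma sqn_ge0 x : 0 <= sqn x.
Proof. by apply: sumr_ge0 => i _; exact: sqr_ge0. Qed.

Lemma enorm_ge0 x : 0 <= enorm x. Proof. exact: sqrtr_ge0. Qed.

Lemma enorm_sqr x : enorm x ^+ 2 = sqn x.
Proof. by rewrite sqr_sqrtr// sqn_ge0. Qed.

Lemma continuous_enorm : continuous (@enorm R n).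
Proof.
move=> x; apply: (@continuous_comp _ _ _ sqn Num.sqrt).
  exact/smooth_continuous/smooth_sqn.
exact: sqrt_continuous.
Qed.

Lemma pderiv_sqn i x : pderiv i sqn x = 2 * x ord0 i.
Proof.
have h j : is_derive x (e_ i) (fun y => y ord0 j ^+ 2) (2 * x ord0 j * (i == j)%:R).
  have := is_deriveM (is_derive_coord i j x) (is_derive_coord i j x).
  by move=> h; apply: is_derive_eq h _; rewrite /GRing.scale/=; ring.
have E : sqn = \sum_j (fun y : 'rV[R]_n => y ord0 j ^+ 2).
  by apply/funext => y; rewrite fct_sumE.
have [_] := is_derive_sum h; rewrite /pderiv E => ->.
rewrite (bigD1 i)//= eqxx mulr1 big1 ?addr0// => j ji.
by rewrite eq_sym (negbTE ji) mulr0.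
Qed.

End smooth.

(** * Integration over the ball *)

Section volume_facts.
Context {R : realType} {n : nat}.
Implicit Types (u v : 'rV[R]_n -> R) (U D A : set 'rV[R]_n) (x y : 'rV[R]_n).

Lemma measurable_box (P : 'I_n -> set R) : (forall i, measurable (P i)) ->
  measurable [set x : 'rV[R]_n | forall i, P i (x ord0 i)].
Proof.
move=> mP; rewrite (_ : [set _ | _] = \bigcap_(i in [set: 'I_n])
    (setT `&` (fun y : 'rV[R]_n => y ord0 i) @^-1` P i)).
  apply: fin_bigcap_measurable => // i _.
  by apply: measurable_row_coord.
apply/seteqP; split=> y /= h i; first by move=> _; split => //; exact: h.
by have [_] := h i I.
Qed.

Lemma open_rowP U x : open U -> U x ->
  exists2 e : R, 0 < e & forall y, (forall i, `|x ord0 i - y ord0 i| < e) -> U y.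
Proof.
move=> oU Ux; have /nbhs_ballP[e /= e0 eU] := open_nbhs_nbhs (conj oU Ux).
exists e => // y xy; apply: eU; split => // i j.
by rewrite ord1; exact: xy.
Qed.

(** The sigma-algebra on rows is generated by the coordinates, so an open set is exhibited as the
    countable union of the rational boxes that it contains. *)
Lemma open_measurable_row U : open U -> measurable U.
Proof.
move=> oU.
pose box (q : 'rV[rat]_n * rat) : set 'rV[R]_n :=
  [set y | forall i, `|ratr (q.1 ord0 i) - y ord0 i| < ratr q.2].
rewrite (_ : U = \bigcup_(q in [set q | box q `<=` U]) box q).
  rewrite bigcup_mkcond; apply: countable_bigcupT_measurable => [|q].
    exact: countableP.
  case: ifP => // _.
  apply: (measurable_box (P := fun i => [set t | `|ratr (q.1 ord0 i) - t| < ratr q.2])).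
  move=> i; rewrite (_ : [set _ | _] = `]ratr (q.1 ord0 i) - ratr q.2, ratr (q.1 ord0 i) + ratr q.2[%classic).
    exact: measurable_itv.
  by apply/seteqP; split => t /=; rewrite in_itv/= -ltr_distlC distrC.
apply/seteqP; split => [x Ux|x [q /= qU qx]]; last exact: qU.
have [e e0 eU] := open_rowP oU Ux.
(* The centre of the box will be within [r] of [x], hence every point of the box within [2 r < e] of
   it. *)
have /rat_in_itvoo[r] : e / 4 < e / 2 by lra.
rewrite in_itv/= => /andP[r1 r2].
have /choice[q hq] : forall i, exists q : rat, `|ratr q - x ord0 i| < ratr r.
  move=> i; have /rat_in_itvoo[q] : x ord0 i - ratr r < x ord0 i + ratr r by lra.
  by rewrite in_itv/= -ltr_distlC => qx; exists q; rewrite distrC.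
exists (\row_i q i, r) => [y|] /= h; last by rewrite mxE.
apply: eU => i; have := h i; have := hq i; rewrite mxE.
rewrite !ltr_distlC => /andP[? ?] /andP[? ?]; apply/andP; split; lra.
Qed.

Lemma measurable_fun_open D u : open D ->
  (forall x, D x -> {for x, continuous u}) -> measurable_fun D u.
Proof.
move=> oD cu; apply: (measurability _ (RGenOpens.measurableE R)) => //= _ [_ [a [b ->]] <-].
have oV : open `]a, b[%classic by exact: interval_open.
apply: open_measurable_row; rewrite openE => x [Dx Vux] /=.
apply: filterI; first exact: open_nbhs_nbhs.
exact: (cu x Dx _ (open_nbhs_nbhs (conj oV Vux))).
Qed.

Lemma measurable_continuous u D : measurable D -> continuous u -> measurable_fun D u.
Proof.
move=> mD cu; apply: (measurable_funS measurableT) => //.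
by apply: measurable_fun_open => [|x _]; [exact: openT|exact: cu].
Qed.

Lemma volume_open_gt0 U x : open U -> U x -> (0 < @volume R n U)%E.
Proof.
move=> oU Ux; have [e e0 eU] := open_rowP oU Ux.
pose a := \row_i (x ord0 i - e / 2); pose b := \row_i (x ord0 i + e / 2).
have ab i : a ord0 i <= b ord0 i by rewrite !mxE; lra.
apply: (@lt_le_trans _ _ (@volume R n [set y | forall i, a ord0 i <= y ord0 i <= b ord0 i])).
  rewrite volume_box// lte_fin; apply: prodr_gt0 => i _; rewrite !mxE; lra.
apply: le_measure.
- rewrite inE; apply: (measurable_box (P := fun i => `[a ord0 i, b ord0 i]%classic)) => i.
  exact: measurable_itv.
- by rewrite inE; exact: open_measurable_row.
- move=> y /= h; apply: eU => i; have := h i; rewrite !mxE ltr_distlC; lra.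
Qed.

Lemma open_B1 : open (@B1 R n).
Proof.
by apply: (@open_comp _ _ (@enorm R n) [set t : R | t < 1]) => [x _|]; [exact: continuous_enorm|exact: open_lt].
Qed.

Lemma measurable_B1 : measurable (@B1 R n).
Proof. exact: (open_measurable_row open_B1). Qed.

Lemma coord_le_enorm x i : `|x ord0 i| <= enorm x.
Proof.
rewrite -sqrtr_sqr ler_wsqrtr// (bigD1 i)//= lerDl.
by apply: sumr_ge0 => j _; exact: sqr_ge0.
Qed.

Lemma B1_subset_cB1 : @B1 R n `<=` @cB1 R n.
Proof. by move=> x /ltW. Qed.

Lemma compact_cB1 : compact (@cB1 R n).
Proof.
apply: bounded_closed_compact.
  apply: filterS (nbhs_pinfty_ge (num_real (1 : R))) => M M1 x Ax /=.
  rewrite [X in X <= _]mx_normrE; apply: bigmax_le => [|[i j] _].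
    exact: le_trans M1.
  by rewrite ord1/= (le_trans (coord_le_enorm _ _))// (le_trans Ax).
apply: (@preimage_closed _ _ (@enorm R n) [set t : R | t <= 1]) => [x _|]; first exact: continuous_enorm.
exact: closed_le.
Qed.

Lemma volume_B1_lty : (@volume R n (@B1 R n) < +oo)%E.
Proof.
apply: (@le_lt_trans _ _ (@volume R n [set y | forall i, (\row_i (-1 : R)) ord0 i <= y ord0 i <= (\row_i (1:R)) ord0 i])).
  apply: le_measure.
  - rewrite inE; exact: measurable_B1.
  - rewrite inE; apply: (measurable_box (P := fun i => `[(\row_i (-1 : R)) ord0 i, (\row_i (1:R)) ord0 i]%classic)) => i.
    exact: measurable_itv.
  - move=> y /= By i; rewrite !mxE -ler_norml (le_trans (coord_le_enorm _ _))//.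
    exact: ltW.
by rewrite volume_box ?ltry// => i; rewrite !mxE; lra.
Qed.

End volume_facts.

(** * Fubini's theorem and the vanishing integral of a partial derivative *)

Section divergence.
Context {R : realType}.

Lemma continuous_rowP (T : topologicalType) n (F : T -> 'rV[R]_n) :
  (forall i, continuous (fun t => F t ord0 i)) -> continuous F.
Proof.
move=> cF x; apply/cvg_ballP => e e0.
have : \forall t \near x, forall i, ball (F x ord0 i) e (F t ord0 i).
  apply: filter_forall => i; have /cvg_ballP := cF i x; exact.
by apply: filterS => t h; split=> // i j; rewrite !ord1.
Qed.

Lemma continuous_row_cons_l n (y : 'rV[R]_n) :
  continuous (fun t : R => row_cons (t, y)).
Proof.
apply: continuous_rowP => i; case: (unliftP ord0 i) => [j ->|->].
  by under eq_fun do rewrite row_consS; exact: cst_continuous.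
by under eq_fun do rewrite row_cons0; exact: id.
Qed.

Lemma continuous_row_cons_r n (t : R) :
  continuous (fun y : 'rV[R]_n => row_cons (t, y)).
Proof.
apply: continuous_rowP => i; case: (unliftP ord0 i) => [j ->|->].
  by under eq_fun do rewrite row_consS; exact: coord_continuous.
by under eq_fun do rewrite row_cons0; exact: cst_continuous.
Qed.

Lemma bounded_on_compact n (K : set 'rV[R]_n) (g : 'rV[R]_n -> R) :
  compact K -> {within K, continuous g} ->
  exists2 C : R, 0 <= C & forall x, K x -> `|g x| <= C.
Proof.
move=> cK cg; have /compact_bounded/ex_strict_bound_gt0[C C0 hC] := continuous_compact cg cK.
exists C => [|x Kx]; first exact: ltW.
by rewrite ltW// hC//; exists x.
Qed.

(** Stated coordinatewise, so that it passes with the same [M] to the slices of [g], on which the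
    induction over the dimension operates. *)
Definition supported_in_box n (M : R) (g : 'rV[R]_n -> R) :=
  forall (x : 'rV[R]_n) i, M < `|x ord0 i| -> g x = 0.

Lemma integrable_supported_in_box n M (g : 'rV[R]_n -> R) : continuous g ->
  supported_in_box M g -> (@volume R n).-integrable setT (EFin \o g).
Proof.
move=> cg sg; pose K := [set x : 'rV[R]_n | forall i, `[- `|M|, `|M|]%classic (x ord0 i)].
have cK : compact K.
  by apply: (@rV_compact R n (fun=> `[- `|M|, `|M|]%classic)) => i; exact: segment_compact.
have mK : measurable K.
  by apply: (measurable_box (P := fun=> `[- `|M|, `|M|]%classic)) => i; exact: measurable_itv.
have [|C C0 hC] := bounded_on_compact cK (g := g); first exact: continuous_subspaceT.
have Kfin : (@volume R n K < +oo)%E.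
  pose a := \row_(i < n) (- `|M|); pose b := \row_(i < n) `|M|.
  have -> : K = [set x : 'rV[R]_n | forall i, (a ord0 i <= x ord0 i <= b ord0 i)%R].
    apply/seteqP; split=> x /= h i; have := h i.
      by rewrite /= in_itv/= !mxE.
    by rewrite /= in_itv/= !mxE.
  by rewrite volume_box ?ltry// => i; rewrite !mxE; have := normr_ge0 M; lra.
have mg : measurable_fun K g by exact: measurable_continuous.
have gK : (@volume R n).-integrable K (EFin \o g).
  apply: measurable_bounded_integrable => //.
  by exists C; split; [exact: num_real|move=> D CD x Kx; exact: le_trans (hC x Kx) (ltW CD)].
have := (integrable_mkcond _ mK).1 gK; rewrite (_ : _ \_ _ = EFin \o g)//.
apply/funext => x; rewrite /patch; case: ifPn => //; rewrite notin_setE => Kx.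
have [i xi] : exists i, M < `|x ord0 i|.
  apply: contrapT => /forallNP h; apply: Kx => i /=; rewrite in_itv/= -ler_norml.
  by have /negP := h i; rewrite -leNgt => /le_trans; apply; exact: ler_norm.
by rewrite /= (sg _ _ xi).
Qed.

Lemma integrable_comp_row_cons n (f : 'rV[R]_n.+1 -> \bar R) :
  (@volume R n.+1).-integrable setT f ->
  (lebesgue_measure \x @volume R n)%E.-integrable setT (f \o @row_cons R n).
Proof.
move=> /integrableP[mf foo]; apply/integrableP; split.
  by apply: measurableT_comp => //; exact: measurable_row_cons.
move: foo; rewrite /= ge0_integral_pushforward//; first exact: measurable_row_cons.
exact: measurableT_comp.
Qed.

Lemma integral_volumeS12 n (f : 'rV[R]_n.+1 -> \bar R) :
  (@volume R n.+1).-integrable setT f ->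
  (\int[@volume R n.+1]_x f x =
   \int[lebesgue_measure]_t \int[@volume R n]_y f (row_cons (t, y)))%E.
Proof.
move=> fi; have fi' := integrable_comp_row_cons fi.
rewrite (integral12_prod_meas1 fi') /= integral_pushforward//.
- exact: measurable_row_cons.
- exact: measurable_int fi.
Qed.

Lemma integral_volumeS21 n (f : 'rV[R]_n.+1 -> \bar R) :
  (@volume R n.+1).-integrable setT f ->
  (\int[@volume R n.+1]_x f x =
   \int[@volume R n]_y \int[lebesgue_measure]_t f (row_cons (t, y)))%E.
Proof.
move=> fi; have fi' := integrable_comp_row_cons fi.
rewrite (integral21_prod_meas1 fi') /= integral_pushforward//.
- exact: measurable_row_cons.
- exact: measurable_int fi.
Qed.

Lemma integral_derive_eq0 M (g dg : R -> R) :
  (forall t, is_derive t (1 : R) g (dg t)) -> continuous dg ->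
  (forall t, M < `|t| -> g t = 0) -> (forall t, M < `|t| -> dg t = 0) ->
  (\int[lebesgue_measure]_t (dg t)%:E = 0)%E.
Proof.
move=> dgE cdg g0 dg0; pose N := `|M| + 1.
have MN : M < N by rewrite (le_lt_trans (ler_norm _))// ltrDl.
have N0 : 0 < N by rewrite ltr_wpDl.
rewrite (_ : (\int[lebesgue_measure]_t _ = \int[lebesgue_measure]_(t in `[(- N)%R, N]) (dg t)%:E)%E).
  have cg : continuous g.
    by apply: derivable1_continuous => t; case: (dgE t).
  rewrite (@continuous_FTC2 _ dg g).
  - by rewrite !g0 ?subee// ?normrN gtr0_norm.
  - lra.
  - exact: continuous_subspaceT.
  - split=> [t _||]; first by case: (dgE t).
      exact/cvg_at_right_filter/cg.
    exact/cvg_at_left_filter/cg.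
  - by move=> t _; rewrite derive1E; case: (dgE t) => _ ->.
rewrite [RHS]integral_mkcond; apply: eq_integral => t _.
rewrite /patch; case: ifPn => //; rewrite notin_setE /= in_itv/= => /negP.
rewrite -ler_norml -ltNge => Nt.
by rewrite dg0// (lt_trans MN).
Qed.

Lemma supported_pderiv n M (w : 'rV[R]_n -> R) i :
  supported_in_box M w -> supported_in_box M (pderiv i w).
Proof.
move=> sw x j xj; rewrite /pderiv (@near_eq_derive _ _ _ _ (cst 0)) ?derive_cst//.
have c : {for x, continuous (fun y : 'rV[R]_n => `|y ord0 j|)}.
  exact: (cvg_norm (@coord_continuous _ _ _ ord0 j x)).
have h : nbhs x [set y : 'rV[R]_n | M < `|y ord0 j|] := c [set t | M < t] (lt_nbhsr xj).
by apply: filterS h => y /= /sw.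
Qed.

Lemma row_cons_shift0 n (h t : R) (y : 'rV[R]_n) :
  row_cons (h + t, y) = h *: delta_mx ord0 ord0 + row_cons (t, y).
Proof.
apply/rowP => j; rewrite [in RHS]mxE; case: (unliftP ord0 j) => [k ->|->].
  by rewrite !row_consS !mxE mulr0 add0r.
by rewrite !row_cons0 !mxE eqxx mulr1.
Qed.

Lemma row_cons_shiftS n (h t : R) (y : 'rV[R]_n) j :
  row_cons (t, h *: delta_mx ord0 j + y) =
  h *: delta_mx ord0 (lift ord0 j) + row_cons (t, y).
Proof.
apply/rowP => i; rewrite [in RHS]mxE; case: (unliftP ord0 i) => [k ->|->].
  by rewrite !row_consS !mxE !eqxx/= (inj_eq lift_inj).
by rewrite !row_cons0 !mxE mulr0 add0r.
Qed.

Lemma is_derive_row_cons0 n (w : 'rV[R]_n.+1 -> R) t (y : 'rV[R]_n) dw :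
  is_derive (row_cons (t, y)) (delta_mx ord0 ord0) w dw ->
  is_derive t (1 : R) (fun t => w (row_cons (t, y))) dw.
Proof.
move=> /is_derive_line h; apply/is_derive_line.
rewrite (_ : (fun s : R => _) = fun s => w (s *: delta_mx ord0 ord0 + row_cons (t, y)))//.
by apply/funext => s; rewrite -row_cons_shift0 [_%:A]mulr1.
Qed.

Lemma is_derive_row_consS n (w : 'rV[R]_n.+1 -> R) t (y : 'rV[R]_n) j dw :
  is_derive (row_cons (t, y)) (delta_mx ord0 (lift ord0 j)) w dw ->
  is_derive y (delta_mx ord0 j) (fun y => w (row_cons (t, y))) dw.
Proof.
move=> /is_derive_line h; apply/is_derive_line.
rewrite (_ : (fun s : R => _) = fun s => w (s *: delta_mx ord0 (lift ord0 j) + row_cons (t, y)))//.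
by apply/funext => s; rewrite -row_cons_shiftS.
Qed.

(** Fubini's theorem in the order that puts the variable of differentiation inside: for the first
    coordinate the inner integral vanishes by the fundamental theorem of calculus, for any other one
    by induction on the dimension. *)
Lemma integral_pderiv_eq0 n M (w : 'rV[R]_n -> R) (i : 'I_n) : continuous w ->
  (forall x, derivable w x (delta_mx ord0 i)) -> continuous (pderiv i w) ->
  supported_in_box M w -> (\int[@volume R n]_x (pderiv i w x)%:E = 0)%E.
Proof.
elim: n w i => [|n IHn] w i; first by case: i.
move=> cw dw cdw sw; have sdw := @supported_pderiv _ _ _ i sw.
have idw := integrable_supported_in_box cdw sdw.
have comp (g : 'rV[R]_n.+1 -> R) t : continuous g -> continuous (fun y : 'rV[R]_n => g (row_cons (t, y))).
  move=> cg y; apply: continuous_comp; first exact: continuous_row_cons_r.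
  exact: cg.
have comp0 (g : 'rV[R]_n.+1 -> R) y : continuous g -> continuous (fun t : R => g (row_cons (t, y))).
  move=> cg t; apply: continuous_comp; first exact: continuous_row_cons_l.
  exact: cg.
case: (unliftP ord0 i) => [j|] ij.
  rewrite integral_volumeS12// integral0_eq// => t _.
  have dwt y : is_derive y (delta_mx ord0 j) (fun y => w (row_cons (t, y)))
      (pderiv i w (row_cons (t, y))).
    by apply: is_derive_row_consS; rewrite -ij; exact/derivableP/dw.
  have E : pderiv j (fun y => w (row_cons (t, y))) = fun y => pderiv i w (row_cons (t, y)).
    by apply/funext => y; case: (dwt y).
  under eq_integral do rewrite -[pderiv i w _]/((fun y => pderiv i w (row_cons (t, y))) _) -E.
  apply: IHn.
  - exact: comp.
  - by move=> y; case: (dwt y).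
  - by rewrite E; exact: comp.
  - by move=> y k yk; apply: (sw _ (lift ord0 k)); rewrite row_consS.
rewrite integral_volumeS21// integral0_eq// => y _.
apply: (@integral_derive_eq0 M (fun t => w (row_cons (t, y)))).
- by move=> t; apply: is_derive_row_cons0; rewrite -ij; exact/derivableP/dw.
- exact: comp0.
- by move=> t yt; apply: (sw _ ord0); rewrite row_cons0.
- by move=> t yt; apply: (sdw _ ord0); rewrite row_cons0.
Qed.

End divergence.

(** * Bounded, integrable and square-integrable functions on the ball *)

Section integral_ball.
Context {R : realType} {n : nat}.
Implicit Types (u v w b g : 'rV[R]_n -> R) (th : nat -> 'rV[R]_n -> R).

Notation mu := (@volume R n).
Notation B := (@B1 R n).

Let mB : measurable B := @measurable_B1 R n.

Definition itg u := mu.-integrable B (EFin \o u).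

Definition bdd b := measurable_fun B b /\ exists C : R, forall x, B x -> `|b x| <= C.

Lemma ae_B1S (P Q : 'rV[R]_n -> Prop) :
  (forall x, B x -> P x -> Q x) -> ae_B1 P -> ae_B1 Q.
Proof.
rewrite /ae_B1 => PQ; apply: filterS => x h Bx.
exact: PQ (h Bx).
Qed.

Lemma ae_B1_and (P Q : 'rV[R]_n -> Prop) :
  ae_B1 P -> ae_B1 Q -> ae_B1 (fun x => P x /\ Q x).
Proof.
by rewrite /ae_B1; apply: filterS2 => x h1 h2 Bx; split; [exact: h1|exact: h2].
Qed.

(** An open set without such a point would lie in a null set. Through this lemma, statements holding
    almost everywhere become pointwise ones for continuous functions. *)
Lemma ae_B1_open (P : 'rV[R]_n -> Prop) (U : set 'rV[R]_n) x0 :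
  ae_B1 P -> open U -> U `<=` B -> U x0 -> exists2 x, U x & P x.
Proof.
move=> [A [mA A0 PA]] oU UB Ux0; apply: contrapT => h.
have UA : U `<=` A.
  by move=> x Ux; apply: PA => /= Px; apply: h; exists x => //; exact/Px/UB.
have := volume_open_gt0 oU Ux0; rewrite ltNge => /negP; apply.
rewrite -A0; apply: le_measure; rewrite ?inE//.
exact: open_measurable_row.
Qed.

Lemma itg_measurable u : itg u -> measurable_fun B u.
Proof. by move=> /measurable_int/measurable_EFinP. Qed.

Lemma eq_itg u v : (forall x, B x -> u x = v x) -> itg u -> itg v.
Proof.
by move=> uv; apply: eq_integrable => // x /set_mem Bx /=; rewrite uv.
Qed.

Lemma le_itg u v : measurable_fun B u -> (forall x, B x -> `|u x| <= v x) ->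
  itg v -> itg u.
Proof.
move=> mu' uv; apply: le_integrable => //; first exact/measurable_EFinP.
by move=> x Bx /=; rewrite lee_fin (le_trans (uv x Bx))// ler_norm.
Qed.

Lemma itgD u v : itg u -> itg v -> itg (fun x => u x + v x).
Proof. by move=> iu iv; exact: (integrableD mB iu iv). Qed.

Lemma itgZ (a : R) u : itg u -> itg (fun x => a * u x).
Proof. by move=> iu; exact: (integrableZl mB a iu). Qed.

Lemma itgB u v : itg u -> itg v -> itg (fun x => u x - v x).
Proof. by move=> iu iv; exact: (integrableB mB iu iv). Qed.

Lemma bdd_itg b : bdd b -> itg b.
Proof.
move=> [mb [C hC]]; apply: measurable_bounded_integrable => //.
  exact: volume_B1_lty.
exists C; split; first exact: num_real.
by move=> D CD x Bx; exact: le_trans (hC x Bx) (ltW CD).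
Qed.

Lemma bddP b (C : R) : measurable_fun B b -> (forall x, B x -> `|b x| <= C) -> bdd b.
Proof. by move=> mb hC; split=> //; exists C. Qed.

Lemma bdd_cst (c : R) : bdd (cst c).
Proof. by split; [exact: measurable_cst|exists `|c|]. Qed.

Lemma bdd_cB1 b : {within @cB1 R n, continuous b} -> bdd b.
Proof.
move=> cb; have [C C0 hC] := bounded_on_compact (@compact_cB1 R n) cb.
split; last by exists C => x Bx; apply: hC; exact: B1_subset_cB1.
apply: measurable_fun_open; first exact: open_B1.
move: (continuous_subspaceW B1_subset_cB1 cb).
by rewrite continuous_open_subspace; [move=> cB x Bx; apply: cB; rewrite inE|exact: open_B1].
Qed.

Lemma bdd_continuous b : continuous b -> bdd b.
Proof. by move=> cb; apply: bdd_cB1; exact: continuous_subspaceT. Qed.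

Lemma bddM b c : bdd b -> bdd c -> bdd (fun x => b x * c x).
Proof.
move=> [mb [C hC]] [mc [D hD]]; split; first exact: measurable_funM.
by exists (C * D) => x Bx; rewrite normrM ler_pM// ?hC ?hD.
Qed.

Lemma itgM u b : itg u -> bdd b -> itg (fun x => u x * b x).
Proof.
move=> iu [mb [C hC]].
have := integrableMl mB iu mb; apply.
exists C; split; first exact: num_real.
by move=> D CD x Bx; exact: le_trans (hC x Bx) (ltW CD).
Qed.

Lemma L2_measurable u : L2 u -> measurable_fun B u. Proof. by case. Qed.

Lemma L2_sqr u : L2 u -> itg (fun x => u x ^+ 2). Proof. by case. Qed.

Lemma L2M u v : L2 u -> L2 v -> itg (fun x => u x * v x).
Proof.
move=> [mu' iu] [mv iv]; apply: (le_itg _ _ (itgD iu iv)).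
  exact: measurable_funM.
move=> x _; rewrite normrM -(real_normK (num_real (u x))) -(real_normK (num_real (v x))).
have := normr_ge0 (u x); have := normr_ge0 (v x); nra.
Qed.

Lemma bdd_L2 b : bdd b -> L2 b.
Proof. by move=> hb; split; [case: hb|apply: bdd_itg; exact: bddM]. Qed.

Lemma L2_itg u : L2 u -> itg u.
Proof.
move=> Lu; apply: eq_itg (L2M Lu (bdd_L2 (bdd_cst 1))) => x _.
by rewrite mulr1.
Qed.

Lemma L2Mb u b : L2 u -> bdd b -> L2 (fun x => u x * b x).
Proof.
move=> [mu' iu] hb; split; first by apply: measurable_funM => //; case: hb.
by apply: eq_itg (itgM iu (bddM hb hb)) => x _; rewrite exprMn -expr2.
Qed.

Lemma L2D u v : L2 u -> L2 v -> L2 (fun x => u x + v x).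
Proof.
move=> Lu Lv; split.
  by apply: measurable_funD; exact: L2_measurable.
have h := itgD (itgD (L2_sqr Lu) (L2_sqr Lv)) (itgZ 2 (L2M Lu Lv)).
by apply: eq_itg h => x _; ring.
Qed.

Lemma L2Z (a : R) u : L2 u -> L2 (fun x => a * u x).
Proof.
move=> Lu; rewrite (_ : (fun x => _) = fun x => u x * cst a x).
  by apply: L2Mb => //; exact: bdd_cst.
by apply/funext => x; rewrite mulrC.
Qed.

Lemma L2B u v : L2 u -> L2 v -> L2 (fun x => u x - v x).
Proof.
move=> Lu Lv; have := L2D Lu (L2Z (-1) Lv).
by under eq_fun do rewrite mulN1r.
Qed.

Lemma itg_sum (I : Type) (r : seq I) (F : I -> 'rV[R]_n -> R) :
  (forall k, itg (F k)) -> itg (fun x => \sum_(k <- r) F k x).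
Proof.
move=> LF; elim: r => [|a r IH].
  by under eq_fun do rewrite big_nil; exact: bdd_itg (bdd_cst 0).
by under eq_fun do rewrite big_cons; exact: itgD.
Qed.

Lemma intBD u v : itg u -> itg v -> intB (fun x => u x + v x) = intB u + intB v.
Proof. exact: RintegralD. Qed.

Lemma intBB u v : itg u -> itg v -> intB (fun x => u x - v x) = intB u - intB v.
Proof. exact: RintegralB. Qed.

Lemma intBZ (a : R) u : itg u -> intB (fun x => a * u x) = a * intB u.
Proof. exact: RintegralZl. Qed.

Lemma intB_sum (I : Type) (r : seq I) (F : I -> 'rV[R]_n -> R) :
  (forall k, itg (F k)) ->
  intB (fun x => \sum_(k <- r) F k x) = \sum_(k <- r) intB (F k).
Proof.
move=> LF; elim: r => [|a r IH].
  rewrite big_nil; under eq_fun do rewrite big_nil.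
  by rewrite /intB Rintegral_cst// mul0r.
under eq_fun do rewrite big_cons; rewrite big_cons intBD//; first by rewrite IH.
exact: itg_sum.
Qed.

Lemma eq_intB u v : (forall x, B x -> u x = v x) -> intB u = intB v.
Proof. by move=> uv; apply: eq_Rintegral => x /set_mem; exact: uv. Qed.

Lemma ae_eq_intB u v : measurable_fun B u -> measurable_fun B v ->
  ae_B1 (fun x => u x = v x) -> intB u = intB v.
Proof.
move=> mu' mv uv; congr fine; apply: ae_eq_integral => //.
- exact/measurable_EFinP.
- exact/measurable_EFinP.
- by apply: ae_B1S uv => x _ ->.
Qed.

Lemma intB_ge0 u : (forall x, B x -> 0 <= u x) -> 0 <= intB u.
Proof. exact: Rintegral_ge0. Qed.

Lemma le_intB u v : itg u -> itg v -> (forall x, B x -> u x <= v x) ->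
  intB u <= intB v.
Proof. exact: le_Rintegral. Qed.

Lemma ae_eq_itg u v : measurable_fun B v -> ae_B1 (fun x => u x = v x) ->
  itg u -> itg v.
Proof.
move=> mv uv iu; have mu' := itg_measurable iu.
move/integrableP : iu => [_ uoo]; apply/integrableP; split; first exact/measurable_EFinP.
rewrite (ae_eq_integral (fun x => `|(u x)%:E|%E))//.
- by apply: measurableT_comp => //; exact/measurable_EFinP.
- by apply: measurableT_comp => //; exact/measurable_EFinP.
- by apply: ae_B1S uv => x _ /= ->.
Qed.

Lemma intB_sqr_eq0 u : measurable_fun B u -> itg u -> (forall x, B x -> 0 <= u x) ->
  intB u = 0 -> ae_B1 (fun x => u x = 0).
Proof.
move=> mu' iu u0 Iu.
have : (\int[mu]_(x in B) `|(u x)%:E| = 0)%E.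
  have /integrable_fin_num - /(_ mB) /fineK := iu.
  rewrite -/(Rintegral _ _ _) -/(intB _) Iu => h.
  apply: etrans (esym h); apply: eq_integral => x /set_mem Bx.
  by rewrite gee0_abs// lee_fin u0.
have mEu : measurable_fun B (EFin \o u) by exact/measurable_EFinP.
move/(ae_eq_integral_abs mu mB mEu).1 => h.
by apply: ae_B1S h => x _ [].
Qed.

Lemma intB_gt0 u x0 : bdd u -> (forall x, B x -> 0 <= u x) -> B x0 ->
  {for x0, continuous u} -> 0 < u x0 -> 0 < intB u.
Proof.
move=> bu u0 Bx0 cu ux0; rewrite lt_def intB_ge0// andbT; apply/negP => /eqP Iu.
have ae0 := intB_sqr_eq0 (proj1 bu) (bdd_itg bu) u0 Iu.
have : nbhs x0 (B `&` [set x | 0 < u x]).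
  apply: filterI; first exact: open_nbhs_nbhs (conj open_B1 Bx0).
  exact: cu _ (lt_nbhsr ux0).
rewrite nbhsE => -[U [oU Ux0] UB].
have [x Ux ux] := ae_B1_open ae0 oU (fun y Uy => proj1 (UB y Uy)) Ux0.
by have [_ /=] := UB x Ux; rewrite ux ltxx.
Qed.

Lemma cauchy_schwarz u v : L2 u -> L2 v ->
  intB (fun x => u x * v x) ^+ 2 <=
  intB (fun x => u x ^+ 2) * intB (fun x => v x ^+ 2).
Proof.
move=> Lu Lv; set p := intB _; set a := intB _; set c := intB _.
have H (s t : R) : 0 <= s ^+ 2 * a + 2 * s * t * p + t ^+ 2 * c.
  have : 0 <= intB (fun x => (s * u x + t * v x) ^+ 2).
    by apply: intB_ge0 => x _; exact: sqr_ge0.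
  congr (_ <= _).
  rewrite -intBZ; last exact: L2_sqr.
  rewrite -intBZ; last exact: L2M.
  rewrite -intBZ; last exact: L2_sqr.
  rewrite -intBD; [|exact/itgZ/L2_sqr|exact/itgZ/L2M].
  rewrite -intBD; [|apply: itgD; [exact/itgZ/L2_sqr|exact/itgZ/L2M]|exact/itgZ/L2_sqr].
  by apply: eq_intB => x _; ring.
have a0 : 0 <= a by apply: intB_ge0 => x _; exact: sqr_ge0.
have c0 : 0 <= c by apply: intB_ge0 => x _; exact: sqr_ge0.
(* If [a = 0], the choice [s = - (c + 1)], [t = p] turns the form into [- (c + 2) p^2], which forces
   [p = 0]. *)
have [an0|an0] := eqVneq a 0.
  have := H (- (c + 1)) p; rewrite an0; have := sqr_ge0 p; nra.
have agt0 : 0 < a by rewrite lt_def an0.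
(* Here the form equals [a (a c - p^2)]. *)
have := H (- p) a; nra.
Qed.

End integral_ball.

(** * Convergence in mean square *)

Section convergence.
Context {R : realType} {n : nat}.
Implicit Types (u v w b g : 'rV[R]_n -> R) (th : nat -> 'rV[R]_n -> R).

Notation mu := (@volume R n).
Notation B := (@B1 R n).

Let mB : measurable B := @measurable_B1 R n.

Definition cvgL2 th u := intB (fun x => (th m x - u x) ^+ 2) @[m --> \oo] --> (0 : R).

Lemma cvg0_le (a e : nat -> R) : (forall m, 0 <= a m <= e m) ->
  e @ \oo --> (0 : R) -> a @ \oo --> (0 : R).
Proof.
move=> ae e0; apply: (@squeeze_cvgr _ _ _ _ (cst 0) e) => //; last exact: cvg_cst.
by apply: nearW.
Qed.

Lemma cvg_dist_le (a e : nat -> R) l : (forall m, `|a m - l| <= e m) ->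
  e @ \oo --> (0 : R) -> a @ \oo --> l.
Proof.
move=> ae e0; apply/cvgrPdist_le => eps eps0; near=> m.
rewrite distrC (le_trans (ae m))//; near: m.
exact: (cvgr_le _ e0).
Unshelve. all: by end_near.
Qed.

Lemma cvgL2_int th u w : (forall m, L2 (th m)) -> L2 u -> L2 w -> cvgL2 th u ->
  intB (fun x => th m x * w x) @[m --> \oo] --> intB (fun x => u x * w x).
Proof.
move=> Lth Lu Lw thu.
pose e m := Num.sqrt (intB (fun x => (th m x - u x) ^+ 2) * intB (fun x => w x ^+ 2)).
have e0 : e @ \oo --> (0 : R).
  rewrite -sqrtr0; apply: (@cvg_comp _ _ _ _ Num.sqrt _ (nbhs (0 : R))); last exact: sqrt_continuous.
  by rewrite -(mul0r (intB (fun x => w x ^+ 2))); apply: cvgMl.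
apply: cvg_dist_le e0 => m.
rewrite -intBB; [|exact: L2M|exact: L2M].
have -> : intB (fun x => th m x * w x - u x * w x) = intB (fun x => (th m x - u x) * w x).
  by apply: eq_intB => x _; ring.
rewrite -sqrtr_sqr ler_wsqrtr//; apply: cauchy_schwarz => //.
exact: L2B.
Qed.

Lemma cvgL2_le th u th' u' (C : R) :
  (forall m, itg (fun x => (th m x - u x) ^+ 2)) ->
  (forall m, itg (fun x => (th' m x - u' x) ^+ 2)) ->
  (forall m x, B x -> (th' m x - u' x) ^+ 2 <= C * (th m x - u x) ^+ 2) ->
  cvgL2 th u -> cvgL2 th' u'.
Proof.
move=> i1 i2 h thu.
apply: (@cvg0_le _ (fun m => C * intB (fun x => (th m x - u x) ^+ 2))); last first.
  by rewrite -[X in _ --> X](mulr0 C); apply: cvgMr.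
move=> m; rewrite intB_ge0 => [|x _]; last exact: sqr_ge0.
by rewrite -intBZ//; apply: le_intB => //; [exact: itgZ|exact: h].
Qed.

Lemma cvgL2D th u th' u' : (forall m, L2 (th m)) -> L2 u ->
  (forall m, L2 (th' m)) -> L2 u' -> cvgL2 th u -> cvgL2 th' u' ->
  cvgL2 (fun m x => th m x + th' m x) (fun x => u x + u' x).
Proof.
move=> L1 L2' L3 L4 c1 c2.
apply: (@cvg0_le _ (fun m => 2 * intB (fun x => (th m x - u x) ^+ 2) +
    2 * intB (fun x => (th' m x - u' x) ^+ 2))); last first.
  rewrite -[X in _ --> X](addr0 0).
  by apply: cvgD; [rewrite -[X in _ --> X](mulr0 2)|rewrite -[X in _ --> X](mulr0 2)]; apply: cvgMr.
move=> m; rewrite intB_ge0 => [|x _]; last exact: sqr_ge0.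
have i1 : itg (fun x => (th m x - u x) ^+ 2) by exact/L2_sqr/L2B.
have i2 : itg (fun x => (th' m x - u' x) ^+ 2) by exact/L2_sqr/L2B.
rewrite -intBZ// -intBZ// -intBD; [|exact: itgZ|exact: itgZ].
apply: le_intB; [|by apply: itgD; exact: itgZ|].
  by apply/L2_sqr/L2B; exact: L2D.
move=> x _; have := sqr_ge0 ((th m x - u x) - (th' m x - u' x)); nra.
Qed.

Lemma dct (F : nat -> 'rV[R]_n -> R) (f g : 'rV[R]_n -> R) : (forall m, measurable_fun B (F m)) ->
  measurable_fun B f -> itg g -> (forall m x, B x -> `|F m x| <= g x) ->
  (forall x, B x -> F ^~ x @ \oo --> f x) ->
  itg f /\ intB (F m) @[m --> \oo] --> intB f.
Proof.
move=> mF mf ig Fg Ff.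
have [] := @dominated_convergence _ _ _ mu B mB (fun m => EFin \o F m) (EFin \o f) (EFin \o g).
- by move=> m; exact/measurable_EFinP.
- exact/measurable_EFinP.
- by apply: aeW => x Bx; apply: cvg_EFin; [exact: nearW|exact: Ff].
- exact: ig.
- by apply: aeW => x m Bx; rewrite lee_fin Fg.
move=> if_ _ h; split => //; apply: fine_cvg.
by rewrite fineK//; exact: integrable_fin_num.
Qed.

(** Convergence of the integrals gives no pointwise convergence of [A m], so domination does not
    apply to [A m * g] directly. Instead [g] is truncated at height [K]: the integral is at most [K]
    times that of [A m], plus the integral of [g - gK K], which is small for large [K] uniformly in
    [m]. *)
Lemma cvg_weighted (A : nat -> 'rV[R]_n -> R) g :
  (forall m, measurable_fun B (A m)) -> (forall m x, B x -> 0 <= A m x <= 1) ->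
  itg g -> (forall x, B x -> 0 <= g x) -> intB (A m) @[m --> \oo] --> (0 : R) ->
  intB (fun x => A m x * g x) @[m --> \oo] --> (0 : R).
Proof.
move=> mA A01 ig g0 A0.
have mg := itg_measurable ig.
pose gK (K : nat) x := Num.min (g x) K%:R.
have mgK K : measurable_fun B (gK K) by apply: measurable_minr.
have igK K : itg (gK K).
  apply: (le_itg _ _ ig) => // x Bx; rewrite ger0_norm ?ge_min ?lexx//.
  by rewrite le_min g0//=.
pose z := (fun=> 0) : 'rV[R]_n -> R.
have [_ h] : itg z /\ (fun K => intB (fun x => g x - gK K x)) @ \oo --> intB z.
  apply: (@dct _ _ g) => //.
  - by move=> m; exact: measurable_funB.
  - exact: measurable_cst.
  - move=> m x Bx; rewrite ger0_norm ?subr_ge0 ?ge_min ?lexx//.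
    by rewrite gerBl le_min g0//=.
  - move=> x Bx; apply: cvg_near_cst.
    near=> K; rewrite /gK /= min_l ?subrr//.
    near: K; exact: nbhs_infty_ger.
have bA m : bdd (A m).
  apply: (@bddP _ _ _ 1) => // x Bx; have /andP[a0 a1] := A01 m x Bx.
  by rewrite ger0_norm.
have iAg m : itg (fun x => A m x * g x).
  by under eq_fun do rewrite mulrC; exact: itgM.
apply/cvgr0Pnorm_le => e e0.
have [K hK] : exists K, intB (fun x => g x - gK K x) <= e / 2.
  have : \forall K \near \oo, intB (fun x => g x - gK K x) <= e / 2.
    apply: (cvgr_le _ h).
    by rewrite /z /intB Rintegral_cst// mul0r divr_gt0.
  by move=> /filter_ex.
have A0' : \forall m \near \oo, intB (A m) <= e / 2 / (K%:R + 1).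
  apply: (cvgr_le _ A0).
  by rewrite !divr_gt0// ltr_wpDl.
near=> m.
have Am : intB (A m) <= e / 2 / (K%:R + 1) by near: m.
rewrite ger0_norm; last first.
  by apply: intB_ge0 => x Bx; rewrite mulr_ge0 ?g0//; case/andP: (A01 m x Bx).
apply: (@le_trans _ _ (K%:R * intB (A m) + intB (fun x => g x - gK K x))).
  rewrite -intBZ; last exact: bdd_itg.
  rewrite -intBD; [|exact/itgZ/bdd_itg|exact: itgB].
  apply: le_intB => //; first by apply: itgD; [exact/itgZ/bdd_itg|exact: itgB].
  move=> x Bx; have /andP[a0 a1] := A01 m x Bx; rewrite /gK.
  have K0 : 0 <= K%:R :> R by [].
  have := g0 x Bx; case: (leP (g x) K%:R) => ?; nra.
have : K%:R * intB (A m) <= e / 2.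
  have K0 : 0 <= K%:R :> R by [].
  have A_ge0 : 0 <= intB (A m) by apply: intB_ge0 => x Bx; case/andP: (A01 m x Bx).
  move: Am; rewrite ler_pdivlMr ?ltr_wpDl//; nra.
lra.
Unshelve. all: by end_near.
Qed.

End convergence.

(** * Test functions and Sobolev spaces *)

Section test_functions.
Context {R : realType} {n : nat}.
Implicit Types (u v w b g : 'rV[R]_n -> R) (th : nat -> 'rV[R]_n -> R).

Notation B := (@B1 R n).

Lemma test_smooth u : test_function u -> smooth u.
Proof. by move=> /test_functionP[]. Qed.

Lemma test_function_sub u v : smooth v -> (forall x, v x != 0 -> u x != 0) ->
  test_function u -> test_function v.
Proof.
move=> sv vu /test_functionP[su cu uB]; apply/test_functionP; split => //.
  apply: subclosed_compact cu _; first exact: closed_closure.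
  exact: closureS.
by apply: subset_trans uB; exact: closureS.
Qed.

Lemma test_function_inside (rho : R) u : rho < 1 -> smooth u ->
  (forall x, rho < enorm x -> u x = 0) -> test_function u.
Proof.
move=> rho1 su u0; apply/test_functionP; split => //.
  apply: subclosed_compact (@compact_cB1 R n) _; first exact: closed_closure.
  have cl : closed [set x : 'rV[R]_n | enorm x <= rho].
    apply: (@preimage_closed _ _ (@enorm R n) [set t : R | t <= rho]) => [x _|]; first exact: continuous_enorm.
    exact: closed_le.
  have h : [set x | u x != 0] `<=` [set x : 'rV[R]_n | enorm x <= rho].
    by move=> x /=; apply: contraNT; rewrite -ltNge => /u0 ->.
  move=> x /(closureS h); rewrite -(closure_id _).1// => xr.
  by rewrite /cB1/= (le_trans xr)// ltW.
have cl : closed [set x : 'rV[R]_n | enorm x <= rho].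
  apply: (@preimage_closed _ _ (@enorm R n) [set t : R | t <= rho]) => [x _|]; first exact: continuous_enorm.
  exact: closed_le.
have h : [set x | u x != 0] `<=` [set x : 'rV[R]_n | enorm x <= rho].
  by move=> x /=; apply: contraNT; rewrite -ltNge => /u0 ->.
move=> x /(closureS h); rewrite -(closure_id _).1// => xr.
by rewrite /B1/= (le_lt_trans xr).
Qed.

Lemma test_function_out u x : test_function u -> ~ B x -> u x = 0.
Proof.
move=> /test_functionP[_ _ uB] Bx; apply/eqP/negPn/negP => ux.
by apply: Bx; apply: uB; exact: subset_closure.
Qed.

Lemma test_pderiv_out u i x : test_function u -> ~ B x -> pderiv i u x = 0.
Proof.
move=> /test_functionP[_ _ uB] Bx.
rewrite /pderiv (@near_eq_derive _ _ _ _ (cst 0)) ?derive_cst//.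
have : nbhs x (~` closure [set x | u x != 0]).
  apply: open_nbhs_nbhs; split; last by move=> /uB.
  exact/closed_openC/closed_closure.
apply: filterS => y; apply: contra_notP => /eqP uy.
exact: subset_closure.
Qed.

Lemma bdd_smooth u : smooth u -> bdd u.
Proof. by move=> /smooth_continuous/bdd_continuous. Qed.

Lemma bdd_pderiv u i : smooth u -> bdd (pderiv i u).
Proof. by move=> su; apply: bdd_smooth; exact: smooth_pderiv. Qed.

Lemma test_functionM u v : test_function u -> smooth v ->
  test_function (fun x => u x * v x).
Proof.
move=> tu sv; apply: (test_function_sub _ _ tu).
  by apply: smoothM => //; exact: test_smooth.
by move=> x; rewrite mulf_eq0 negb_or => /andP[].
Qed.

Lemma test_function_comp (G : R -> R) u : smooth1 G -> G 0 = 0 -> test_function u ->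
  test_function (G \o u).
Proof.
move=> sG G0 tu; apply: (test_function_sub _ _ tu).
  by apply: smooth_comp => //; exact: test_smooth.
by move=> x /=; apply: contra => /eqP ->; rewrite G0.
Qed.

Lemma intB_pderiv u i : test_function u -> intB (pderiv i u) = 0.
Proof.
move=> tu; have su := test_smooth tu.
have sb : supported_in_box 1 u.
  move=> x j xj; apply: test_function_out tu _ => Bx.
  by have := lt_trans (lt_le_trans xj (coord_le_enorm x j)) Bx; rewrite ltxx.
have := integral_pderiv_eq0 (i := i) (smooth_continuous su)
  (fun x => smooth_derivable su) (smooth_continuous (smooth_pderiv i su)) sb.
rewrite /intB /Rintegral => h; rewrite -[RHS]/(fine 0%E) -h.
congr fine; rewrite integral_mkcond; apply: eq_integral => x _.
rewrite /patch; case: ifPn => //; rewrite notin_setE => Bx.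
by rewrite test_pderiv_out.
Qed.

Lemma intB_by_parts u v i : test_function u -> smooth v ->
  intB (fun x => u x * pderiv i v x) = - intB (fun x => pderiv i u x * v x).
Proof.
move=> tu sv; have su := test_smooth tu; apply/eqP.
rewrite -addr_eq0 -intBD; last 2 first.
- by apply: bdd_itg; apply: bddM; [exact: bdd_smooth|exact: bdd_pderiv].
- by apply: bdd_itg; apply: bddM; [exact: bdd_pderiv|exact: bdd_smooth].
rewrite -[X in _ == X](intB_pderiv i (test_functionM tu sv)).
by rewrite pderivM//; apply/eqP; apply: eq_intB => x _; rewrite addrC.
Qed.

(** Scaled bumps converge to the indicator of the positive half-line. When [t <= 0], the condition
    [c <= 0] keeps the argument nonpositive for every [m]. *)
Lemma cvg_bump (t c : R) : 0 < t \/ t <= 0 /\ c <= 0 ->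
  (fun m : nat => expbump (m%:R * t + c)) @ \oo --> (((0 < t)%R)%:R : R).
Proof.
case=> [t0|[t0 c0]]; last first.
  rewrite ltNge t0/=; apply: cvg_near_cst; apply: nearW => m.
  rewrite /expbump flat_npos// -[leRHS]addr0 lerD// mulr_ge0_le0//.
rewrite t0; apply/cvgrPdist_le => e e0; near=> m.
have h : e^-1 <= m%:R * t + c.
  rewrite -lerBlDr -ler_pdivrMr//; near: m; exact: nbhs_infty_ger.
have p : 0 < m%:R * t + c by rewrite (lt_le_trans _ h)// invr_gt0.
rewrite ger0_norm ?subr_ge0 ?expbump_le1// expbumpE//.
rewrite lerBlDl -lerBlDr (le_trans _ (expR_ge1Dx _))// lerD2l lerN2.
by rewrite -[leRHS]invrK lef_pV2// posrE invr_gt0.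
Unshelve. all: by end_near.
Qed.

(** The shift by [-1] makes the function vanish where [m (1 - sqn x) <= 1], hence near the unit
    sphere and outside it; this is what gives it a compact support inside the open ball. *)
Definition cutoff (m : nat) (x : 'rV[R]_n) : R := expbump (m%:R * (1 - sqn x) + -1).

Lemma smooth_bump_affine u a c : smooth u -> smooth (fun x => expbump (a * u x + c)).
Proof.
move=> su; apply: (@smooth_comp _ _ expbump (fun x => a * u x + c)).
  exact: smooth1_expbump.
exact: smooth_affine.
Qed.

Lemma test_cutoff m : test_function (cutoff m).
Proof.
(* The index [m.+1] avoids a division by zero at [m = 0] and is still sufficient, since
   [m / m.+1 <= 1]. *)
apply: (@test_function_inside (Num.sqrt (1 - m.+1%:R^-1))).
- rewrite -[ltRHS]sqrtr1 ltr_sqrt// ltrBlDr ltrDl invr_gt0//.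
- rewrite (_ : cutoff m = fun x => expbump (- m%:R * sqn x + (m%:R - 1))).
    by apply: smooth_bump_affine; exact: smooth_sqn.
  by apply/funext => x; rewrite /cutoff; congr expbump; ring.
- move=> x; rewrite ltNge => h.
  have : 1 - m.+1%:R^-1 < sqn x.
    by rewrite ltNge; apply: contra h => h; exact: ler_wsqrtr.
  rewrite ltrBlDr -ltrBlDl => {}h; rewrite /cutoff /expbump flat_npos//.
  have m0 : 0 <= m%:R :> R by [].
  have : m%:R * m.+1%:R^-1 <= 1 :> R.
    by rewrite ler_pdivrMr ?ltr0n// mul1r ler_nat.
  by move=> h2; rewrite subr_le0 (le_trans _ h2)// ler_wpM2l// ltW.
Qed.

Lemma sqn_lt1 (x : 'rV[R]_n) : B x <-> sqn x < 1.
Proof.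
by rewrite /B1/= /enorm -/(sqn x) -[X in _ < X]sqrtr1 ltr_sqrt.
Qed.

End test_functions.

(** * The fundamental lemma of the calculus of variations *)

Section fundamental_lemma.
Context {R : realType} {n : nat}.
Implicit Types (u v w b g D : 'rV[R]_n -> R) (th : nat -> 'rV[R]_n -> R).

Notation mu := (@volume R n).
Notation B := (@B1 R n).

Let mB : measurable B := @measurable_B1 R n.

Definition orthant (a : 'rV[R]_n) : set 'rV[R]_n :=
  [set x | forall i, a ord0 i < x ord0 i].

Lemma cvg_prodr (I : Type) (r : seq I) (F : I -> nat -> R) (l : I -> R) :
  (forall i, F i @ \oo --> l i) ->
  (fun m => \prod_(i <- r) F i m) @ \oo --> \prod_(i <- r) l i.
Proof.
move=> Fl; elim: r => [|i r IH].
  by rewrite big_nil; under eq_fun do rewrite big_nil; exact: cvg_cst.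
by rewrite big_cons; under eq_fun do rewrite big_cons; exact: cvgM.
Qed.

Lemma measurable_orthant a : measurable (orthant a).
Proof.
rewrite (_ : orthant a = [set x | forall i, `]a ord0 i, +oo[%classic (x ord0 i)]).
  by apply: (measurable_box (P := fun i => `]a ord0 i, +oo[%classic)) => i; exact: measurable_itv.
by apply/seteqP; split => x /= h i; have := h i; rewrite /= in_itv/= andbT.
Qed.

(** Open half-lines generate the Borel sets of the line, and a half-space is the union of the
    orthants whose other bounds are [- m]. *)
Lemma measurable_sub_orthants :
  (@measurable _ 'rV[R]_n) `<=` <<s [set orthant a | a in [set: 'rV[R]_n]] >>.
Proof.
set G := [set orthant a | a in _].
apply: smallest_sub; first exact: smallest_sigma_algebra.
rewrite -bigcup_seq => A [i _ [C mC <-]]; rewrite setTI.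
have [s0 sD sU] := smallest_sigma_algebra [set: 'rV[R]_n] G.
pose H := [set C : set R | <<s G >> ((fun x : 'rV[R]_n => x ord0 i) @^-1` C)].
suff : (@ocitv R).-sigma.-measurable `<=` H by apply.
rewrite RGenOInfty.measurableE; apply: smallest_sub => /=.
  split.
  - by rewrite /H /= preimage_set0.
  - by move=> E HE; rewrite /H /= setTD preimage_setC -setTD; exact: sD.
  - by move=> F HF; rewrite /H /= preimage_bigcup; exact: sU.
move=> _ [t ->]; rewrite /H /=.
pose a (m : nat) : 'rV[R]_n := \row_j (if j == i then t else - m%:R).
rewrite (_ : _ @^-1` _ = \bigcup_m orthant (a m)).
  by apply: sU => m; apply: sub_sigma_algebra; exists (a m).
apply/seteqP; split => [x /=|x [m _] /(_ i)]; rewrite /= in_itv/= andbT; last first.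
  by rewrite mxE eqxx.
move=> tx; have [m hm] : exists m : nat, forall j, - m%:R < x ord0 j.
  exists (Num.truncn (\sum_j `|x ord0 j|)).+1 => j.
  rewrite ltrNl (le_lt_trans _ (truncnS_gt _))// (bigD1 j)//=.
  rewrite (le_trans (ler_norm _))// normrN lerDl; exact: sumr_ge0.
by exists m => // j; rewrite mxE; case: eqP => [->//|_]; exact: hm.
Qed.

Lemma bdd_indic (A : set 'rV[R]_n) : measurable A -> bdd (\1_A : 'rV[R]_n -> R).
Proof.
move=> mA; apply: (@bddP _ _ _ 1); first exact: measurable_indic.
by move=> x _; rewrite indicE; case: (_ \in _); rewrite ?normr1 ?normr0.
Qed.

(** Dynkin's argument: orthants are stable under intersection, and the measurable sets over which
    [D] integrates to 0 form a lambda-system. Orthants, and the whole space, belong to it because on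
    the ball their indicators are limits of test functions bounded by 1. *)
Lemma intB_indic_eq0 D : itg D -> (forall t, test_function t -> intB (fun x => D x * t x) = 0) ->
  forall A, measurable A -> intB (fun x => D x * \1_A x) = 0.
Proof.
move=> iD hD A mA.
pose H := [set A : set 'rV[R]_n | measurable A /\ intB (fun x => D x * \1_A x) = 0].
suff : <<s [set orthant a | a in [set: 'rV[R]_n]] >> `<=` H.
  by move=> /(_ A (measurable_sub_orthants mA))[].
have absD : itg (fun x => `|D x|) by exact: integrable_norm.
have mD := itg_measurable iD.
have lim (F : nat -> 'rV[R]_n -> R) (A' : set 'rV[R]_n) : measurable A' ->
    (forall m, measurable_fun B (F m)) -> (forall m x, B x -> `|F m x| <= 1) ->
    (forall m, intB (fun x => D x * F m x) = 0) ->
    (forall x, B x -> F ^~ x @ \oo --> (\1_A' x : R)) -> H A'.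
  move=> mA' mF F1 F0 Fl; split=> //.
  have [_ h] : itg (fun x => D x * \1_A' x) /\
      (fun m => intB (fun x => D x * F m x)) @ \oo --> intB (fun x => D x * \1_A' x).
    apply: (@dct _ _ _ _ (fun x => `|D x|)) => //.
    - by move=> m; exact: measurable_funM.
    - by apply: measurable_funM => //; exact: (proj1 (bdd_indic mA')).
    - by move=> m x Bx; rewrite normrM ler_piMr// F1.
    - by move=> x Bx; apply: cvgMr; exact: Fl.
  move/cvg_lim : h => <-//; rewrite (_ : (fun m => _) = cst 0) ?lim_cst//.
  exact/funext.
apply: lambda_system_subset.
- move=> _ _ [a _ <-] [b _ <-]; exists (\row_i Num.max (a ord0 i) (b ord0 i)) => //.
  apply/seteqP; split => x /=.
    by move=> h; split=> i; have := h i; rewrite mxE gt_max => /andP[].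
  by move=> [ha hb] i; rewrite mxE gt_max ha hb.
- split.
  + by [].
  + apply: (lim (fun m => @cutoff R n m)) => //.
    * by move=> m; exact: (proj1 (bdd_smooth (test_smooth (test_cutoff m)))).
    * by move=> m x _; rewrite ger0_norm ?expbump_ge0// expbump_le1.
    * by move=> m; apply: hD; exact: test_cutoff.
    * move=> x /sqn_lt1 Bx; rewrite indicE in_setT.
      have p : 0 < 1 - sqn x by rewrite subr_gt0.
      by have := @cvg_bump R (1 - sqn x) (-1) (or_introl p); rewrite p.
  + move=> A1 A2 A21 [m1 I1] [m2 I2]; split; first exact: measurableD.
    rewrite -(subrr 0) -{1}I1 -I2 -intBB; [|exact: itgM (bdd_indic m1)|exact: itgM (bdd_indic m2)].
    apply: eq_intB => x _; rewrite -mulrBr !indicE in_setD.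
    case: (boolP (x \in A2)) => [x2|x2]; last by rewrite andbT subr0.
    by rewrite andbF (mem_set (A21 _ (set_mem x2))) subrr.
  + move=> F ndF HF; apply: (lim (fun m => \1_(F m))).
    * by apply: bigcupT_measurable => m; case: (HF m).
    * by move=> m; have [mF _] := HF m; exact: (proj1 (bdd_indic mF)).
    * by move=> m x _; rewrite indicE; case: (_ \in _); rewrite ?normr1 ?normr0.
    * by move=> m; case: (HF m).
    * move=> x _; apply: cvg_near_cst; rewrite indicE.
      case: (pselect ((\bigcup_m F m) x)) => [Fx|Fx].
        rewrite mem_set//; have [k _ Fk] := Fx.
        near=> m; rewrite indicE mem_set//.
        have /ndF/subsetPset : (k <= m)%N by near: m; exact: nbhs_infty_ge.
        by apply.
      rewrite memNset//; apply: nearW => m; rewrite indicE memNset// => Fm.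
      by apply: Fx; exists m.
- move=> _ [a _ <-].
  pose F (m : nat) (x : 'rV[R]_n) := (\prod_i expbump (m%:R * x ord0 i + - m%:R * a ord0 i)) * cutoff m x.
  have sP (m : nat) : smooth (fun x : 'rV[R]_n => \prod_i expbump (m%:R * x ord0 i + - m%:R * a ord0 i)).
    by apply: smooth_prod => i; apply: smooth_bump_affine; exact: smooth_coord.
  have tF m : test_function (F m).
    rewrite /F; under eq_fun do rewrite mulrC.
    by apply: test_functionM => //; exact: test_cutoff.
  apply: (lim F); first exact: measurable_orthant.
  + by move=> m; exact: (proj1 (bdd_smooth (test_smooth (tF m)))).
  + move=> m x _; rewrite normrM normr_prod mulr_ile1//.
    * exact: prodr_ge0.
    * apply: prodr_ile1 => i _.
      by rewrite normr_ge0/= ger0_norm ?expbump_ge0// expbump_le1.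
    * by rewrite ger0_norm ?expbump_ge0// expbump_le1.
  + by move=> m; exact: hD.
  + move=> x /sqn_lt1 Bx; rewrite -[X in _ --> X]mulr1; apply: cvgM; last first.
      have p : 0 < 1 - sqn x by rewrite subr_gt0.
      by have := @cvg_bump R (1 - sqn x) (-1) (or_introl p); rewrite p.
    rewrite (_ : \1_ _ x = \prod_i ((0 < x ord0 i - a ord0 i)%R)%:R).
      apply: cvg_prodr => i.
      rewrite (_ : (fun m : nat => _) = fun m => expbump (m%:R * (x ord0 i - a ord0 i) + 0)).
        by apply: cvg_bump; case: (ltP 0 (x ord0 i - a ord0 i)); [left|right].
      by apply/funext => m; congr expbump; ring.
    rewrite indicE; case: (pselect (orthant a x)) => ax.
      by rewrite mem_set// big1// => i _; rewrite subr_gt0 ax.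
    rewrite memNset//; have /existsNP[i /negP axi] := ax.
    by rewrite (bigD1 i)//= subr_gt0 (negbTE axi) mul0r.
- by [].
Unshelve. all: by end_near.
Qed.

(** The integral of [D] vanishes over the sets where it is positive and where it is negative; the
    difference of the two is the integral of its absolute value. *)
Lemma fundamental_lemma D : itg D ->
  (forall t, test_function t -> intB (fun x => D x * t x) = 0) ->
  ae_B1 (fun x => D x = 0).
Proof.
move=> iD hD; have h0 := intB_indic_eq0 iD hD.
have mD := itg_measurable iD.
pose P := B `&` D @^-1` `]0, +oo[%classic; pose N := B `&` D @^-1` `]-oo, 0[%classic.
have mP : measurable P by apply: mD => //; exact: measurable_itv.
have mN : measurable N by apply: mD => //; exact: measurable_itv.
have absD : itg (fun x => `|D x|) by exact: integrable_norm.
have : intB (fun x => `|D x|) = 0.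
  rewrite -(subrr 0) -{1}(h0 _ mP) -(h0 _ mN) -intBB; [|exact: itgM (bdd_indic mP)|exact: itgM (bdd_indic mN)].
  apply: eq_intB => x Bx; rewrite -mulrBr !indicE.
  have -> : (x \in P) = (0 < D x).
    by apply/idP/idP => [/set_mem[_]|h]; [|apply: mem_set; split => //]; rewrite /= in_itv/= andbT.
  have -> : (x \in N) = (D x < 0).
    by apply/idP/idP => [/set_mem[_]|h]; [|apply: mem_set; split => //]; rewrite /= in_itv/=.
  case: (ltgtP (D x) 0) => [d|d|->].
  - by rewrite ltr0_norm// sub0r mulrN1.
  - by rewrite gtr0_norm// subr0 mulr1.
  - by rewrite normr0 mul0r.
move=> /(intB_sqr_eq0 (itg_measurable absD) absD (fun x _ => normr_ge0 _)).
by apply: ae_B1S => x _ /eqP; rewrite normr_eq0 => /eqP.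
Qed.

End fundamental_lemma.

(** * Weak gradients and the chain rule in [H^1_0] *)

Section sobolev.
Context {R : realType} {n : nat}.
Implicit Types (u v w b : 'rV[R]_n -> R) (th : nat -> 'rV[R]_n -> R)
  (g : 'I_n -> 'rV[R]_n -> R).

Notation B := (@B1 R n).

Lemma test_L2 u : test_function u -> L2 u.
Proof. by move=> /test_smooth/bdd_smooth/bdd_L2. Qed.

Lemma pderiv_L2 u i : test_function u -> L2 (pderiv i u).
Proof. by move=> /test_smooth/(bdd_pderiv i)/bdd_L2. Qed.

Lemma L2_measurable_sqr u : L2 u -> measurable_fun B (fun x => u x ^+ 2).
Proof. by move=> /L2_measurable mu'; exact: measurable_funX. Qed.

Lemma weak_gradient_limit th u g : (forall m, test_function (th m)) -> L2 u ->
  (forall i, L2 (g i)) -> cvgL2 th u ->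
  (forall i, cvgL2 (fun m => pderiv i (th m)) (g i)) -> weak_gradient u g.
Proof.
move=> tth Lu Lg thu thg i; split=> // t tt.
have h1 := cvgL2_int (fun m => test_L2 (tth m)) Lu (pderiv_L2 i tt) thu.
have h2 := cvgL2_int (fun m => pderiv_L2 i (tth m)) (Lg i) (test_L2 tt) (thg i).
apply: cvg_unique h1 _; first exact: Rhausdorff.
rewrite (_ : (fun m => intB _) = fun m => - intB (fun x => pderiv i (th m) x * t x)).
  exact: cvgN.
by apply/funext => m; apply: intB_by_parts => //; exact: test_smooth.
Qed.

Lemma weak_gradient_unique u g g' i : weak_gradient u g -> weak_gradient u g' ->
  ae_B1 (fun x => g i x = g' i x).
Proof.
move=> /(_ i)[Lg hg] /(_ i)[Lg' hg'].
have : ae_B1 (fun x => g i x - g' i x = 0).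
  apply: fundamental_lemma => [|t tt]; first by apply: itgB; exact: L2_itg.
  have : intB (fun x => g i x * t x) = intB (fun x => g' i x * t x).
    by apply: oppr_inj; rewrite -hg// -hg'.
  move/eqP; rewrite -subr_eq0 -intBB; [|exact: L2M (test_L2 tt)|exact: L2M (test_L2 tt)].
  move=> /eqP <-; apply: eq_intB => x _; ring.
by apply: ae_B1S => x _ /eqP; rewrite subr_eq0 => /eqP.
Qed.

Lemma wgradP u : sobolevH10 u -> weak_gradient u (wgrad u).
Proof.
by move=> [[_ [g ug]] _]; rewrite /wgrad; case: xgetP => [_ _ //|/(_ g)].
Qed.

Lemma L2_wgrad u i : sobolevH10 u -> L2 (wgrad u i).
Proof. by move=> /wgradP/(_ i)[]. Qed.

Lemma H10_L2 u : sobolevH10 u -> L2 u. Proof. by move=> [[]]. Qed.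

(** The criterion through which every membership in [sobolevH10] is established below. As [wgrad] is
    a chosen weak gradient, the limit of the gradients identifies it only almost everywhere. *)
Lemma H10_limit th u g : (forall m, test_function (th m)) -> L2 u ->
  (forall i, L2 (g i)) -> cvgL2 th u ->
  (forall i, cvgL2 (fun m => pderiv i (th m)) (g i)) ->
  sobolevH10 u /\ forall i, ae_B1 (fun x => wgrad u i x = g i x).
Proof.
move=> tth Lu Lg thu thg.
have ug := weak_gradient_limit tth Lu Lg thu thg.
have uw : weak_gradient u (wgrad u).
  by rewrite /wgrad; case: xgetP => [_ _ //|/(_ g)].
have wg i := weak_gradient_unique i uw ug.
split=> //; split; first by split=> //; exists g.
exists th; split => // i.
rewrite (_ : (fun m => _) = fun m => intB (fun x => (pderiv i (th m) x - g i x) ^+ 2)).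
  exact: thg.
apply/funext => m; apply: ae_eq_intB.
- by apply: L2_measurable_sqr; apply: L2B; [exact: pderiv_L2|exact: (uw i).1].
- by apply: L2_measurable_sqr; apply: L2B; [exact: pderiv_L2|exact: Lg].
- by apply: ae_B1S (wg i) => x _ ->.
Qed.

Lemma H10N u : sobolevH10 u ->
  sobolevH10 (fun x => - u x) /\ forall i, ae_B1 (fun x => wgrad (fun x => - u x) i x = - wgrad u i x).
Proof.
move=> Hu; have [_ [th [tth thu thg]]] := Hu.
have LN v : L2 v -> L2 (fun x => - v x).
  by move=> Lv; have := L2Z (-1) Lv; under eq_fun do rewrite mulN1r.
have N m i : pderiv i (fun x => - th m x) = fun x => - pderiv i (th m) x.
  by apply/funext => x; apply: deriveN; exact/smooth_derivable/test_smooth.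
apply: (@H10_limit (fun m x => - th m x)).
- move=> m; have := test_functionM (tth m) (@smooth_cst R n (-1)).
  by under eq_fun do rewrite mulrN1.
- exact/LN/H10_L2.
- by move=> i; exact/LN/L2_wgrad.
- apply: cvg_trans thu; rewrite (_ : (fun m => _) = fun m => intB (fun x => (th m x - u x) ^+ 2))//.
  by apply/funext => m; apply: eq_intB => x _; ring.
- move=> i; apply: cvg_trans (thg i).
  rewrite (_ : (fun m => _) = fun m => intB (fun x => (pderiv i (th m) x - wgrad u i x) ^+ 2))//.
  by apply/funext => m; rewrite N; apply: eq_intB => x _; ring.
Qed.

Lemma lipschitz1 (G : R -> R) : smooth1 G -> (forall t, 0 <= derive1 G t <= 1) ->
  forall s t, `|G s - G t| <= `|s - t|.
Proof.
move=> sG G01 s t; wlog st : s t / s < t => [H|].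
  have [|ts|->] := ltgtP s t; first exact: H.
    by rewrite distrC [leRHS]distrC; exact: H.
  by rewrite !subrr !normr0.
have [] := @MVT _ G (derive1 G) _ _ st.
- by move=> x _; rewrite derive1E; apply: derivableP; exact: sG 0%N _.
- by apply: continuous_subspaceT; exact: smooth1_continuous.
- move=> z _ h; rewrite distrC h normrM [leRHS]distrC ler_piMl//.
  by have /andP[a b] := G01 z; rewrite ger0_norm.
Qed.

Lemma measurable_comp1 (G : R -> R) u : continuous G -> measurable_fun B u ->
  measurable_fun B (fun x => G (u x)).
Proof.
move=> cG mu'; apply: (measurableT_comp (f := G)) => //.
exact: continuous_measurable_fun.
Qed.

(** The difference is split as [c (p (a - b) + (p - q) b)]: the bounded [p] multiplies the
    convergent factor, while [p - q] meets only the fixed function [b]. It will be used with [p],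
    [q] values of [G'] and [a], [b] partial derivatives. *)
Lemma sqr_product_sub_le (p q a b c K : R) : 0 <= p <= 1 -> c ^+ 2 <= K ^+ 2 ->
  (p * c * a - q * c * b) ^+ 2 <=
  2 * K ^+ 2 * (a - b) ^+ 2 + 2 * K ^+ 2 * ((p - q) ^+ 2 * b ^+ 2).
Proof.
move=> /andP[p0 p1] cK; have p2 : p ^+ 2 <= 1 by nra.
have -> : p * c * a - q * c * b = c * (p * (a - b) + (p - q) * b) by ring.
rewrite exprMn.
have h : (p * (a - b) + (p - q) * b) ^+ 2 <= 2 * (a - b) ^+ 2 + 2 * ((p - q) ^+ 2 * b ^+ 2).
  have := sqr_ge0 (p * (a - b) - (p - q) * b).
  have := ler_wpM2r (sqr_ge0 (a - b)) p2; nra.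
apply: (@le_trans _ _ (K ^+ 2 * (2 * (a - b) ^+ 2 + 2 * ((p - q) ^+ 2 * b ^+ 2)))).
  by rewrite ler_pM ?sqr_ge0.
by rewrite le_eqVlt; apply/orP; left; apply/eqP; ring.
Qed.

(** The functions [G(th m) X], with [th m] test functions approximating [u], are test functions. The
    delicate term of their gradient is [G'(th m)] times the gradient of [th m]: the Lipschitz bound
    on [G'] gives convergence of [G'(th m)] in mean square, and [cvg_weighted] upgrades it to
    convergence against the fixed integrable weight [wgrad u i ^+ 2]. *)
Lemma H10_comp (G : R -> R) (C : R) u X : smooth1 G -> G 0 = 0 ->
  (forall t, 0 <= derive1 G t <= 1) ->
  (forall s t, `|derive1 G s - derive1 G t| <= C * `|s - t|) ->
  smooth X -> sobolevH10 u ->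
  sobolevH10 (fun x => G (u x) * X x) /\
  forall i, ae_B1 (fun x => wgrad (fun x => G (u x) * X x) i x =
    derive1 G (u x) * X x * wgrad u i x + G (u x) * pderiv i X x).
Proof.
move=> sG G0 G01 GC sX Hu; have [_ [th [tth thu thg]]] := Hu.
have Lu := H10_L2 Hu; have Ldu i := L2_wgrad i Hu.
have Gl := lipschitz1 sG G01.
have cG := smooth1_continuous sG.
have sG' := smooth1_derive1 sG; have cG' := smooth1_continuous sG'.
have LG v : L2 v -> L2 (fun x => G (v x)).
  move=> Lv; have mG : measurable_fun B (fun x => G (v x)).
    by apply: measurable_comp1 => //; exact: L2_measurable.
  split=> //; apply: (le_itg _ _ (L2_sqr Lv)).
    exact: measurable_funX.
  move=> x _; rewrite normrX -[leRHS]real_normK ?num_real// lerXn2r ?nnegrE//.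
  by have := Gl (v x) 0; rewrite G0 !subr0.
have bG' v : measurable_fun B v -> bdd (fun x => derive1 G (v x)).
  move=> mv; apply: (@bddP _ _ _ 1); first exact: measurable_comp1.
  by move=> x _; have /andP[a b] := G01 (v x); rewrite ger0_norm.
have bX := bdd_smooth sX; have bdX i := bdd_pderiv i sX.
have [mX [K hK]] := bX.
have Lth m := test_L2 (tth m).
have Ldth m i := pderiv_L2 i (tth m).
have mth m := L2_measurable (Lth m).
have dE m i : pderiv i (fun x => G (th m x) * X x) =
    fun x => derive1 G (th m x) * X x * pderiv i (th m) x + G (th m x) * pderiv i X x.
  have sth := test_smooth (tth m).
  rewrite (@pderivM _ _ (G \o th m))//; last exact: smooth_comp.
  by rewrite pderiv_comp//; apply/funext => x /=; rewrite mulrAC.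
apply: (@H10_limit (fun m x => G (th m x) * X x)).
- move=> m; apply: (@test_functionM _ _ (G \o th m)) => //.
  exact: test_function_comp.
- by apply: L2Mb => //; exact: LG.
- move=> i; apply: L2D; last by apply: L2Mb => //; exact: LG.
  under eq_fun do rewrite mulrC; apply: L2Mb => //; apply: bddM => //.
  by apply: bG'; exact: L2_measurable.
- apply: (@cvgL2_le _ _ th u _ _ (K ^+ 2)) => // [m|m|m x Bx].
  + exact/L2_sqr/L2B.
  + by apply/L2_sqr/L2B; apply: L2Mb => //; exact: LG.
  + rewrite -mulrBl exprMn mulrC ler_pM ?sqr_ge0//.
      by rewrite -[X x ^+ 2]real_normK ?num_real// lerXn2r ?nnegrE// ?hK// (le_trans _ (hK x Bx)).
    by rewrite -[leLHS]real_normK ?num_real// -[leRHS]real_normK ?num_real// lerXn2r ?nnegrE.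
- have bA v : measurable_fun B v -> bdd (fun x => derive1 G (v x) * X x).
    by move=> mv; apply: bddM => //; exact: bG'.
  have LA v w : L2 v -> L2 w -> L2 (fun x => derive1 G (v x) * X x * w x).
    move=> Lv Lw; under eq_fun do rewrite mulrC; apply: L2Mb => //.
    by apply: bA; exact: L2_measurable.
  move=> i; rewrite /cvgL2; under eq_fun do rewrite dE.
  apply: cvgL2D.
  + by move=> m; exact: LA.
  + exact: LA.
  + by move=> m; apply: L2Mb => //; exact: LG.
  + by apply: L2Mb => //; exact: LG.
  (* As [G'] takes values in [[0, 1]], so does [A m], as [cvg_weighted] requires. *)
  + pose A m x := (derive1 G (th m x) - derive1 G (u x)) ^+ 2.
    have A01 m x : 0 <= A m x <= 1.
      rewrite sqr_ge0/=; have /andP[? ?] := G01 (th m x); have /andP[? ?] := G01 (u x).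
      by rewrite /A; nra.
    have mA m : measurable_fun B (A m).
      apply: measurable_funX; apply: measurable_funB; apply: measurable_comp1 => //.
      exact: L2_measurable.
    have iA m : itg (A m).
      apply/bdd_itg/(@bddP _ _ _ 1) => // x _; have /andP[a0 a1] := A01 m x.
      by rewrite ger0_norm.
    have A0 : intB (A m) @[m --> \oo] --> (0 : R).
      apply: (@cvg0_le _ _ (fun m => C ^+ 2 * intB (fun x => (th m x - u x) ^+ 2))).
        move=> m; rewrite intB_ge0 => [|x _]; last by case/andP: (A01 m x).
        have i2 : itg (fun x => (th m x - u x) ^+ 2) by exact/L2_sqr/L2B.
        rewrite -intBZ//; apply: le_intB => //; first exact: itgZ.
        move=> x _; have h := GC (th m x) (u x).
        rewrite -[leLHS]real_normK ?num_real// -[X in _ * X]real_normK ?num_real// -exprMn.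
        by rewrite lerXn2r ?nnegrE// (le_trans _ h).
      by rewrite -[X in _ --> X](mulr0 (C ^+ 2)); apply: cvgMr.
    have Ag : intB (fun x => A m x * wgrad u i x ^+ 2) @[m --> \oo] --> (0 : R).
      by apply: cvg_weighted => //; [exact/L2_sqr|move=> x _; exact: sqr_ge0].
    have iAg m : itg (fun x => A m x * wgrad u i x ^+ 2).
      under eq_fun do rewrite mulrC; apply: itgM; first exact/L2_sqr.
      apply/(@bddP _ _ _ 1) => // x _; have /andP[a0 a1] := A01 m x.
      by rewrite ger0_norm.
    have iD m : itg (fun x => (pderiv i (th m) x - wgrad u i x) ^+ 2).
      exact/L2_sqr/L2B.
    apply: (@cvg0_le _ _ (fun m => 2 * K ^+ 2 * intB (fun x => (pderiv i (th m) x - wgrad u i x) ^+ 2) +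
      2 * K ^+ 2 * intB (fun x => A m x * wgrad u i x ^+ 2))); last first.
      rewrite -[X in _ --> X](addr0 0); apply: cvgD.
        by rewrite -[X in _ --> X](mulr0 (2 * K ^+ 2)); apply: cvgMr; exact: thg.
      by rewrite -[X in _ --> X](mulr0 (2 * K ^+ 2)); apply: cvgMr.
    move=> m; rewrite intB_ge0 => [|x _]; last exact: sqr_ge0.
    rewrite -intBZ// -intBZ// -intBD; [|exact: itgZ|exact: itgZ].
    apply: le_intB; [|by apply: itgD; exact: itgZ|].
      by apply/L2_sqr/L2B; exact: LA.
    move=> x Bx; rewrite /A.
    have XK : X x ^+ 2 <= K ^+ 2.
      by rewrite -[X x ^+ 2]real_normK ?num_real// lerXn2r ?nnegrE// ?hK// (le_trans _ (hK x Bx)).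
    exact: sqr_product_sub_le (G01 _) XK.
  + have [_ [K' hK']] := bdX i.
    apply: (@cvgL2_le _ _ th u _ _ (K' ^+ 2)) => // [m|m|m x Bx].
    * exact/L2_sqr/L2B.
    * by apply/L2_sqr/L2B; apply: L2Mb => //; exact: LG.
    * rewrite -mulrBl exprMn mulrC ler_pM ?sqr_ge0//.
        by rewrite -[leLHS]real_normK ?num_real// lerXn2r ?nnegrE// ?hK'// (le_trans _ (hK' x Bx)).
      by rewrite -[leLHS]real_normK ?num_real// -[leRHS]real_normK ?num_real// lerXn2r ?nnegrE.
Qed.

End sobolev.

(** * The truncation function *)

Section scaled_ramp.
Context {R : realType}.
Implicit Types (s t e : R).

(** The function [G] of the overview. Scaling argument and value by inverse factors keeps the slopes
    those of [ramp], hence in [[0, 1]] for every [e]. *)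
Definition threshold e t := e * ramp (e^-1 * t + -1).

Lemma derive1_threshold e t : 0 < e ->
  derive1 (threshold e) t = derive1 ramp (e^-1 * t + -1).
Proof.
move=> e0; have /derivableP h := @smooth1_ramp R 0%N (e^-1 * t + -1).
have [_] := is_derive_affine e h; rewrite !derive1E => ->.
by rewrite mulfV ?gt_eqF// mul1r.
Qed.

Lemma smooth1_threshold e : smooth1 (threshold e).
Proof. by apply: smooth1_affine; exact: smooth1_ramp. Qed.

Lemma derive1_threshold01 e t : 0 < e -> 0 <= derive1 (threshold e) t <= 1.
Proof.
by move=> e0; rewrite derive1_threshold// derive1_ramp_ge0 derive1_ramp_le1.
Qed.

Lemma derive1_threshold_lipschitz e : 0 < e -> exists C : R, forall s t,
  `|derive1 (threshold e) s - derive1 (threshold e) t| <= C * `|s - t|.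
Proof.
move=> e0; have [C C0 hC] := @derive1_ramp_lipschitz R; exists (C * e^-1) => s t.
rewrite !derive1_threshold// (le_trans (hC _ _))//.
rewrite (_ : _ - _ = e^-1 * (s - t)); last by ring.
by rewrite normrM [`|e^-1|]gtr0_norm ?invr_gt0// mulrA.
Qed.

Lemma threshold_eq0 e t : 0 < e -> t <= e -> threshold e t = 0.
Proof.
move=> e0 te; rewrite /threshold ramp_npos ?mulr0//.
by rewrite subr_le0 mulrC ler_pdivrMr// mul1r.
Qed.

Lemma threshold_ge0 e t : 0 < e -> 0 <= threshold e t.
Proof. by move=> e0; rewrite mulr_ge0 ?ramp_ge0// ltW. Qed.

Lemma threshold_gt0 e t : 0 < e -> e < t -> 0 < threshold e t.
Proof.
move=> e0 et; rewrite mulr_gt0// ramp_gt0// subr_gt0 mulrC ltr_pdivlMr//.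
by rewrite mul1r.
Qed.

Lemma threshold_ge e t : 0 < e -> t - 2 * e <= threshold e t.
Proof.
move=> e0; have := ler_wpM2l (ltW e0) (ramp_ge (e^-1 * t + -1)).
apply: le_trans; rewrite mulrBr mulrDr mulrA mulfV ?gt_eqF//; lra.
Qed.

Lemma threshold_le e t : 0 < e -> 0 <= t -> threshold e t <= t.
Proof.
move=> e0 t0; have [te|te] := leP t e; first by rewrite threshold_eq0.
have h : 0 <= e^-1 * t + -1.
  by rewrite subr_ge0 mulrC ler_pdivlMr// mul1r ltW.
have := ler_wpM2l (ltW e0) (ramp_le h).
rewrite /threshold => /le_trans; apply.
rewrite mulrDr mulrA mulfV ?gt_eqF//; lra.
Qed.

(** Where the argument of [ramp] is positive, with inverse [y], the derivative [(1 + y) exp(-y)]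
    lies between [exp(-y)] and 1. *)
Lemma cvg_derive1_threshold t : 0 < t ->
  (fun m : nat => derive1 (threshold (m.+1%:R^-1)) t) @ \oo --> (1 : R).
Proof.
move=> t0; have h := @cvg_bump R t (t - 1) (or_introl t0).
rewrite t0 in h.
apply: (@squeeze_cvgr _ _ _ _ (fun m : nat => expbump (m%:R * t + (t - 1))) (cst 1)).
- apply: nearW => m; rewrite derive1_threshold ?invr_gt0// derive1_ramp_le1 andbT invrK.
  rewrite -natr1 mulrDl mul1r -addrA derive1_ramp /expbump /flat; case: ifPn => // p.
  by rewrite hornerC hornerD hornerC hornerX ler_wpM2r ?expR_ge0// lerDl invr_ge0 ltW.
- exact: h.
- exact: cvg_cst.
Qed.

Lemma ramp_homo s t : s <= t -> ramp s <= ramp t.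
Proof.
move=> st; have [s0|s0] := leP s 0; first by rewrite ramp_npos// ramp_ge0.
by rewrite ler_pM ?expbump_ge0 ?expbump_le// ltW.
Qed.

Lemma ramp_lt s t : 0 < t -> s < t -> ramp s < ramp t.
Proof.
move=> t0 st; have [s0|s0] := leP s 0; first by rewrite ramp_npos// ramp_gt0.
rewrite (@le_lt_trans _ _ (s * expbump t))//.
  by rewrite ler_wpM2l ?expbump_le// ltW.
by rewrite ltr_pM2r// expbump_gt0.
Qed.

Lemma derive2_ramp_ge0 t : 0 <= derive1 (derive1 ramp) t :> R.
Proof.
rewrite derive1_ramp derive1_flat /flat; case: ifPn => // z0; rewrite mulr_ge0 ?expR_ge0//.
rewrite /dflat derivD derivC derivX add0r hornerM hornerXn mulr_ge0//.
  by rewrite exprn_ge0// invr_ge0 ltW.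
by rewrite !hornerE addrAC subrr add0r invr_ge0 ltW.
Qed.

End scaled_ramp.

(** * Poincare's inequality and smooth elements of [H^1_0] *)

Section sobolev_facts.
Context {R : realType} {n : nat}.
Implicit Types (u v w b : 'rV[R]_n -> R).

Notation B := (@B1 R n).

Lemma H10_by_parts u v i : sobolevH10 u -> smooth v ->
  intB (fun x => wgrad u i x * v x) = - intB (fun x => u x * pderiv i v x).
Proof.
move=> Hu sv; have [_ [th [tth thu thg]]] := Hu.
have h1 := cvgL2_int (fun m => test_L2 (tth m)) (H10_L2 Hu) (bdd_L2 (bdd_pderiv i sv)) thu.
have h2 := cvgL2_int (fun m => pderiv_L2 i (tth m)) (L2_wgrad i Hu) (bdd_L2 (bdd_smooth sv)) (thg i).
apply: cvg_unique h2 _; first exact: Rhausdorff.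
rewrite (_ : (fun m => intB _) = fun m => - intB (fun x => th m x * pderiv i v x)).
  exact: cvgN.
by apply/funext => m; rewrite intB_by_parts// opprK.
Qed.

(** Integration by parts of [t^2] against the derivative of the coordinate [x_i], followed by
    [- 2 a d y <= a^2 / 2 + 2 d^2] for [|y| <= 1]; absorbing half of the left-hand side gives the
    constant 4. *)
Lemma test_poincare (t : 'rV[R]_n -> R) i : test_function t ->
  intB (fun x => t x ^+ 2) <= 4 * intB (fun x => pderiv i t x ^+ 2).
Proof.
move=> tt; have st := test_smooth tt.
have Lt := test_L2 tt; have Ldt := pderiv_L2 i tt.
have := intB_by_parts i (test_functionM tt st) (@smooth_coord R n i).
rewrite pderiv_coord eqxx pderivM//.
have -> : intB (fun x => t x * t x * cst 1%:R x) = intB (fun x => t x ^+ 2).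
  by apply: eq_intB => x _; rewrite /= mulr1 expr2.
move=> E.
have L1 : itg (fun x => t x ^+ 2) by exact: L2_sqr.
have L2' : itg (fun x => pderiv i t x ^+ 2) by exact: L2_sqr.
have h : - intB (fun x => (pderiv i t x * t x + t x * pderiv i t x) * x ord0 i) <=
    intB (fun x => 2^-1 * t x ^+ 2 + 2 * pderiv i t x ^+ 2).
  rewrite -mulN1r -intBZ; last first.
    apply: itgM; last exact/bdd_smooth/smooth_coord.
    by apply: itgD; exact: L2M.
  apply: le_intB.
  - apply: itgZ; apply: itgM; last exact/bdd_smooth/smooth_coord.
    by apply: itgD; exact: L2M.
  - by apply: itgD; exact: itgZ.
  - move=> x Bx; have := coord_le_enorm x i => /le_trans/(_ (ltW Bx)).
    rewrite ler_norml => /andP[x1 x2].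
    move: (t x) (pderiv i t x) (x ord0 i) x1 x2 => a d y x1 x2.
    have h1 := sqr_ge0 (a + 2 * d * y).
    have h2 : y ^+ 2 <= 1 by nra.
    have h3 := ler_wpM2r (sqr_ge0 d) h2.
    nra.
move: h; rewrite -E intBD; [|exact: itgZ|exact: itgZ].
rewrite intBZ// intBZ//; lra.
Qed.

Lemma H10_poincare u (i : 'I_n) : sobolevH10 u -> ae_B1 (fun x => wgrad u i x = 0) ->
  ae_B1 (fun x => u x = 0).
Proof.
move=> Hu wu; have [_ [th [tth thu thg]]] := Hu.
have Lu := H10_L2 Hu.
have iu : itg (fun x => u x ^+ 2) by exact: L2_sqr.
suff : intB (fun x => u x ^+ 2) = 0.
  move=> /(intB_sqr_eq0 (L2_measurable_sqr Lu) iu (fun x _ => sqr_ge0 _)).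
  by apply: ae_B1S => x _ /eqP; rewrite sqrf_eq0 => /eqP.
(* From [u^2 <= 2 (th m - u)^2 + 2 (th m)^2]; the constant 8 is twice that of [test_poincare], and
   the assumption on [wgrad u i] allows subtracting it from the derivative of [th m]. *)
have le m : intB (fun x => u x ^+ 2) <= 2 * intB (fun x => (th m x - u x) ^+ 2) +
    8 * intB (fun x => (pderiv i (th m) x - wgrad u i x) ^+ 2).
  have -> : intB (fun x => (pderiv i (th m) x - wgrad u i x) ^+ 2) =
      intB (fun x => pderiv i (th m) x ^+ 2).
    apply: ae_eq_intB.
    - by apply: L2_measurable_sqr; apply: L2B; [exact: pderiv_L2|exact: L2_wgrad].
    - by apply: L2_measurable_sqr; exact: pderiv_L2.
    - by apply: ae_B1S wu => x _ ->; rewrite subr0.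
  have := test_poincare i (tth m) => h.
  have i1 : itg (fun x => (th m x - u x) ^+ 2) by apply: L2_sqr; apply: L2B => //; exact: test_L2.
  have i2 : itg (fun x => th m x ^+ 2) by apply: L2_sqr; exact: test_L2.
  apply: (@le_trans _ _ (2 * intB (fun x => (th m x - u x) ^+ 2) + 2 * intB (fun x => th m x ^+ 2))); last by lra.
  rewrite -intBZ// -intBZ// -intBD; [|exact: itgZ|exact: itgZ].
  apply: le_intB => //; first by apply: itgD; exact: itgZ.
  by move=> x _; have := sqr_ge0 (2 * th m x - u x); nra.
apply/eqP; rewrite eq_le; apply/andP; split; last by apply: intB_ge0 => x _; exact: sqr_ge0.
have L : (fun m => 2 * intB (fun x => (th m x - u x) ^+ 2) +
    8 * intB (fun x => (pderiv i (th m) x - wgrad u i x) ^+ 2)) @ \oo --> (2 * 0 + 8 * 0 : R).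
  by apply: cvgD; apply: cvgMr => //; exact: thg.
rewrite !mulr0 addr0 in L.
by rewrite -(cvg_lim (@Rhausdorff R) L); apply: limr_ge; [apply/cvg_ex; exists 0|exact: nearW].
Qed.

(** Such a [v] need not have compact support in the open ball, but its truncations at level
    [m.+1%:R^-1] do, since [v] is small near the sphere. Positivity makes the derivatives of the
    truncations converge at every point of the ball. *)
Lemma H10_smooth v : smooth v -> (forall x, B x -> 0 < v x) ->
  (forall e : R, 0 < e -> exists2 r, r < 1 & forall x : 'rV[R]_n, r < enorm x -> v x <= e) ->
  sobolevH10 v /\ forall i, ae_B1 (fun x => wgrad v i x = pderiv i v x).
Proof.
move=> sv v0 v1.
have e0 m : 0 < m.+1%:R^-1 :> R by rewrite invr_gt0.
pose th m := threshold (m.+1%:R^-1) \o v.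
have sth m : smooth (th m) by apply: smooth_comp => //; exact: smooth1_threshold.
have tth m : test_function (th m).
  have [r r1 hr] := v1 _ (e0 m).
  apply: (test_function_inside r1) => // x /hr vx.
  by rewrite /th /= threshold_eq0.
have [mv [K hK]] := bdd_smooth sv.
have z0 : intB ((fun=> 0) : 'rV[R]_n -> R) = 0.
  by rewrite /intB Rintegral_cst ?mul0r//; exact: measurable_B1.
apply: (@H10_limit _ _ th).
- exact: tth.
- exact/bdd_L2/bdd_smooth.
- by move=> i; exact/bdd_L2/bdd_pderiv.
- rewrite /cvgL2 -z0.
  apply: (proj2 (@dct _ _ (fun m x => (th m x - v x) ^+ 2) (fun=> 0) (fun=> K ^+ 2) _ _ _ _ _)).
  + move=> m; apply: L2_measurable_sqr; apply: L2B; first exact: test_L2.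
    exact/bdd_L2/bdd_smooth.
  + exact: measurable_cst.
  + exact: bdd_itg (bdd_cst _).
  + move=> m x Bx; rewrite ger0_norm ?sqr_ge0// -[leLHS]real_normK ?num_real//.
    have vx := v0 x Bx; have vK := le_trans (ler_norm _) (hK x Bx).
    have t1 := threshold_ge0 (v x) (e0 m); have t2 := threshold_le (e0 m) (ltW vx).
    rewrite lerXn2r ?nnegrE// ?(le_trans (ltW vx))//.
    by rewrite ler_norml /th/=; apply/andP; split; lra.
  + move=> x Bx; apply: (@cvg0_le _ _ (fun m => 4 * (m.+1%:R^-1 ^+ 2))); last first.
      rewrite -[X in _ --> X](mulr0 4); apply: cvgMr.
      rewrite -[X in _ --> X](mulr0 0); under eq_fun do rewrite expr2.
      by apply: cvgM; exact: cvg_harmonic.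
    move=> m; rewrite sqr_ge0/=.
    have vx := v0 x Bx.
    have t1 := threshold_ge (v x) (e0 m); have t2 := threshold_le (e0 m) (ltW vx).
    have aux (p q z : R) : 0 < q -> z - 2 * q <= p -> p <= z -> (p - z) ^+ 2 <= 4 * q ^+ 2.
      by move=> *; nra.
    exact: aux (e0 m) t1 t2.
- move=> i; rewrite /cvgL2 -z0.
  have [mdv [K' hK']] := bdd_pderiv i sv.
  apply: (proj2 (@dct _ _ (fun m x => (pderiv i (th m) x - pderiv i v x) ^+ 2) (fun=> 0) (fun=> K' ^+ 2) _ _ _ _ _)).
  + move=> m; apply: L2_measurable_sqr; apply: L2B; first exact: pderiv_L2.
    exact/bdd_L2/bdd_pderiv.
  + exact: measurable_cst.
  + exact: bdd_itg (bdd_cst _).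
  + move=> m x Bx; rewrite ger0_norm ?sqr_ge0//.
    rewrite pderiv_comp//; last exact: smooth1_threshold.
    have aux (q d k : R) : 0 <= q <= 1 -> `|d| <= k -> (q * d - d) ^+ 2 <= k ^+ 2.
      move=> /andP[q0 q1]; rewrite ler_norml => /andP[d1 d2].
      have h1 : d ^+ 2 <= k ^+ 2 by nra.
      have h2 : (q - 1) ^+ 2 <= 1 by nra.
      have := ler_wpM2r (sqr_ge0 d) h2; nra.
    by apply: aux; [exact: derive1_threshold01|exact: hK'].
  + move=> x Bx; set d := pderiv i v x.
    rewrite (_ : (fun m => _) =
        fun m => (derive1 (threshold (m.+1%:R^-1)) (v x) * d - d) ^+ 2).
      have h := cvgB (cvgM (cvg_derive1_threshold (v0 x Bx)) (@cvg_cst _ d _ _ _)) (@cvg_cst _ d _ _ _).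
      rewrite mul1r subrr in h; have {}h := h eventually_filter eventually_filter eventually_filter eventually_filter.
      by have h2 := cvgM h h; rewrite mulr0 in h2; exact: h2.
    apply/funext => m; rewrite /th pderiv_comp//; exact: smooth1_threshold.
Qed.

End sobolev_facts.

(** * Sign changes of eigenfunctions *)

Section spectral.
Context {R : realType} {n : nat}.
Implicit Types (u v w V P X phi : 'rV[R]_n -> R).

Notation B := (@B1 R n).

Lemma continuousM_at u v x : {for x, continuous u} -> {for x, continuous v} ->
  {for x, continuous (fun y => u y * v y)}.
Proof. by move=> cu cv; exact: (cvgM cu cv). Qed.

Lemma continuousX2_at u x : {for x, continuous u} ->
  {for x, continuous (fun y => u y ^+ 2)}.
Proof. by move=> cu; exact: (cvgM cu cu). Qed.

Lemma continuousD_at u v x : {for x, continuous u} -> {for x, continuous v} ->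
  {for x, continuous (fun y => u y + v y)}.
Proof. by move=> cu cv; exact: (cvgD cu cv). Qed.

Lemma continuousB_at u v x : {for x, continuous u} -> {for x, continuous v} ->
  {for x, continuous (fun y => u y - v y)}.
Proof. by move=> cu cv; exact: (cvgB cu cv). Qed.

Lemma continuous_cst_at (c : R) (x : 'rV[R]_n) :
  {for x, continuous (fun=> c)}.
Proof. exact: cst_continuous. Qed.

Definition weight V := [/\ bdd V, forall x, B x -> 0 < V x &
  forall x, B x -> {for x, continuous V}].

(** The weak form of [- laplacian phi = m V (phi - c)]: the two terms of the eigenvalue equation are
    merged, with [m] standing for [lam + sigma] and [c] for the average. *)
Definition weak_eigen V (m c : R) phi := forall v, sobolevH10 v ->
  intB (grad_dot phi v) = m * intB (fun x => V x * (phi x - c) * v x).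

Lemma B1_0 : B 0.
Proof.
by rewrite /B1/= /enorm big1 ?sqrtr0// => i _; rewrite mxE expr0n.
Qed.

Lemma intB_weight_gt0 V : weight V -> 0 < intB V.
Proof.
move=> [bV V0 cV]; apply: (intB_gt0 bV) B1_0 _ _ => [x /V0/ltW//||].
  exact: cV B1_0.
exact: V0 B1_0.
Qed.

Lemma itg_grad_dot u v : sobolevH10 u -> sobolevH10 v -> itg (grad_dot u v).
Proof. by move=> Hu Hv; apply: itg_sum => i; apply: L2M; exact: L2_wgrad. Qed.

Lemma eigenfunction_weak (lam sigma : R) V u : eigenfunction lam V sigma u ->
  weak_eigen V (lam + sigma) (avg V u) u.
Proof.
by move=> [_ _ h] v /h /eqP; rewrite subr_eq => /eqP ->; rewrite mulrDl addrC.
Qed.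

Lemma L2_subc u (c : R) : L2 u -> L2 (fun x => u x - c).
Proof. by move=> Lu; apply: L2B => //; exact: bdd_L2 (bdd_cst c). Qed.

Lemma L2_weight V u : weight V -> L2 u -> L2 (fun x => V x * u x).
Proof.
by move=> [bV _ _] Lu; under eq_fun do rewrite mulrC; exact: L2Mb.
Qed.

Lemma intB_centred V u : weight V -> L2 u ->
  intB (fun x => V x * (u x - avg V u)) = 0.
Proof.
move=> wV Lu; have V0 := intB_weight_gt0 wV; have [bV _ _] := wV.
have -> : intB (fun x => V x * (u x - avg V u)) =
    intB (fun x => V x * u x - avg V u * V x).
  by apply: eq_intB => x _; ring.
rewrite intBB; [|exact/L2_itg/L2_weight|exact/itgZ/bdd_itg].
rewrite intBZ; last exact: bdd_itg.
by rewrite /avg divfK ?gt_eqF// subrr.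
Qed.

(** Tested against [phi], the equation equates the Dirichlet energy with [m] times a nonnegative
    integral, since [V (phi - c)] has integral 0. If [m <= 0], the gradient vanishes, and so does
    [phi] by Poincare's inequality. *)
Lemma weak_eigen_gt0 V m phi (i0 : 'I_n) : weight V -> sobolevH10 phi -> nonzero phi ->
  weak_eigen V m (avg V phi) phi -> 0 < m.
Proof.
move=> wV Hp nz he; have [bV V0 cV] := wV; have Lp := H10_L2 Hp.
have Lc := L2_subc (avg V phi) Lp.
rewrite ltNge; apply/negP => m0; apply: nz.
have E : intB (grad_dot phi phi) = m * intB (fun x => V x * (phi x - avg V phi) ^+ 2).
  rewrite he//; congr (_ * _).
  transitivity (intB (fun x => V x * (phi x - avg V phi) ^+ 2 +
     avg V phi * (V x * (phi x - avg V phi)))).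
    by apply: eq_intB => x _; ring.
  rewrite intBD; last 2 first.
  - by under eq_fun do rewrite mulrC; apply: itgM => //; exact: L2_sqr.
  - exact/itgZ/L2_itg/L2_weight.
  rewrite intBZ; last exact/L2_itg/L2_weight.
  by rewrite intB_centred// mulr0 addr0.
have G0 : intB (grad_dot phi phi) <= 0.
  rewrite E mulr_le0_ge0// intB_ge0// => x Bx.
  by rewrite mulr_ge0 ?sqr_ge0// ltW// V0.
apply: (H10_poincare (i := i0)) => //.
have Lw i := L2_wgrad i Hp.
have g0 : intB (fun x => wgrad phi i0 x ^+ 2) = 0.
  apply/eqP; rewrite eq_le intB_ge0 ?andbT => [|x _]; last exact: sqr_ge0.
  rewrite (le_trans _ G0)//; apply: le_intB.
  - exact: L2_sqr.
  - exact: itg_grad_dot.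
  - move=> x _; rewrite /grad_dot (bigD1 i0)//= -expr2 lerDl.
    by apply: sumr_ge0 => i _; rewrite -expr2 sqr_ge0.
move: g0 => /(intB_sqr_eq0 (L2_measurable_sqr (Lw i0)) (L2_sqr (Lw i0)) (fun x _ => sqr_ge0 _)).
by apply: ae_B1S => x _ /eqP; rewrite sqrf_eq0 => /eqP.
Qed.

Lemma ae_le_intB u v : itg u -> itg v -> ae_B1 (fun x => u x <= v x) ->
  intB u <= intB v.
Proof.
move=> iu iv uv; have mu' := itg_measurable iu; have mv := itg_measurable iv.
pose w x := Num.max (u x) (v x).
have mw : measurable_fun B w by exact: measurable_maxr.
have vw : ae_B1 (fun x => v x = w x) by apply: ae_B1S uv => x _ h; rewrite /w max_r.
rewrite (ae_eq_intB mv mw vw); apply: le_intB => //; first exact: ae_eq_itg vw iv.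
by move=> x _; rewrite /w le_max lexx.
Qed.

Lemma ae_B1_forall (I : finType) (Q : I -> 'rV[R]_n -> Prop) :
  (forall i, ae_B1 (Q i)) -> ae_B1 (fun x => forall i, Q i x).
Proof.
move=> h; have : {ae @volume R n, forall x, forall i, B x -> Q i x}.
  by apply: filter_forall => i; exact: h.
by apply: filterS => x h' Bx i; exact: h'.
Qed.

(* The gradient of [u = G(phi) X] is [G'(phi) X grad phi], and [0 <= G' <= 1], so
   [|grad u|^2 <= grad phi . grad (G(phi) X^2)]; testing the equation of [phi]
   against [G(phi) X^2] then bounds the Dirichlet energy of [u]. *)
Lemma rayleigh_threshold_lt (lam sigma c e : R) V phi P X x0 :
  weight V -> sobolevH10 phi -> 0 < lam + sigma ->
  weak_eigen V (lam + sigma) c phi ->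
  bdd P -> (forall x, B x -> {for x, continuous P}) ->
  ae_B1 (fun x => phi x = P x) ->
  smooth X -> 0 < e -> 2 * e < c ->
  (forall i x, B x -> e < P x -> pderiv i X x = 0) ->
  B x0 -> e < P x0 -> X x0 != 0 ->
  let u := fun x => threshold e (phi x) * X x in
  avg V u = 0 ->
  [/\ sobolevH10 u, nonzero u & rayleigh lam V u < sigma].
Proof.
move=> wV Hp m0 he bP cP phiP sX e0 ec dX Bx0 ex0 Xx0 u avgu.
have [bV V0 cV] := wV; have Lp := H10_L2 Hp.
have [C GC] := derive1_threshold_lipschitz e0.
have sG := @smooth1_threshold R e; have cG := smooth1_continuous sG.
have G0 : threshold e 0 = 0 by rewrite threshold_eq0// ltW.
have G01 t := derive1_threshold01 t e0.
have [Hu wu] := H10_comp sG G0 G01 GC sX Hp.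
have sX2 : smooth (fun x => X x * X x) by exact: smoothM.
have [Hv wv] := H10_comp sG G0 G01 GC sX2 Hp.
rewrite -/u in Hu wu; set v := fun x => _ * (X x * X x) in Hv wv.
have Lu := H10_L2 Hu; have Lv := H10_L2 Hv.
have bX := bdd_smooth sX.
have bG : bdd (fun x => threshold e (P x)).
  have [mP [K hK]] := bP; split; first exact: measurable_comp1.
  exists K => x /hK; apply: le_trans.
  by have := lipschitz1 sG G01 (P x) 0; rewrite G0 !subr0.
have uP : ae_B1 (fun x => u x = threshold e (P x) * X x).
  by apply: ae_B1S phiP => x _; rewrite /u => ->.
pose U x := threshold e (P x) * X x.
have bU : bdd U by exact: bddM.
have cGP : {for x0, continuous (fun x => threshold e (P x))}.
  by apply: (@continuous_comp _ _ _ P (threshold e)); [exact: cP|exact: cG].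
have cX : {for x0, continuous X} by exact: (smooth_continuous sX).
have cU : {for x0, continuous U} by exact: continuousM_at.
have U0 : U x0 != 0 by rewrite mulf_neq0// gt_eqF// threshold_gt0.
have cu : centred V u = u by apply/funext => x; rewrite /centred avgu subr0.
have iVu : itg (fun x => V x * u x ^+ 2).
  by under eq_fun do rewrite mulrC; apply: itgM => //; exact: L2_sqr.
have bVU : bdd (fun x => V x * U x ^+ 2) by apply: bddM => //; exact: bddM.
have D0 : 0 < intB (fun x => V x * u x ^+ 2).
  have -> : intB (fun x => V x * u x ^+ 2) = intB (fun x => V x * U x ^+ 2).
    apply: ae_eq_intB; [exact: itg_measurable|exact: (proj1 bVU)|].
    by apply: ae_B1S uP => x _ ->.
  apply: (@intB_gt0 _ _ _ x0) => //.
  - by move=> x Bx; rewrite mulr_ge0 ?sqr_ge0// ltW// V0.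
  - by apply: continuousM_at; [exact: cV|exact: continuousX2_at].
  - by rewrite mulr_gt0 ?V0// lt_def sqr_ge0 sqrf_eq0 U0.
split=> //.
  move=> u0; move: D0; rewrite (_ : intB _ = intB ((fun=> 0) : 'rV[R]_n -> R)).
    by rewrite /intB Rintegral_cst ?mul0r ?ltxx//; exact: measurable_B1.
  apply: ae_eq_intB; [exact: itg_measurable|exact: measurable_cst|].
  by apply: ae_B1S u0 => x _ ->; rewrite expr0n mulr0.
rewrite /rayleigh cu ltr_pdivrMr// ltrBlDl -mulrDl.
have h1 : intB (grad_dot u u) <= intB (grad_dot phi v).
  apply: ae_le_intB; [exact: itg_grad_dot|exact: itg_grad_dot|].
  apply: ae_B1S (ae_B1_and phiP (ae_B1_and (ae_B1_forall wu) (ae_B1_forall wv))) => x Bx [pP [wux wvx]].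
  apply: ler_sum => i _; rewrite wux wvx pderivM//.
  have /andP[g0 g1] := G01 (phi x).
  have -> : threshold e (phi x) * pderiv i X x = 0.
    rewrite pP; have [Pe|Pe] := leP (P x) e; first by rewrite threshold_eq0// mul0r.
    by rewrite dX// mulr0.
  have -> : threshold e (phi x) * (pderiv i X x * X x + X x * pderiv i X x) = 0.
    rewrite pP; have [Pe|Pe] := leP (P x) e; first by rewrite threshold_eq0// mul0r.
    by rewrite dX// mul0r mulr0 addr0 mulr0.
  rewrite !addr0; move: (wgrad phi i x) (X x) g0 g1; move: (derive1 _ _) => q d y q0 q1.
  have := ler_wpM2r (sqr_ge0 (y * d)) (_ : q * q <= q); rewrite ler_piMr// => /(_ isT).
  nra.
apply: le_lt_trans h1 _; rewrite he// ltr_pM2l// -subr_gt0.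
have iVv : itg (fun x => V x * (phi x - c) * v x).
  under eq_fun do rewrite -mulrA mulrC; apply: itgM => //.
  by apply: L2M => //; exact: L2_subc.
(* [W] is the difference of the two integrands, written with the continuous representative. It is
   nonnegative since [threshold e t >= t - 2 * e > t - c], and positive at [x0]. *)
pose W x := V x * X x ^+ 2 * (threshold e (P x) * (threshold e (P x) - P x + c)).
have bPc : bdd (fun x => threshold e (P x) - P x + c).
  have [mG [K1 hK1]] := bG; have [mP [K2 hK2]] := bP.
  split; first by apply: measurable_funD => //; exact: measurable_funB.
  exists (K1 + K2 + `|c|) => x Bx; rewrite (le_trans (ler_normD _ _))// lerD2r.
  by rewrite (le_trans (ler_normB _ _))// lerD ?hK1 ?hK2.
have bW : bdd W.
  by apply: bddM; [apply: bddM => //; exact: bddM|exact: bddM].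
rewrite -intBB// (_ : intB _ = intB W).
  apply: (@intB_gt0 _ _ _ x0) => //.
  - move=> x Bx; rewrite mulr_ge0//; first by rewrite mulr_ge0 ?sqr_ge0// ltW// V0.
    have [Pe|Pe] := leP (P x) e; first by rewrite threshold_eq0// mul0r.
    have := threshold_ge (P x) e0; have := threshold_gt0 e0 Pe.
    by move=> t0 t1; rewrite mulr_ge0 ?(ltW t0)//; lra.
  - apply: continuousM_at.
      by apply: continuousM_at; [exact: cV|exact: continuousX2_at].
    apply: continuousM_at => //; apply: continuousD_at; last exact: continuous_cst_at.
    by apply: continuousB_at => //; exact: cP.
  - have X20 : 0 < X x0 ^+ 2 by rewrite lt_def sqr_ge0 sqrf_eq0 Xx0.
    have t0 := threshold_gt0 e0 ex0; have t1 := threshold_ge (P x0) e0.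
    rewrite mulr_gt0//; first by rewrite mulr_gt0// V0.
    by rewrite mulr_gt0//; lra.
apply: ae_eq_intB; first by apply: itg_measurable; exact: itgB.
  by case: bW.
by apply: ae_B1S phiP => x _ pP; rewrite /u /v /W pP; ring.
Qed.

End spectral.

(** * Behaviour near the unit sphere *)

Section boundary.
Context {R : realType} {n : nat}.
Implicit Types (u v w V P X phi : 'rV[R]_n -> R).

Notation B := (@B1 R n).

Lemma enorm_axis (r : R) (i0 : 'I_n) : 0 <= r -> enorm (r *: delta_mx ord0 i0) = r.
Proof.
move=> r0; rewrite /enorm (bigD1 i0)//= big1 ?addr0 => [|i ii0].
  by rewrite !mxE !eqxx mulr1 sqrtr_sqr ger0_norm.
by rewrite !mxE eqxx (negbTE ii0) mulr0 expr0n.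
Qed.

Lemma lt_sqn (a : R) (x : 'rV[R]_n) : 0 <= a -> (a ^+ 2 < sqn x) = (a < enorm x).
Proof.
by move=> a0; rewrite -enorm_sqr ltr_pXn2r// nnegrE enorm_ge0.
Qed.

(* [barrier] is superharmonic, vanishes on the unit sphere and equals 1 on the
   ball of radius [a]. *)
Definition barrier (a : R) (x : 'rV[R]_n) : R :=
  - (ramp (1 - a ^+ 2))^-1 * ramp (1 * sqn x + - a ^+ 2) + 1.

Lemma smooth_barrier a : smooth (barrier a).
Proof.
apply: smoothD; last exact: smooth_cst.
apply: (@smooth_comp _ _ (fun t => - (ramp (1 - a ^+ 2))^-1 * ramp (1 * t + - a ^+ 2)) sqn).
  by apply: smooth1_affine; exact: smooth1_ramp.
exact: smooth_sqn.
Qed.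

Lemma pderiv_barrier a i : pderiv i (barrier a) =
  fun x => - (ramp (1 - a ^+ 2))^-1 * derive1 ramp (1 * sqn x + - a ^+ 2) * (2 * x ord0 i).
Proof.
pose g t := - (ramp (1 - a ^+ 2))^-1 * ramp (1 * t + - a ^+ 2).
have sg : smooth1 g by apply: smooth1_affine; exact: smooth1_ramp.
have dg t : derive1 g t = - (ramp (1 - a ^+ 2))^-1 * derive1 ramp (1 * t + - a ^+ 2).
  have /derivableP h := @smooth1_ramp R 0%N (1 * t + - a ^+ 2).
  by have [_] := is_derive_affine (- (ramp (1 - a ^+ 2))^-1) h; rewrite !derive1E mulr1.
have -> : barrier a = fun x => (g \o sqn) x + cst 1 x by [].
rewrite pderivD; [|by apply: smooth_comp => //; exact: smooth_sqn|exact: smooth_cst].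
rewrite pderiv_comp//; last exact: smooth_sqn.
by apply/funext => x; rewrite pderiv_cst addr0 pderiv_sqn dg.
Qed.

Lemma pderiv2_barrier a i (x : 'rV[R]_n) : pderiv i (pderiv i (barrier a)) x =
  - (ramp (1 - a ^+ 2))^-1 * (derive1 (derive1 ramp) (1 * sqn x + - a ^+ 2) * (2 * x ord0 i) ^+ 2
     + 2 * derive1 ramp (1 * sqn x + - a ^+ 2)).
Proof.
rewrite pderiv_barrier.
pose g t := - (ramp (1 - a ^+ 2))^-1 * derive1 ramp (1 * t + - a ^+ 2).
have sr := smooth1_derive1 (@smooth1_ramp R).
have sg : smooth1 g by apply: smooth1_affine.
have dg t : derive1 g t = - (ramp (1 - a ^+ 2))^-1 * derive1 (derive1 ramp) (1 * t + - a ^+ 2).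
  have /derivableP h := sr 0%N (1 * t + - a ^+ 2).
  by have [_] := is_derive_affine (- (ramp (1 - a ^+ 2))^-1) h; rewrite !derive1E mulr1.
have s2 : smooth (fun y : 'rV[R]_n => 2 * y ord0 i + 0) by apply: smooth_affine; exact: smooth_coord.
transitivity (pderiv i (fun y : 'rV[R]_n => (g \o sqn) y * (2 * y ord0 i + 0)) x).
  by congr (pderiv i _ x); apply/funext => y; rewrite addr0.
rewrite pderivM//; last by apply: smooth_comp => //; exact: smooth_sqn.
rewrite pderiv_comp//; last exact: smooth_sqn.
rewrite pderiv_sqn dg /=.
have -> : pderiv i (fun y : 'rV[R]_n => 2 * y ord0 i + 0) x = 2.
  transitivity (pderiv i (fun y : 'rV[R]_n => cst 2 y * y ord0 i) x).
    by congr (pderiv i _ x); apply/funext => y; rewrite addr0.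
  rewrite pderivM; [|exact: smooth_cst|exact: smooth_coord].
  by rewrite pderiv_cst pderiv_coord eqxx /= mul0r add0r mulr1.
by rewrite /g addr0; ring.
Qed.

(** [ramp] is convex and nondecreasing and [sqn] is convex, so [barrier] is even concave. Each pure
    second derivative then has a sign, and integrations by parts can be estimated one coordinate at
    a time. *)
Lemma pderiv2_barrier_le0 a i (x : 'rV[R]_n) : pderiv i (pderiv i (barrier a)) x <= 0.
Proof.
rewrite pderiv2_barrier mulNr oppr_le0 mulr_ge0 ?invr_ge0 ?ramp_ge0// addr_ge0//.
  by rewrite mulr_ge0 ?sqr_ge0// derive2_ramp_ge0.
by rewrite mulr_ge0// derive1_ramp_ge0.
Qed.

Lemma pderiv2_barrier_eq0 (a : R) i (x : 'rV[R]_n) : 0 <= a -> enorm x <= a ->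
  pderiv i (pderiv i (barrier a)) x = 0.
Proof.
move=> a0 xa; have h : 1 * sqn x + - a ^+ 2 <= 0.
  by rewrite mul1r subr_le0 leNgt lt_sqn// -leNgt.
by rewrite pderiv2_barrier derive1_ramp derive1_flat !flat_npos// mul0r mulr0 addr0 mulr0.
Qed.

Lemma barrier_le1 a (x : 'rV[R]_n) : barrier a x <= 1.
Proof.
by rewrite /barrier gerDr mulNr oppr_le0 mulr_ge0 ?invr_ge0 ?ramp_ge0.
Qed.

Lemma barrier_lt1 (a : R) (x : 'rV[R]_n) : 0 <= a < 1 -> a < enorm x -> barrier a x < 1.
Proof.
move=> /andP[a0 a1] ax; have T0 : 0 < 1 - a ^+ 2 by rewrite subr_gt0 exprn_ilt1.
rewrite /barrier gtrDr mulNr oppr_lt0 mulr_gt0 ?invr_gt0 ?ramp_gt0//.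
by rewrite mul1r subr_gt0 lt_sqn.
Qed.

Lemma barrier_eq1 (a : R) (x : 'rV[R]_n) : 0 <= a -> enorm x <= a -> barrier a x = 1.
Proof.
move=> a0 xa; have h : 1 * sqn x + - a ^+ 2 <= 0.
  by rewrite mul1r subr_le0 leNgt lt_sqn// -leNgt.
by rewrite /barrier (ramp_npos h) mulr0 add0r.
Qed.

Lemma barrier_gt0 (a : R) (x : 'rV[R]_n) : 0 <= a < 1 -> B x -> 0 < barrier a x.
Proof.
move=> /andP[a0 a1] /sqn_lt1 x1; have T0 : 0 < 1 - a ^+ 2 by rewrite subr_gt0 exprn_ilt1.
rewrite /barrier mulNr addrC subr_gt0 mulrC ltr_pdivrMr ?ramp_gt0// !mul1r.
by apply: ramp_lt => //; rewrite ltrD2r.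
Qed.

Lemma barrier_small (a e : R) : 0 <= a < 1 -> 0 < e ->
  exists2 r, r < 1 & forall x : 'rV[R]_n, r < enorm x -> barrier a x <= e.
Proof.
move=> /andP[a0 a1] e0; have T0 : 0 < 1 - a ^+ 2 by rewrite subr_gt0 exprn_ilt1.
have rT := ramp_gt0 T0; set T := 1 - a ^+ 2 in T0 rT *.
(* As [ramp] is 1-Lipschitz, [barrier a x <= (1 - sqn x) / ramp T] inside the ball, which is at most
   [e] once [sqn x >= 1 - e * ramp T]. *)
exists (Num.sqrt (1 - e * ramp T)).
  by rewrite -[ltRHS]sqrtr1 ltr_sqrt// ltrBlDr ltrDl mulr_gt0.
move=> x; rewrite ltNge => h.
have {}h : 1 - e * ramp T < sqn x.
  by rewrite ltNge; apply: contra h => h; exact: ler_wsqrtr.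
rewrite /barrier -/T mulNr addrC lerBlDr -lerBlDl.
rewrite mulrC ler_pdivlMr// mulrBl !mul1r.
have [Ts|sT] := leP T (sqn x - a ^+ 2).
  by rewrite (le_trans _ (ramp_homo Ts))// gerBl mulr_ge0 ?ltW.
have := lipschitz1 (@smooth1_ramp R) (fun t => introT andP (conj (derive1_ramp_ge0 t) (derive1_ramp_le1 t))) T (sqn x - a ^+ 2).
rewrite [X in _ <= X]gtr0_norm ?subr_gt0// => /(le_trans (ler_norm _)).
by rewrite /T; lra.
Qed.

(** The equation is tested against the barrier [b]. On the left, integration by parts gives minus
    the integral of [phi] times the Laplacian of [b]; the latter is 0 up to radius [a] and
    nonpositive beyond, where [phi < 0], so the left-hand side is at most 0. On the right, [b] may
    be replaced by [b - 1] because [V (phi - c)] has integral 0; [b - 1] is 0 up to radius [a] and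
    negative beyond, where [phi - c < 0], so the right-hand side is positive. *)
Lemma not_negative_near_boundary V (m : R) phi P (a : R) (i0 : 'I_n) :
  weight V -> sobolevH10 phi -> 0 < m -> weak_eigen V m (avg V phi) phi ->
  0 < avg V phi -> bdd P -> (forall x, B x -> {for x, continuous P}) ->
  ae_B1 (fun x => phi x = P x) -> 0 <= a < 1 ->
  ~ (forall x, B x -> a < enorm x -> P x < 0).
Proof.
move=> wV Hp m0 he; set c := avg V phi => c0 bP cP phiP a01 neg.
have [bV V0 cV] := wV; have Lp := H10_L2 Hp.
have /andP[a0 a1] := a01.
have sb := smooth_barrier a.
have [Hb wb] := H10_smooth sb (fun x => barrier_gt0 a01) (fun e => barrier_small a01).
have bb := bdd_smooth sb.
have h1 : intB (grad_dot phi (barrier a)) <= 0.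
  rewrite (_ : intB _ = intB (fun x => \sum_i wgrad phi i x * pderiv i (barrier a) x)).
    rewrite intB_sum => [|i]; last first.
      by apply: L2M; [exact: L2_wgrad|exact/bdd_L2/bdd_pderiv].
    apply: sumr_le0 => i _; rewrite H10_by_parts//; last exact: smooth_pderiv.
    rewrite oppr_le0 (_ : intB _ = intB (fun x => P x * pderiv i (pderiv i (barrier a)) x)).
      apply: intB_ge0 => x Bx; have [xa|ax] := leP (enorm x) a.
        by rewrite pderiv2_barrier_eq0// mulr0.
      by rewrite mulr_le0 ?pderiv2_barrier_le0// ltW// neg.
    have bd := bdd_pderiv i (smooth_pderiv i sb).
    apply: ae_eq_intB.
    - by apply: measurable_funM; [exact: L2_measurable|case: bd].
    - by apply: measurable_funM; [case: bP|case: bd].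
    - by apply: ae_B1S phiP => x _ ->.
  apply: ae_eq_intB.
  - exact: itg_measurable (itg_grad_dot Hp Hb).
  - apply: itg_measurable; apply: itg_sum => i.
    by apply: L2M; [exact: L2_wgrad|exact/bdd_L2/bdd_pderiv].
  - apply: ae_B1S (ae_B1_forall wb) => x _ h; apply: eq_bigr => i _.
    by rewrite h.
move: h1; rewrite he// leNgt => /negP; apply; rewrite mulr_gt0//.
have bPc : bdd (fun x => P x - c).
  have [mP [K hK]] := bP; split; first by apply: measurable_funB.
  exists (K + `|c|) => x Bx; rewrite (le_trans (ler_normB _ _))// lerD2r.
  exact: hK.
have bb1 : bdd (fun x => barrier a x - 1).
  have [mb [K hK]] := bb; split; first by apply: measurable_funB.
  exists (K + 1) => x Bx; rewrite (le_trans (ler_normB _ _))// normr1 lerD2r.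
  exact: hK.
have iVp : itg (fun x => V x * (phi x - c)) by apply/L2_itg/L2_weight => //; exact: L2_subc.
have -> : intB (fun x => V x * (phi x - c) * barrier a x) =
    intB (fun x => V x * ((P x - c) * (barrier a x - 1))).
  rewrite -[LHS]subr0 -(intB_centred wV Lp) -/c -intBB//; last first.
    by apply: itgM.
  apply: ae_eq_intB.
  - by apply: itg_measurable; apply: itgB => //; exact: itgM.
  - by have [] := bddM bV (bddM bPc bb1).
  - by apply: ae_B1S phiP => x _ ->; ring.
pose r0 := (a + 1) / 2; pose x0 : 'rV[R]_n := r0 *: delta_mx ord0 i0.
have r0E : enorm x0 = r0 by rewrite enorm_axis// /r0; lra.
have Bx0 : B x0 by rewrite /B1/= r0E /r0; lra.
have ax0 : a < enorm x0 by rewrite r0E /r0; lra.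
apply: (@intB_gt0 _ _ _ x0) => //.
- exact: bddM bV (bddM bPc bb1).
- move=> x Bx; rewrite mulr_ge0 ?(ltW (V0 x Bx))//.
  have [xa|ax] := leP (enorm x) a; first by rewrite barrier_eq1// subrr mulr0.
  have := neg x Bx ax; have := barrier_le1 a x; nra.
- apply: continuousM_at; first exact: cV.
  apply: continuousM_at; apply: continuousB_at; try exact: continuous_cst_at; first exact: cP.
  exact: (smooth_continuous sb).
- rewrite mulr_gt0 ?V0//; have := neg x0 Bx0 ax0; have := barrier_lt1 a01 ax0; nra.
Qed.

End boundary.

(** * Radial cutoffs and the dimension count *)

Section intervals.
Context {R : realType} {n : nat}.
Implicit Types (u v w V P X phi : 'rV[R]_n -> R) (p : R -> R).

Notation B := (@B1 R n).

(** A smooth transition from 0 on [t <= 1/2] to 1 on [1 <= t], obtained by nesting two bumps: the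
    outer argument [1 - expbump (1 - t) / expbump (1/2)] is nonpositive for [t <= 1/2] and equal to
    1 for [1 <= t]. *)
Definition step (t : R) : R :=
  (expbump 1)^-1 * expbump (- (expbump 2^-1)^-1 * expbump (-1 * t + 1) + 1).

Lemma step_eq0 t : t <= 2^-1 -> step t = 0.
Proof.
move=> t2; have h0 : 0 < expbump 2^-1 :> R by rewrite expbump_gt0.
have h : expbump 2^-1 <= expbump (-1 * t + 1) :> R by apply: expbump_le; lra.
rewrite /step [X in _ * X]flat_npos ?mulr0//.
suff : 1 <= (expbump 2^-1)^-1 * expbump (-1 * t + 1) :> R by lra.
by rewrite mulrC ler_pdivlMr// mul1r.
Qed.

Lemma step_eq1 t : 1 <= t -> step t = 1.
Proof.
move=> t1; have h0 : 0 < expbump 1 :> R by rewrite expbump_gt0.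
have -> : step t = (expbump 1)^-1 * expbump 1.
  rewrite /step; congr (_ * expbump _).
  by rewrite [X in _ * X + _]flat_npos ?mulr0 ?add0r//; lra.
by rewrite mulVf// gt_eqF.
Qed.

Lemma smooth_step u : smooth u -> smooth (fun x => step (u x)).
Proof.
move=> su; have s1 := smooth_bump_affine (-1) 1 su.
have s2 := smooth_bump_affine (- (expbump 2^-1)^-1) 1 s1.
have := smooth_affine (expbump 1)^-1 0 s2.
by under eq_fun do rewrite addr0.
Qed.

Lemma exists_radial_cutoff (A A' B' B : R) : A < A' -> B' < B ->
  exists k : R -> R, [/\ smooth (k \o @sqn R n),
    forall s, s <= A \/ B <= s -> k s = 0 &
    forall s, A' <= s <= B' -> k s = 1].
Proof.
(* The slopes are normalised so that the arguments of [step] equal [1/2] at [A] and [B], and 1 at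
   [A'] and [B']. *)
move=> AA BB; pose a := (A' - A)^-1 / 2; pose b := (B - B')^-1 / 2.
have dA : 0 < A' - A by rewrite subr_gt0.
have dB : 0 < B - B' by rewrite subr_gt0.
have a0 : 0 < a by rewrite divr_gt0// invr_gt0.
have b0 : 0 < b by rewrite divr_gt0// invr_gt0.
have aE : a * (A' - A) = 2^-1 by rewrite /a mulrAC mulVf ?mul1r// gt_eqF.
have bE : b * (B - B') = 2^-1 by rewrite /b mulrAC mulVf ?mul1r// gt_eqF.
exists (fun s => step (a * s + (2^-1 - a * A)) * step (- b * s + (2^-1 + b * B))).
split.
- apply: smoothM; apply: smooth_step; apply: smooth_affine; exact: smooth_sqn.
- move=> s [sA|Bs].
    by rewrite step_eq0 ?mul0r//; nra.
  by rewrite [X in _ * X]step_eq0 ?mulr0//; nra.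
- move=> s /andP[s1 s2]; rewrite !step_eq1 ?mul1r//; nra.
Qed.

Lemma exists_left_kernel k (M : 'M[R]_(k.+1, k)) : exists2 a : 'rV[R]_k.+1, a != 0 & a *m M = 0.
Proof.
have : kermx M != 0.
  by rewrite -mxrank_eq0 mxrank_ker subn_eq0 -ltnNge ltnS rank_leq_col.
move=> /rowV0Pn[a /sub_kermxP aM a0]; by exists a.
Qed.

Lemma pderiv_near_cst u x i c : (\forall y \near x, u y = c) -> pderiv i u x = 0.
Proof.
move=> uc; rewrite /pderiv (@near_eq_derive _ _ _ _ (cst c)) ?derive_cst//.
Qed.

Lemma profile_dist p (r0 e : R) : {within `[0, 1], continuous p} -> 0 <= r0 <= 1 ->
  0 < e -> exists2 d, 0 < d &
    forall r, 0 <= r <= 1 -> `|r0 - r| < d -> `|p r0 - p r| < e.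
Proof.
move=> /subspace_continuousP cp r01 e0.
have /cvgrPdist_lt/(_ e e0) : p @ within `[0, 1]%classic (nbhs r0) --> p r0.
  by apply: cp; rewrite /= in_itv.
rewrite near_withinE => /nbhs_ballP[d /= d0 hd].
by exists d => // r r1 rd; apply: hd => //=; rewrite in_itv.
Qed.

(** A profile is continuous only within [[0, 1]]; composed with [clamp] and [enorm] it becomes a
    function continuous on the whole space and unchanged on the ball. *)
Definition clamp (r : R) := Num.max 0 (Num.min r 1).

Lemma clamp01 r : 0 <= clamp r <= 1.
Proof. by rewrite /clamp le_max lexx/= ge_max ler01/= ge_min lexx orbT. Qed.

Lemma clamp_id r : 0 <= r <= 1 -> clamp r = r.
Proof. by move=> /andP[r0 r1]; rewrite /clamp min_l// max_r. Qed.

Lemma clamp_dist r s : `|clamp r - clamp s| <= `|r - s|.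
Proof.
wlog rs : r s / r <= s => [H|].
  have [|/ltW] := leP r s; first exact: H.
  by rewrite distrC [X in _ -> _ <= X]distrC; exact: H.
rewrite [leRHS]ler0_norm ?subr_le0// ler_norml /clamp.
have [r1|r1] := leP r 1; have [s1|s1] := leP s 1.
- by have [r0|r0] := leP 0 r; have [s0|s0] := leP 0 s; lra.
- by rewrite (max_r (@ler01 R)); have [r0|r0] := leP 0 r; lra.
- by lra.
- by rewrite (max_r (@ler01 R)); lra.
Qed.

Lemma continuous_clamped_profile p : {within `[0, 1], continuous p} ->
  continuous (fun x : 'rV[R]_n => p (clamp (enorm x))).
Proof.
move=> cp x; apply: (@continuous_comp _ _ _ (@enorm R n) (fun r => p (clamp r))).
  exact: continuous_enorm.
apply/cvgrPdist_lt => e e0; have [d d0 hd] := profile_dist cp (clamp01 (enorm x)) e0.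
apply/nbhs_ballP; exists d => //= r; rewrite /ball/= => xr.
apply: hd; first exact: clamp01.
exact: le_lt_trans (clamp_dist _ _) xr.
Qed.

Lemma clamp_enorm x : B x -> clamp (enorm x) = enorm x.
Proof. by move=> /ltW x1; rewrite clamp_id// enorm_ge0. Qed.

Lemma sqn_near_lt (x : 'rV[R]_n) (t : R) : sqn x < t -> \forall y \near x, sqn y < t.
Proof.
move=> xt; have c : {for x, continuous (@sqn R n)} by exact: (smooth_continuous smooth_sqn).
exact: (c [set s | s < t] (lt_nbhsl xt)).
Qed.

Lemma sqn_near_gt (x : 'rV[R]_n) (t : R) : t < sqn x -> \forall y \near x, t < sqn y.
Proof.
move=> xt; have c : {for x, continuous (@sqn R n)} by exact: (smooth_continuous smooth_sqn).
exact: (c [set s | t < s] (lt_nbhsr xt)).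
Qed.

(** As [p a <= 0], continuity keeps [p] below [e] just after [a]. No radius with [e < p r] then has
    its square in the gap from [A] to [A'], and the cutoff can make its transition there. Squares
    are used because the cutoff is a function of [sqn]. *)
Lemma lower_cut p (a e : R) : {within `[0, 1], continuous p} -> 0 < e -> a < 1 ->
  (0 <= a -> p a <= 0) ->
  exists A A', [/\ A < A', forall r, 0 <= r <= 1 -> r <= a -> r ^+ 2 <= A &
    forall r, 0 <= r <= 1 -> e < p r -> r ^+ 2 < A /\ r < a \/ A' < r ^+ 2 /\ a < r].
Proof.
move=> cp e0 a1 pa; have [a0|a0] := leP 0 a; last first.
  (* A negative [a] stands for a ball: the transition is placed below all squared radii, so nothing
     is cut near the origin. *)
  exists (-2), (-1); split; first by lra.
    by move=> r /andP[r0 r1] ra; lra.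
  by move=> r /andP[r0 r1] _; right; split; [have := sqr_ge0 r; lra|lra].
have a01 : 0 <= a <= 1 by rewrite a0 ltW.
have [d d0 hd] := profile_dist cp a01 e0.
exists (a ^+ 2), ((a + d / 2) ^+ 2); split; first by nra.
  by move=> r /andP[r0 r1] ra; nra.
move=> r r01 er; have /andP[r0 r1] := r01.
have [ra|ar] := ltP r a; first by left; split => //; nra.
right; have [rd|rd] := leP r (a + d / 2); last by split; nra.
have : `|a - r| < d by rewrite distrC ger0_norm ?subr_ge0//; lra.
move=> /(hd r r01); rewrite ltr_norml => /andP[h _].
by have := pa a0; lra.
Qed.

Lemma upper_cut p (b e : R) : {within `[0, 1], continuous p} -> 0 < e -> 0 < b <= 1 ->
  (b < 1 -> p b <= 0) ->
  exists A' A, [/\ A' < A, forall r, 0 <= r <= 1 -> b <= r -> b < 1 -> A <= r ^+ 2 &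
    forall r, 0 <= r <= 1 -> e < p r ->
      A < r ^+ 2 /\ b < r \/ r ^+ 2 < A' /\ (r < b \/ b = 1)].
Proof.
move=> cp e0 /andP[b0]; rewrite le_eqVlt => /predU1P[-> _|b1 pb].
  (* Nothing is cut at the unit sphere, where the test functions inherit the zero boundary values of
     [phi]; the transition is placed beyond the ball. *)
  exists 2, 3; split; first by lra.
    by move=> r _ _; rewrite ltxx.
  by move=> r /andP[r0 r1] _; right; split; [nra|right].
have {}pb := pb b1.
have b01 : 0 <= b <= 1 by rewrite !ltW.
have [d d0 hd] := profile_dist cp b01 e0.
(* The maximum with 0 keeps squaring monotone when [d] is large. *)
pose b' := Num.max 0 (b - d / 2).
have b'0 : 0 <= b' by rewrite le_max lexx.
have b'b : b' < b by rewrite gt_max b0 ltrBlDr ltrDl divr_gt0.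
have db' : b - d / 2 <= b' by rewrite le_max lexx orbT.
exists (b' ^+ 2), (b ^+ 2); split; first by nra.
  by move=> r /andP[r0 r1] ra _; nra.
move=> r r01 er; have /andP[r0 r1] := r01.
have [br|rb] := ltP b r; first by left; split => //; nra.
right; have [rd|rd] := ltP r b'; first by split; [nra|left; lra].
have : `|b - r| < d by rewrite ger0_norm ?subr_ge0//; lra.
move=> /(hd r r01); rewrite ltr_norml => /andP[h _].
lra.
Qed.

(** Both transitions lie in gaps that avoid the set where [p] exceeds [e], so the cutoff is locally
    constant on it. The last clause is the hypothesis that [rayleigh_threshold_lt] makes on [X]. *)
Lemma interval_cutoff p (a b e : R) : {within `[0, 1], continuous p} -> 0 < e ->
  a < b -> 0 < b <= 1 -> (0 <= a -> p a <= 0) -> (b < 1 -> p b <= 0) ->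
  exists k : R -> R, [/\ smooth (k \o @sqn R n),
    forall r, 0 <= r <= 1 -> r <= a \/ b <= r /\ b < 1 -> k (r ^+ 2) = 0,
    forall r, 0 <= r <= 1 -> a < r < b -> e < p r -> k (r ^+ 2) = 1 &
    forall i x, B x -> e < p (enorm x) -> pderiv i (k \o @sqn R n) x = 0].
Proof.
move=> cp e0 ab b01 pa pb; have /andP[b0 b1] := b01.
have [A [A' [AA hA1 hA2]]] := lower_cut cp e0 (lt_le_trans ab b1) pa.
have [D' [D [DD hD1 hD2]]] := upper_cut cp e0 b01 pb.
have [k [sk k0 k1]] := exists_radial_cutoff AA DD.
exists k; split => //.
- by move=> r r01 [ra|[br bl]]; apply: k0; [left; exact: hA1|right; exact: hD1].
- move=> r r01 /andP[ar rb] er; apply: k1.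
  have [[_ ra]|[h1 _]] := hA2 r r01 er; first by lra.
  have [[_ br]|[h2 _]] := hD2 r r01 er; first by lra.
  by rewrite !ltW.
- move=> i x Bx ex; have r01 : 0 <= enorm x <= 1 by rewrite enorm_ge0 ltW.
  have [[h _]|[h1 _]] := hA2 _ r01 ex.
    apply: (@pderiv_near_cst _ _ _ 0); rewrite enorm_sqr in h.
    by apply: filterS (sqn_near_lt h) => y yA; apply: k0; left; exact: ltW.
  have [[h _]|[h2 _]] := hD2 _ r01 ex.
    apply: (@pderiv_near_cst _ _ _ 0); rewrite enorm_sqr in h.
    by apply: filterS (sqn_near_gt h) => y yA; apply: k0; right; exact: ltW.
  apply: (@pderiv_near_cst _ _ _ 1); rewrite enorm_sqr in h1 h2.
  apply: filterS2 (sqn_near_gt h1) (sqn_near_lt h2) => y y1 y2.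
  by apply: k1; rewrite !ltW.
Qed.

Lemma pderiv_sum (I : Type) (s : seq I) (F : I -> 'rV[R]_n -> R) i :
  (forall j, smooth (F j)) ->
  pderiv i (fun x => \sum_(j <- s) F j x) = fun x => \sum_(j <- s) pderiv i (F j) x.
Proof.
move=> sF; elim: s => [|j s IH].
  by apply/funext => x; rewrite big_nil; under eq_fun do rewrite big_nil; rewrite [pderiv _ _]pderiv_cst.
apply/funext => x; rewrite big_cons; under eq_fun do rewrite big_cons.
by rewrite pderivD//; [rewrite IH|exact: smooth_sum].
Qed.

(** The form serves both families of domains: [p] has to be positive at one radius of each interval
    only, and an end carries a condition only if it is a radius in [[0, 1)]. *)
Lemma no_positive_intervals (lam sigma : R) V phi p (phis : nat -> 'rV[R]_n -> R) (k : nat)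
    (a b r : 'I_k.+1 -> R) (i0 : 'I_n) :
  weight V -> sobolevH10 phi -> 0 < lam + sigma ->
  weak_eigen V (lam + sigma) (avg V phi) phi -> 0 < avg V phi ->
  radial_profile phi p -> (0 < k)%N ->
  (forall j, (1 <= j < k)%N -> L2 (phis j)) ->
  (forall u, admissible V phis k u -> sigma <= rayleigh lam V u) ->
  (forall i, a i < r i < b i) -> (forall i, 0 <= r i) -> (forall i, 0 < p (r i)) ->
  (forall i, b i <= 1) -> (forall i, 0 <= a i -> p (a i) <= 0) ->
  (forall i, b i < 1 -> p (b i) <= 0) ->
  (forall i j, i != j -> b i <= a j \/ b j <= a i) -> False.
Proof.
move=> wV Hp m0 he c0 [cp phiP] k0 Lphis minim arb r0 pr b1 pa pb disj.
set c := avg V phi in he c0.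
(* Small enough to lie strictly below each [p (r i)] and, by the default value [c / 4], to satisfy
   [2 * e < c]. *)
pose e := \big[Num.min/(c / 4)]_i (p (r i) / 2).
have e0 : 0 < e.
  by apply/bigmin_gtP; split=> [|i _]; rewrite divr_gt0.
have ec : 2 * e < c.
  have : e <= c / 4 by exact: bigmin_le_id.
  lra.
have er i : e < p (r i).
  have : e <= p (r i) / 2 by exact: bigmin_le_cond.
  have := pr i; lra.
have r01 i : 0 <= r i <= 1.
  by have := arb i; have := b1 i; have := r0 i; lra.
have /choice[K hK] : forall i, exists k : R -> R, [/\ smooth (k \o @sqn R n),
    forall s, 0 <= s <= 1 -> s <= a i \/ b i <= s /\ b i < 1 -> k (s ^+ 2) = 0,
    forall s, 0 <= s <= 1 -> a i < s < b i -> e < p s -> k (s ^+ 2) = 1 &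
    forall j x, B x -> e < p (enorm x) -> pderiv j (k \o @sqn R n) x = 0].
  move=> i; apply: interval_cutoff => //.
  - by have := arb i; lra.
  - by have := arb i; have := b1 i; have := r0 i; lra.
  - exact: pa.
  - exact: pb.
have [bV V0 cV] := wV; have Lp := H10_L2 Hp.
pose P (x : 'rV[R]_n) := p (clamp (enorm x)).
have cP : continuous P by exact: continuous_clamped_profile.
have phiP' : ae_B1 (fun x => phi x = P x).
  by apply: ae_B1S phiP => x Bx ->; rewrite /P clamp_enorm.
pose w i (x : 'rV[R]_n) := threshold e (phi x) * K i (sqn x).
have LG : L2 (fun x => threshold e (phi x)).
  have [C GC] := derive1_threshold_lipschitz e0.
  have G0 : threshold e 0 = 0 by rewrite threshold_eq0// ltW.
  have [H1 _] := H10_comp (@smooth1_threshold R e) G0 (fun t => derive1_threshold01 t e0) GC (@smooth_cst R n 1) Hp.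
  by have := H10_L2 H1; under eq_fun do rewrite mulr1.
have Lw i : L2 (w i).
  by have [sK _ _ _] := hK i; apply: L2Mb => //; exact: (bdd_smooth sK).
(* [q 0] encodes the zero mean, which makes [centred V u] equal to [u]. *)
pose q (j : nat) : 'rV[R]_n -> R :=
  if j is j'.+1 then centred V (phis j) else cst 1.
have Lq (j : 'I_k) : L2 (q j).
  rewrite /q; case: j => -[|j] /= jk; first exact: bdd_L2 (bdd_cst 1).
  by apply: L2_subc; apply: Lphis.
(* There are [k.+1] coefficients for [k] linear conditions. *)
have [al al0 alM] := exists_left_kernel (\matrix_(i < k.+1, j < k) intB (fun x => V x * (w i x * q j x))).
pose X (x : 'rV[R]_n) := \sum_i al 0 i * K i (sqn x).
have sX : smooth X.
  apply: smooth_sum => i; apply: smoothM; first exact: smooth_cst.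
  by have [sK _ _ _] := hK i.
pose u x := threshold e (phi x) * X x.
have uE x : u x = \sum_i al 0 i * w i x.
  by rewrite /u /X mulr_sumr; apply: eq_bigr => i _; rewrite /w; ring.
have orth (j : 'I_k) : intB (fun x => V x * (u x * q j x)) = 0.
  have := congr1 (fun N : 'rV[R]_k => N 0 j) alM; rewrite !mxE => <-.
  rewrite (_ : intB _ = intB (fun x => \sum_i al 0 i * (V x * (w i x * q j x)))).
    have iw i : itg (fun x => V x * (w i x * q j x)).
      by under eq_fun do rewrite mulrC; apply: itgM => //; exact: L2M.
    rewrite intB_sum => [|i]; last exact: itgZ.
    by apply: eq_bigr => i _; rewrite intBZ// mxE.
  by apply: eq_intB => x _; rewrite uE mulr_suml mulr_sumr; apply: eq_bigr => i _; ring.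
have avgu : avg V u = 0.
  have := orth (Ordinal k0); rewrite /avg /q/= => h.
  by rewrite (_ : intB _ = 0) ?mul0r//; rewrite -[RHS]h; apply: eq_intB => x _; rewrite /= mulr1.
have [i1 ali1] : exists i, al 0 i != 0.
  apply: contrapT => /forallNP h; move/negP: al0; apply; apply/eqP/rowP => i.
  by rewrite mxE; apply/eqP/negPn/negP; exact: h.
pose x0 : 'rV[R]_n := r i1 *: delta_mx ord0 i0.
have x0E : enorm x0 = r i1 by rewrite enorm_axis.
have Bx0 : B x0.
  by rewrite /B1/= x0E; have := arb i1; have := b1 i1; lra.
(* At the radius [r i1] the cutoff of index [i1] equals 1, since [p] exceeds [e] there, and the
   others vanish by disjointness; hence [X x0] is nonzero. *)
have Xx0 : X x0 = al 0 i1.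
  rewrite /X (bigD1 i1)//= big1 ?addr0 => [|i ii1].
    have [_ _ k1 _] := hK i1.
    by rewrite -enorm_sqr x0E k1 ?mulr1.
  have [_ k0' _ _] := hK i; rewrite -enorm_sqr x0E k0' ?mulr0//.
  have := arb i; have := arb i1; have := b1 i1; have := b1 i.
  case: (disj _ _ ii1) => h; [right|left]; lra.
have [Hu nu ru] : [/\ sobolevH10 u, nonzero u & rayleigh lam V u < sigma].
  apply: (@rayleigh_threshold_lt _ _ lam sigma c e V phi P X x0) => //.
  - exact: bdd_continuous.
  - by move=> x _; exact: cP.
  - move=> i x Bx; rewrite /P clamp_enorm// => ex.
    have sF j : smooth (fun x : 'rV[R]_n => al 0 j * K j (sqn x)).
      by apply: smoothM; [exact: smooth_cst|case: (hK j)].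
    rewrite [LHS](congr1 (fun h => h x) (pderiv_sum (index_enum 'I_k.+1) i sF)) big1// => j _; have [sK _ _ dK] := hK j.
    rewrite (@pderivM _ _ (cst (al 0 j)) (K j \o sqn))//; last exact: smooth_cst.
    by rewrite pderiv_cst dK// mulr0 mul0r addr0.
  - by rewrite /P clamp_enorm// x0E.
  - by rewrite Xx0.
have : admissible V phis k u.
  split=> //.
  - exists (fun s => threshold e (p s) * \sum_i al 0 i * K i (s ^+ 2)).
    apply: ae_B1S phiP => x _ h; rewrite /u h /X; congr (_ * _).
    by apply: eq_bigr => i _; rewrite enorm_sqr.
  - case=> [//|j] /andP[_ jk]; have := orth (Ordinal jk); rewrite /q /= => h.
    rewrite /avg (_ : intB _ = 0) ?mul0r// -[RHS]h.
    by apply: eq_intB => x _; rewrite [centred V u x]/centred avgu subr0.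
by move=> /minim; rewrite leNgt ru.
Qed.

End intervals.

(** * Counting nodal domains *)

Lemma not_card_le_II (T : pointedType) (A : set T) (m : nat) : ~ (A #<= `I_m)%card ->
  exists2 g : 'I_m.+1 -> T, injective g & forall i, A (g i).
Proof.
move=> h; have /pcard_leP[f] : (`I_m.+1 #<= A)%card.
  case: (pselect (finite_set A)) => [[k Ak]|/infiniteP]; last first.
    by apply: card_le_trans; exact: card_leT.
  have /card_eqPle[Ak1 Ak2] := Ak.
  apply: card_le_trans Ak2; rewrite card_le_II ltnNge; apply/negP => km.
  by apply: h; apply: card_le_trans Ak1 _; rewrite card_le_II.
exists (fun i => f (val i)) => [i j fij|i]; last by apply: (@funS _ _ _ _ f); rewrite /= ltn_ord.
by apply: val_inj; apply: (@inj _ _ _ f) fij; rewrite inE/= ltn_ord.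
Qed.

(** * Derivatives relative to an interval *)

Section relative_derivative_facts.
Context {R : realType}.
Implicit Types (D : set R) (f p : R -> R).

Lemma quotient_in_near D f x l (e : R) : quotient_in D f x --> l -> 0 < e ->
  exists2 d, 0 < d & forall t, D t -> t != x -> `|x - t| < d ->
    `|l - (f t - f x) / (t - x)| < e.
Proof.
move=> /cvgrPdist_lt/(_ e) + e0 => /(_ e0).
rewrite near_withinE => /nbhs_ballP[d /= d0 hd].
by exists d => // t Dt tx xt; apply: hd.
Qed.

Lemma derivable_in_continuous D f x e : derivable_in D f x -> 0 < e ->
  exists2 d, 0 < d & forall t, D t -> `|x - t| < d -> `|f x - f t| < e.
Proof.
move=> df e0; have [d d0 hd] := quotient_in_near df ltr01.
set l := lim _ in hd.
pose K := `|l| + 1; have K0 : 0 < K by rewrite ltr_wpDl.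
exists (Num.min d (e / K)) => [|t Dt]; first by rewrite lt_min d0 divr_gt0.
rewrite lt_min => /andP[td te].
have [->|tx] := eqVneq t x; first by rewrite subrr normr0.
have := hd t Dt tx td => h.
have tx0 : t - x != 0 by rewrite subr_eq0.
have q : `|(f t - f x) / (t - x)| < K.
  rewrite -[X in `|X|](subrK l) addrC (le_lt_trans (ler_normD _ _))// ltrD2l.
  by rewrite distrC.
rewrite distrC -(divfK tx0 (f t - f x)) normrM [`|t - x|]distrC.
rewrite (@le_lt_trans _ _ (K * `|x - t|))//; first by rewrite ler_wpM2r// ltW.
by rewrite mulrC -ltr_pdivlMr.
Qed.

(** The limit of a divergent filter takes the default value 0, so a nonzero derivative certifies
    that the difference quotients converge. *)
Lemma deriv_in_neq0 D f x : deriv_in D f x != 0 ->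
  quotient_in D f x --> deriv_in D f x.
Proof.
move=> /eqP h; have : cvg (quotient_in D f x); last by [].
by apply: contrapT => /dvgP h'; apply: h; rewrite /deriv_in h'.
Qed.

(** The quotients on the left of [b] are positive, so the nonzero derivative cannot be negative;
    once it is positive, the quotients on the right are positive too. *)
Lemma positive_after p a b : 0 < b < 1 -> a < b -> p b = 0 ->
  deriv_in `[0, 1]%classic p b != 0 -> (forall r, 0 <= r -> a < r < b -> p r < 0) ->
  exists2 d, 0 < d & forall r, b < r < b + d -> r <= 1 -> 0 < p r.
Proof.
move=> /andP[b0 b1] ab pb dp neg; have cv := deriv_in_neq0 dp.
set l := deriv_in _ _ _ in dp cv.
have l2 : 0 < `|l| / 2 by rewrite divr_gt0// normr_gt0.
have [d d0 hd] := quotient_in_near cv l2.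
have lpos : 0 < l.
  rewrite ltNge; apply/negP => l0.
  have ln : l < 0 by rewrite lt_neqAle dp.
  (* Any point between [m] and [b] is a nonnegative radius of the interval at distance less than [d]
     from [b]. *)
  pose m := Num.max (Num.max a 0) (b - d).
  have mb : m < b by rewrite !gt_max ab b0 ltrBlDr ltrDl.
  pose t := (m + b) / 2.
  have am : a <= m by rewrite !le_max lexx.
  have zm : 0 <= m by rewrite !le_max lexx orbT.
  have dm : b - d <= m by rewrite le_max lexx orbT.
  have tb : t < b by rewrite /t; lra.
  have mt : m < t by rewrite /t; lra.
  have pt : p t < 0 by apply: neg; rewrite ?tb ?andbT; lra.
  have := hd t; rewrite /= in_itv/= => /(_ _ _ _) h.
  have {}h : `|l - (p t - p b) / (t - b)| < `|l| / 2.
    apply: h; first by lra.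
      by rewrite lt_eqF.
    by rewrite gtr0_norm; lra.
  move: h; rewrite pb subr0 ltr_norml ltr0_norm// => /andP[h _].
  have q : 0 < p t / (t - b) by rewrite nmulr_rgt0// invr_lt0 subr_lt0.
  lra.
exists d => // r /andP[br rd] r1.
have {}hd : `|l - (p r - p b) / (r - b)| < `|l| / 2.
  apply: hd; first by rewrite /= in_itv/=; lra.
    by rewrite gt_eqF.
  by rewrite ltr0_norm; lra.
move: hd; rewrite pb subr0 ltr_norml gtr0_norm// => /andP[_ h].
have : 0 < p r / (r - b) by lra.
by rewrite pmulr_lgt0// invr_gt0 subr_gt0.
Qed.

Lemma exists_notin (s : seq R) (lo hi : R) : lo < hi ->
  exists2 r, lo < r < hi & r \notin s.
Proof.
move=> lohi; suff [l [h [lol lh hhi hs]]] : exists l h, [/\ lo <= l, l < h, h <= hi &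
    forall r, l < r < h -> r \notin s].
  by exists ((l + h) / 2); [lra|apply: hs; lra].
elim: s => [|z s [l [h [lol lh hhi hs]]]]; first by exists lo, hi.
have [zl|lz] := leP z l.
  exists l, h; split => // r rlh; rewrite in_cons negb_or hs// andbT gt_eqF//; lra.
have [hz|zh] := leP h z.
  exists l, h; split => // r rlh; rewrite in_cons negb_or hs// andbT lt_eqF//; lra.
exists z, h; split => //; first by lra.
by move=> r rzh; rewrite in_cons negb_or hs ?andbT ?gt_eqF//; lra.
Qed.

End relative_derivative_facts.

(** * Nodal domains as intervals of radii *)

Section nodal_domains.
Context {R : realType} {n : nat} (i0 : 'I_n).
Implicit Types (V phi : 'rV[R]_n -> R) (p : R -> R) (a b : R).

Notation B := (@B1 R n).
Notation dp p r := (deriv_in `[0, 1]%classic p r).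

Definition shell a b : set 'rV[R]_n := [set x | a < enorm x < b].

(* The inner radius [a = -1] encodes a ball. *)
Definition interval_domain p a b :=
  [/\ a = -1 \/ 0 <= a, a < b, 0 < b <= 1,
      0 <= a -> p a = 0 /\ dp p a != 0 & p b = 0 /\ (b < 1 -> dp p b != 0)].

(** Common to both kinds of domain: the zeros inside a nonnegative one are singular points, and a
    negative one has none. Only the vanishing first derivative of a singular point is retained. *)
Definition inner_zeros p a b :=
  forall r, 0 <= r -> a < r < b -> p r = 0 -> dp p r = 0.

Definition somewhere_positive p a b := exists r, [/\ 0 <= r, a < r < b & 0 < p r].

Definition negative_on p a b := forall r, 0 <= r -> a < r < b -> p r < 0.

Lemma ball_shell b : [set x : 'rV[R]_n | enorm x < b] = shell (-1) b.
Proof.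
apply/seteqP; split=> x /=; last by move=> /andP[].
by move=> xb; rewrite /shell/= xb andbT (lt_le_trans _ (enorm_ge0 x)).
Qed.

Lemma nodal_interval p Om : nodal_domain_of_profile p Om ->
  exists a b, [/\ Om = shell a b, interval_domain p a b, inner_zeros p a b &
    somewhere_positive p a b \/ negative_on p a b].
Proof.
move=> [rad [Hrad [bd sgn negc posc]]].
have [a [b [OmE ab b01 dom]]] : exists a b, [/\ Om = shell a b, a < b, 0 < b <= 1 &
    interval_domain p a b].
  case: Hrad => [[b [b01 OmE radE]]|[a [b [/andP[a0 ab] b1 OmE radE]]]].
    have /andP[b0 b1] := b01.
    have rb : rad b by rewrite radE.
    exists (-1), b; split => //; [by rewrite OmE ball_shell|by lra|split => //].
    - by left.
    - by lra.
    - by lra.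
    - exact: bd.
  have ra : rad a by rewrite radE; left.
  have rb : rad b by rewrite radE; right.
  have b0 : 0 < b by exact: le_lt_trans ab.
  have b01 : 0 < b <= 1 by rewrite b0.
  exists a, b; split => //; split => //; first by right.
    move=> _; have [pa da] := bd a ra; split => //; apply: da.
    exact: lt_le_trans b1.
  exact: bd.
exists a, b.
have inOm r : 0 <= r -> a < r < b -> Om (r *: delta_mx ord0 i0).
  by move=> r0 rab; rewrite OmE /shell/= enorm_axis.
have radius x : Om x -> a < enorm x < b by rewrite OmE.
case: sgn => sgn.
  have [s [ssing spos]] := posc sgn.
  split => //.
    move=> r r0 rab pr; apply: contrapT => /eqP dr.
    have [/ssing[_ _ /eqP]|rs] := boolP (r \in s); first by rewrite (negbTE dr).
    have := spos _ (inOm r r0 rab); rewrite enorm_axis// pr ltxx => /(_ rs).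
    by [].
  left; have /(exists_notin s)[r rab rs] : Num.max a 0 < b.
    by rewrite gt_max ab/=; case/andP: b01.
  have r0 : 0 <= r by case/andP: rab; rewrite gt_max => /andP[_ /ltW].
  have rab' : a < r < b by case/andP: rab; rewrite gt_max => /andP[-> _] ->.
  exists r; split => //; have := spos _ (inOm r r0 rab').
  by rewrite enorm_axis//; apply.
have neg : negative_on p a b.
  by move=> r r0 rab; have := negc sgn _ (inOm r r0 rab); rewrite enorm_axis.
split => //; last by right.
by move=> r r0 rab pr; have := neg r r0 rab; rewrite pr ltxx.
Qed.

(** If two domains overlap without being equal, an end of one is a radius inside the other. It is
    smaller than 1, so [p] vanishes there with nonzero derivative, against [inner_zeros]. *)
Lemma interval_domain_eq p a b a' b' :
  interval_domain p a b -> inner_zeros p a b ->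
  interval_domain p a' b' -> inner_zeros p a' b' ->
  [\/ a = a' /\ b = b', b <= a' | b' <= a].
Proof.
move=> [ha ab /andP[b0 b1] pa [pb db]] z [ha' ab' /andP[b0' b1'] pa' [pb' db']] z'.
have [ba'|a'b] := leP b a'; first exact: Or32.
have [b'a|ab'2] := leP b' a; first exact: Or33.
apply: Or31.
have no_left c d e f : (e = -1 \/ 0 <= e) -> (c = -1 \/ 0 <= c) -> inner_zeros p c d ->
    (0 <= e -> p e = 0 /\ dp p e != 0) -> e < d -> ~ c < e.
  move=> he hc zc pe ed ce.
  have e0 : 0 <= e.
    case: he => // he; case: hc => [hc|c0]; first by move: ce; rewrite he hc ltxx.
    by apply: ltW; exact: le_lt_trans ce.
  have [pe0 /eqP de] := pe e0; apply: de; apply: zc => //.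
  by rewrite ce.
have no_right c d e : 0 < e -> inner_zeros p c d -> p e = 0 -> (e < 1 -> dp p e != 0) ->
    c < e -> d <= 1 -> ~ e < d.
  move=> e0 zc pe de ce d1 ed.
  have /eqP := de (lt_le_trans ed d1); apply; apply: zc => //; first exact: ltW.
  by rewrite ce.
split.
  case: (ltgtP a a') => // h; exfalso.
    exact: no_left ha' ha z pa' a'b h.
  exact: no_left ha ha' z' pa ab'2 h.
case: (ltgtP b b') => // h; exfalso.
  exact: no_right b0 z' pb db a'b b1' h.
exact: no_right b0' z pb' db' ab'2 b1 h.
Qed.

Lemma deriv_in_ext p p' (D : set R) r : (forall s, D s -> p s = p' s) -> D r ->
  deriv_in D p r = deriv_in D p' r.
Proof.
move=> pp Dr; rewrite /deriv_in; congr (lim _); rewrite /quotient_in.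
have E q q' : (forall s, D s -> q s = q' s) ->
    \forall t \near within D r^', (q t - q r) / (t - r) = (q' t - q' r) / (t - r).
  by move=> qq; rewrite near_withinE; apply: nearW => t Dt; rewrite !qq.
rewrite eqEsubset; split; apply: near_eq_cvg; apply: E => // s Ds.
by rewrite pp.
Qed.

(** Each nodal domain comes with its own profile; uniqueness allows all of them to be described by a
    single [p]. Below 1 a difference would persist on a nonempty open subset of the ball, and the
    value at 1 follows by continuity. *)
Lemma radial_profile_unique phi p p' : radial_profile phi p -> radial_profile phi p' ->
  forall r, 0 <= r <= 1 -> p r = p' r.
Proof.
move=> [cp ep] [cp' ep'].
have H r : 0 <= r < 1 -> p r = p' r.
  move=> /andP[r0 r1]; apply/eqP/negPn/negP => pr.
  pose D (x : 'rV[R]_n) := p (clamp (enorm x)) - p' (clamp (enorm x)).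
  have cD : continuous D.
    by move=> x; apply: continuousB_at; exact: continuous_clamped_profile.
  pose x : 'rV[R]_n := r *: delta_mx ord0 i0.
  have xE : enorm x = r by rewrite enorm_axis.
  have oU : open (B `&` D @^-1` [set t | t != 0]).
    apply: openI; first exact: open_B1.
    by apply: open_comp => [y _|]; [exact: cD|exact: open_neq].
  have Ux : (B `&` D @^-1` [set t | t != 0]) x.
    split; first by rewrite /B1/= xE.
    by rewrite /D/= xE clamp_id ?subr_eq0// r0 ltW.
  have [y [By Dy] [h1 h2]] := ae_B1_open (ae_B1_and ep ep') oU (@subIsetl _ _ _) Ux.
  by move: Dy; rewrite /D/= clamp_enorm// -h1 -h2 subrr eqxx.
move=> r /andP[r0]; rewrite le_eqVlt => /predU1P[->|r1]; last by apply: H; rewrite r0.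
apply/eqP/negPn/negP => p1.
have e0 : 0 < `|p 1 - p' 1| / 2 by rewrite divr_gt0// normr_gt0 subr_eq0.
have o1 : 0 <= (1 : R) <= 1 by rewrite ler01 lexx.
have [d d0 hd] := profile_dist cp o1 e0.
have [d' d'0 hd'] := profile_dist cp' o1 e0.
pose m := Num.max 0 (Num.max (1 - d) (1 - d')).
have m1 : m < 1 by rewrite !gt_max ltr01/=; apply/andP; split; lra.
have m0 : 0 <= m by rewrite le_max lexx.
have md : 1 - d <= m by rewrite !le_max lexx ?orbT.
have md' : 1 - d' <= m by rewrite !le_max lexx ?orbT.
pose s := (m + 1) / 2.
have s01 : 0 <= s <= 1 by rewrite /s; lra.
have n1 : `|1 - s| < d by rewrite ger0_norm /s; lra.
have n2 : `|1 - s| < d' by rewrite ger0_norm /s; lra.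
have := hd s s01 n1; have := hd' s s01 n2; rewrite (H s); last by rewrite /s; lra.
have := ler_normD (p 1 - p' s) (p' s - p' 1).
rewrite addrA subrK [`|p' s - _|]distrC; lra.
Qed.

End nodal_domains.

(** * The counts of positive and negative domains *)

Section counting.
Context {R : realType} {n : nat} (i0 : 'I_n) (lam sigma : R) (V phi : 'rV[R]_n -> R)
  (p : R -> R) (phis : nat -> 'rV[R]_n -> R) (k : nat).
Context (wV : weight V) (Hphi : sobolevH10 phi) (mu_gt0 : 0 < lam + sigma)
  (eigen_phi : weak_eigen V (lam + sigma) (avg V phi) phi) (avg_gt0 : 0 < avg V phi)
  (profile_p : radial_profile phi p) (k_gt0 : (0 < k)%N)
  (L2_phis : forall j, (1 <= j < k)%N -> L2 (phis j))
  (minimal : forall u, admissible V phis k u -> sigma <= rayleigh lam V u).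

Notation B := (@B1 R n).
Notation dp r := (deriv_in `[0, 1]%classic p r).

(** Applied twice: to the positive domains, and to the zones that follow the negative ones. *)
Lemma card_positive_intervals (T : finType) (P : {set T}) (a b r : T -> R) :
  (forall i, i \in P -> [/\ a i < r i < b i, 0 <= r i & 0 < p (r i)]) ->
  (forall i, i \in P -> [/\ b i <= 1, 0 <= a i -> p (a i) <= 0 & b i < 1 -> p (b i) <= 0]) ->
  {in P &, forall i j, i != j -> b i <= a j \/ b j <= a i} -> (#|P| <= k)%N.
Proof.
move=> hr hab disj; rewrite leqNgt; apply/negP => kP.
pose g (i : 'I_k.+1) : T := enum_val (widen_ord kP i).
have gP i : g i \in P by exact: enum_valP.
apply: (@no_positive_intervals R n lam sigma V phi p phis k
  (a \o g) (b \o g) (r \o g) i0) => //= [i|i|i|i|i|i|i j ij].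
- by case: (hr _ (gP i)).
- by case: (hr _ (gP i)).
- by case: (hr _ (gP i)).
- by case: (hab _ (gP i)).
- by case: (hab _ (gP i)).
- by case: (hab _ (gP i)).
- apply: disj => //; apply: contra ij => /eqP/enum_val_inj/(congr1 val)/= ij.
  exact/eqP/val_inj.
Qed.

(** The derivative is known to be nonzero only on bounding spheres of radius less than 1; this makes
    that condition available at the outer end of a negative domain. *)
Lemma negative_domain_lt1 a b : interval_domain p a b -> negative_on p a b -> b < 1.
Proof.
move=> [ha ab /andP[b0 b1] _ _] neg; rewrite lt_neqAle b1 andbT; apply/eqP => bE.
have [cp ep] := profile_p; have cc := @continuous_clamped_profile R n p cp.
have a01 : 0 <= Num.max a 0 < 1 by rewrite le_max lexx orbT gt_max ltr01 -bE ab.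
apply: (not_negative_near_boundary i0 wV Hphi mu_gt0 eigen_phi avg_gt0
  (bdd_continuous cc) (fun x _ => cc x) _ a01) => [|x Bx].
  by apply: ae_B1S ep => x Bx ->; rewrite clamp_enorm.
rewrite clamp_enorm// gt_max => /andP[ax _]; apply: neg; first exact: enorm_ge0.
by rewrite ax bE.
Qed.

Lemma no_nodal_domains (g : 'I_(2 * k).+1 -> set 'rV[R]_n) : injective g ->
  (forall i, exists p', radial_profile phi p' /\ nodal_domain_of_profile p' (g i)) ->
  False.
Proof.
move=> ginj hg.
have /choice[ab hab] : forall i, exists ab : R * R, [/\ g i = shell ab.1 ab.2,
    interval_domain p ab.1 ab.2, inner_zeros p ab.1 ab.2 &
    somewhere_positive p ab.1 ab.2 \/ negative_on p ab.1 ab.2].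
  move=> i; have [p' [prof' /(nodal_interval i0)[a [b [gE dom zer sgn]]]]] := hg i.
  have pp := radial_profile_unique i0 profile_p prof'.
  have [ha ab /andP[b0 b1] pa pb] := dom.
  have pp' r : 0 <= r -> a < r < b -> p r = p' r.
    by move=> r0 /andP[_ rb]; apply: pp; rewrite r0 (le_trans (ltW rb)).
  have dd r : 0 <= r <= 1 -> dp r = deriv_in `[0, 1]%classic p' r.
    move=> r01; apply: deriv_in_ext; last by rewrite /= in_itv.
    by move=> s; rewrite /= in_itv; exact: pp.
  exists (a, b); split => //=.
  - split => //; first by rewrite b0.
      move=> a0; have a01 : 0 <= a <= 1 by rewrite a0 (le_trans (ltW ab)).
      by rewrite pp// dd//; exact: pa.
    have b01 : 0 <= b <= 1 by rewrite ltW.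
    by rewrite pp// dd.
  - move=> r r0 rab; rewrite pp'// dd; first exact: zer.
    by case/andP: rab => _ rb; rewrite r0 (le_trans (ltW rb)).
  - case: sgn => [[r [r0 rab pr]]|neg]; first by left; exists r; rewrite pp'.
    by right => r r0 rab; rewrite pp'//; exact: neg.
pose a i := (ab i).1; pose b i := (ab i).2.
have disj i j : i != j -> b i <= a j \/ b j <= a i.
  have [gi di zi _] := hab i; have [gj dj zj _] := hab j.
  move=> /eqP ij; have [[ea eb]||] := interval_domain_eq di zi dj zj.
  - by case: ij; apply: ginj; rewrite gi gj ea eb.
  - by left.
  - by right.
have b1 i : b i <= 1 by have [_ [_ _ /andP[]]] := hab i.
have b0 i : 0 < b i by have [_ [_ _ /andP[]]] := hab i.
have alb i : a i < b i by have [_ []] := hab i.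
have pa i : 0 <= a i -> p (a i) = 0.
  by move=> ai0; have [_ [_ _ _ /(_ ai0)[]]] := hab i.
have pb i : p (b i) = 0 by have [_ [_ _ _ _ []]] := hab i.
pose P := [set i | `[< somewhere_positive p (a i) (b i) >]]%SET.
have leP : (#|P| <= k)%N.
  have /choice[r hr] : forall i, exists r, i \in P -> [/\ a i < r < b i, 0 <= r & 0 < p r].
    move=> i; have [|_] := boolP (i \in P); last by exists 0.
    by rewrite inE => /asboolP[r [r0 rab pr]]; exists r.
  apply: (@card_positive_intervals _ P a b r) => // [i _|i j _ _]; last exact: disj.
  by split => // [/pa->|_]; rewrite ?pb.
have neg i : i \in ~: P -> negative_on p (a i) (b i).
  rewrite !inE => /asboolPn nP; have [_ _ _ [|//]] := hab i.
  by move=> /nP.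
have leN : (#|~: P| <= k)%N.
  have /choice[d hd] : forall i, exists d, i \in ~: P ->
      0 < d /\ forall r, b i < r < b i + d -> r <= 1 -> 0 < p r.
    move=> i; have [iN|_] := boolP (i \in ~: P); last by exists 0.
    have [_ dom _ _] := hab i.
    have bi1 := negative_domain_lt1 dom (neg i iN).
    have [_ _ _ _ [_ /(_ bi1) db]] := dom.
    have b01 : 0 < b i < 1 by rewrite b0.
    have [d d0 dP] := positive_after b01 (alb i) (pb i) db (neg i iN).
    by exists d.
  (* The inner radius of the next negative domain, or 1 if there is none. The intervals from [b i]
     to [e i] are disjoint: if [b i <= a j], then [e i <= a j < b j]. *)
  pose e i := \big[Num.min/1]_(j in ~: P | b i <= a j) a j.
  (* Two negative domains cannot share a bounding sphere, because [p] is positive just outside the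
     first one. *)
  have be i : i \in ~: P -> b i < e i.
    move=> iN; have [d0 dP] := hd i iN.
    apply/bigmin_gtP; split.
      have [_ dom _ _] := hab i; exact: negative_domain_lt1 dom (neg i iN).
    move=> j /andP[jN bij]; rewrite lt_neqAle bij andbT; apply/eqP => E.
    pose r := (b i + Num.min (b j) (b i + d i)) / 2.
    have h1 : Num.min (b j) (b i + d i) <= b j by rewrite ge_min lexx.
    have h2 : Num.min (b j) (b i + d i) <= b i + d i by rewrite ge_min lexx orbT.
    have h3 : b i < Num.min (b j) (b i + d i) by rewrite lt_min E alb -E ltrDl.
    have bi0 := b0 i; have bj1 := b1 j.
    have r0 : 0 < p r by apply: dP; rewrite /r; lra.
    have : p r < 0 by apply: neg jN _ _ _; rewrite /r -?E; lra.
    by rewrite ltNge (ltW r0).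
  pose r i := (b i + Num.min (e i) (b i + d i)) / 2.
  have e1 i : e i <= 1 by exact: bigmin_le_id.
  apply: (@card_positive_intervals _ _ b e r).
  - move=> i iN; have [d0 dP] := hd i iN.
    have h1 : Num.min (e i) (b i + d i) <= e i by rewrite ge_min lexx.
    have h2 : Num.min (e i) (b i + d i) <= b i + d i by rewrite ge_min lexx orbT.
    have h3 : b i < Num.min (e i) (b i + d i) by rewrite lt_min be//= ltrDl.
    have bi0 := b0 i; have ei1 := e1 i.
    split; [by rewrite /r; lra|by rewrite /r; lra|].
    by apply: dP; rewrite /r; lra.
  (* If [e i < 1], the minimum is one of the radii [a j], where [p] vanishes; the induction over the
     minimum avoids naming [j]. *)
  - move=> i iN; split => // [_|]; first by rewrite pb.
    rewrite /e; elim/big_ind: _ => [|x y hx hy|j /andP[_ bij] _]; first by rewrite ltxx.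
      by rewrite minElt; case: ifP.
    by rewrite pa// (le_trans (ltW (b0 i))).
  - have eb i j : i \in ~: P -> j \in ~: P -> b i <= a j -> e i <= b j.
      move=> iN jN bij; apply: le_trans (ltW (alb j)).
      by apply: bigmin_le_cond; rewrite jN.
    by move=> i j iN jN /disj[] h; [left|right]; exact: eb.
have := cardsC P; rewrite card_ord => E.
by have := leq_add leP leN; rewrite E addnn -mul2n ltnn.
Qed.

End counting.

(** * The weight of a solution *)

Section solution_weight.
Context {R : realType} {n : nat} (f : R -> R) (lam alpha : R) (psi : 'rV[R]_n -> R).
Context (f_C2 : C2_in `[0, +oo[%classic f)
  (f'_gt0 : forall t, 0 < t -> 0 < deriv_in `[0, +oo[%classic f t)
  (lam_ge0 : 0 <= lam) (psi_sol : constrained_solution f lam alpha psi).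

Notation B := (@B1 R n).
Notation cB := (@cB1 R n).

(** Since [alpha > 0], the argument of [f'] stays away from 0 on the closed ball, in the range where
    [f'] is known to be positive. *)
Let arg_ge (x : 'rV[R]_n) : cB x -> alpha <= alpha + lam * psi x.
Proof.
have [_ _ _ pos zer] := psi_sol.
rewrite /cB1/= le_eqVlt lerDl => /predU1P[/zer->|/pos/ltW]; first by rewrite mulr0.
exact: mulr_ge0.
Qed.

(** [V] is continuous up to the unit sphere, because [f'] is derivable, hence continuous, and [psi]
    is continuous on the closed ball; boundedness follows by compactness. *)
Lemma weight_solution :
  weight (fun x => deriv_in `[0, +oo[%classic f (alpha + lam * psi x)).
Proof.
have [[alpha0 [psic _ _]] _ _ pos zer] := psi_sol.
have [_ f2 _] := f_C2.
set V := fun x => _.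
have cV : {within cB, continuous V}.
  apply/subspace_continuousP => x Bx; apply/cvgrPdist_lt => e e0.
  have arg0 y : cB y -> `[0, +oo[%classic (alpha + lam * psi y).
    by move=> By; rewrite /= in_itv/= andbT (le_trans (ltW alpha0))// arg_ge.
  have [d d0 hd] := derivable_in_continuous (f2 _ (arg0 x Bx)) e0.
  (* [lam + 1] replaces [lam] as a Lipschitz constant, so that the division is also legitimate for
     [lam = 0]. *)
  have l0 : 0 < lam + 1 by rewrite ltr_wpDl.
  have /subspace_continuousP/(_ x Bx)/cvgrPdist_lt/(_ (d / (lam + 1))) := psic.
  rewrite divr_gt0// => /(_ isT); rewrite !near_withinE; apply: filterS => y hy By.
  apply: hd; first exact: arg0.
  have -> : alpha + lam * psi x - (alpha + lam * psi y) = lam * (psi x - psi y) by ring.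
  rewrite normrM ger0_norm//.
  apply: (@le_lt_trans _ _ ((lam + 1) * `|psi x - psi y|)).
    by rewrite ler_wpM2r// lerDl.
  by rewrite mulrC -ltr_pdivlMr//; exact: hy.
split; first exact: bdd_cB1.
  by move=> x Bx; apply: f'_gt0; apply: lt_le_trans (arg_ge _) => //; exact: B1_subset_cB1.
move: (continuous_subspaceW (@B1_subset_cB1 R n) cV).
by rewrite continuous_open_subspace; [move=> h x Bx; apply: h; rewrite inE|exact: open_B1].
Qed.

End solution_weight.

(** * Passing from an eigenfunction to its opposite *)

Section sign_change.
Context {R : realType} {n : nat}.
Implicit Types (V phi : 'rV[R]_n -> R) (p : R -> R).

Lemma avgN V phi : weight V -> L2 phi -> avg V (fun x => - phi x) = - avg V phi.
Proof.
move=> wV Lp; rewrite /avg -mulNr; congr (_ / _).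
rewrite -mulN1r -intBZ; last exact/L2_itg/L2_weight.
by apply: eq_intB => x _; ring.
Qed.

Lemma weak_eigenN V m c phi : weight V -> sobolevH10 phi -> weak_eigen V m c phi ->
  weak_eigen V m (- c) (fun x => - phi x).
Proof.
move=> wV Hphi he v Hv; have [HN gN] := H10N Hphi.
have Lp := H10_L2 Hphi; have ig := itg_grad_dot Hphi Hv.
rewrite (@ae_eq_intB _ _ _ (fun x => -1 * grad_dot phi v x)); last first.
- apply: ae_B1S (ae_B1_forall gN) => x _ gx; rewrite /grad_dot mulN1r -sumrN.
  by apply: eq_bigr => i _; rewrite gx mulNr.
- by apply: itg_measurable; exact: itgZ.
- by apply: itg_measurable; exact: itg_grad_dot.
rewrite intBZ// he// mulrCA -(@intBZ _ _ (-1)); last first.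
  by apply: L2M; [exact/L2_weight/L2_subc|exact: H10_L2].
by congr (_ * _); apply: eq_intB => x _; ring.
Qed.

Lemma radial_profileN phi p : radial_profile phi p ->
  radial_profile (fun x => - phi x) (fun r => - p r).
Proof.
move=> [cp ep]; split; last by apply: ae_B1S ep => x _ ->.
by move=> x; apply: continuousN; exact: cp.
Qed.

End sign_change.

Theorem theorem1p7 (R : realType) (n : nat) (f : R -> R) (lam alpha : R)
    (psi : 'rV[R]_n -> R)
    (n_ge2 : (2 <= n)%N)
    (f_ge0 : forall t, 0 <= t -> 0 <= f t)
    (f_C2 : C2_in `[0, +oo[ f)
    (f'_gt0 : forall t, 0 < t -> 0 < deriv_in `[0, +oo[ f t)
    (lam_ge0 : 0 <= lam)
    (psi_sol : constrained_solution f lam alpha psi) :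
  let V := fun x => deriv_in `[0, +oo[ f (alpha + lam * psi x) in
  forall (k : nat) (phi : 'rV[R]_n -> R), (1 <= k)%N ->
    kth_radial_eigenfunction lam V k phi ->
    ([set Om | generalized_nodal_domain V phi Om] #<= `I_(2 * k))%card.
Proof.
move=> V k phi k_gt0 [sigma [phis [enum _ eig]]].
have i0 : 'I_n := Ordinal (ltnW n_ge2).
have wV : weight V := weight_solution f_C2 f'_gt0 lam_ge0 psi_sol.
have [Hphi nz _] := eig; have he := eigenfunction_weak eig.
have mu_gt0 : 0 < lam + sigma k := weak_eigen_gt0 i0 wV Hphi nz he.
have L2_phis j : (1 <= j < k)%N -> L2 (phis j).
  move=> /andP[j1 /ltnW jk]; have [[Hj _ _ _] _ _ _] := enum j (introT andP (conj j1 jk)).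
  exact: H10_L2.
have [_ _ _ minimal] := enum k (introT andP (conj k_gt0 (leqnn k))).
apply: contrapT => /(@not_card_le_II (set 'rV[R]_n))[g ginj gP].
have [avg_lt0|avg_gt0|avg0] := ltgtP (avg V phi) 0.
(* The minimality of [sigma k] is a statement about admissible functions that does not involve
   [phi], so it serves [- phi] unchanged. *)
- have avgNE : avg V (fun x => - phi x) = - avg V phi by rewrite avgN//; exact: H10_L2.
  have [HN _] := H10N Hphi.
  have heN : weak_eigen V (lam + sigma k) (avg V (fun x => - phi x)) (fun x => - phi x).
    by rewrite avgNE; exact: weak_eigenN.
  have avgN_gt0 : 0 < avg V (fun x => - phi x) by rewrite avgNE oppr_gt0.
  have [p [prof _]] := gP ord0.
  apply: (no_nodal_domains i0 wV HN mu_gt0 heN avgN_gt0 (radial_profileN prof) k_gt0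
    L2_phis minimal ginj) => i.
  have [q [profq [[c0 _]|[_ dom]]]] := gP i; first by have := lt_trans c0 avg_lt0; rewrite ltxx.
  by exists (fun r => - q r); split => //; exact: radial_profileN.
- have [p [prof _]] := gP ord0.
  apply: (no_nodal_domains i0 wV Hphi mu_gt0 he avg_gt0 prof k_gt0
    L2_phis minimal ginj) => i.
  have [q [profq [[_ dom]|[c0 _]]]] := gP i; first by exists q.
  by have := lt_trans c0 avg_gt0; rewrite ltxx.
(* With average 0 the definition admits no domain at all, whereas [g] provides at least one. *)
- by have [q [_ [[+ _]|[+ _]]]] := gP ord0; rewrite avg0 ltxx.
Qed.
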